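(* Let $\alpha>1$ and let $X$ be a strongly vertex-reinforced jump process on a finite complete graph $G=(V,E)$ with weight function $w(t)=t^{\alpha}$, with local times $L(v,t)$, $v\in V$, $t\ge 0$. Then almost surely there exists a vertex $v\in V$ such that $L(v,t)\to\infty$ as $t\to\infty$, while for every $u\in V\setminus\{v\}$ the local time $L(u,t)$ remains bounded as $t\to\infty$.
   Context: Let $G=(V,E)$ be a finite connected undirected graph without loops, $V=\{1,\dots,d\}$. Fix positive initial local times $\ell_0^{(v)}>0$, $v\in V$. A vertex-reinforced jump process (VRJP) with weight function $w$ is a continuous-time càdlàg jump process $X=(X_t)_{t\ge0}$ on $V$ such that, at each time $t>0$, conditionally on $\mathcal F_t=\sigma(X_s,\,s\le t)$, for each neighbour $v$ of $X_t$ the probability that $X$ jumps from $X_t$ to $v$ during $(t,t+h]$ is $w(L(v,t))\,h+o(h)$ as $h\to0$, where $L(v,t)=\ell_0^{(v)}+\int_0^t\mathbf 1_{\{X_s=v\}}\,ds$ is the local time at $v$ up to time $t$. For $w(t)=t^\alpha$ the process is called strongly vertex-reinforced when $\alpha>1$.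
   Formalization: The o(h) in the definition of the process is taken uniform over outcomes and over t in bounded time intervals; with an o(h) only at each fixed t, additional forced jumps at deterministic times would be allowed and the claim would fail. *)

(* Defs.v *)
From HB Require Import structures.
From mathcomp Require Import all_boot all_order all_algebra.
From mathcomp Require Import all_classical all_reals all_analysis.

Set Implicit Arguments.
Unset Strict Implicit.
Unset Printing Implicit Defensive.

Import Order.TTheory GRing.Theory Num.Theory.
Import numFieldNormedType.Exports.

Local Open Scope classical_set_scope.
Local Open Scope ring_scope.

(* Graphs are adjacency relations on a finite type of vertices. *)
Definition complete_graph (V : finType) : rel V := fun u v => u != v.

(* A version f of the conditional probability P(B | G), where G is the
   sigma-algebra generated by C. *)
Definition is_cond_prob (R : realType) (d : measure_display)
    (Omega : measurableType d) (P : probability Omega R)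
    (C : set (set Omega)) (B : set Omega) (f : Omega -> R) : Prop :=
  [/\ measurable_fun [set: g_sigma_algebraType C]
        (f : g_sigma_algebraType C -> R),
      P.-integrable [set: Omega] (EFin \o f) &
      forall A, <<s C >> A -> (\int[P]_(w in A) (f w)%:E = P (A `&` B))%E].

Section process.
Context {R : realType} {d : measure_display} {Omega : measurableType d}.
Context {V : finType}.
Implicit Types (X : R -> Omega -> V) (t : R) (w : Omega) (u v : V).

(* V carries the discrete topology, so one-sided limits in V are eventual
   equalities. Processes are indexed by R but only times t >= 0 matter. *)
Definition left_limit X t w u : Prop := \forall s \near t^'-, X s w = u.

Definition cadlag X : Prop := forall w,
  (forall t, 0 <= t -> \forall s \near t^'+, X s w = X t w) /\
  (forall t, 0 < t -> exists u, left_limit X t w u).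

(* The generators of F_t = sigma(X_s, s <= t). *)
Definition history X t : set (set Omega) :=
  [set A | exists s v, 0 <= s <= t /\ A = X s @^-1` [set v]].

Definition local_time (l0 : V -> R) X v t w : R :=
  l0 v + (\int[lebesgue_measure]_(s in `[0, t]) (X s w == v)%:R)%R.

(* X jumps from X_t to v during (t, t + h]. *)
Definition jump_event X t h v : set Omega :=
  [set w | exists s, [/\ t < s <= t + h, left_limit X s w (X t w) &
                         X s w = v]].

(* The error term o(h) is uniform over outcomes and over t in bounded intervals.
   With an o(h) depending on t the rates would not determine the process: jumps
   at prescribed deterministic times are invisible to the right-hand limit
   h -> 0+ at each fixed t. *)
Record is_vrjp (P : probability Omega R) (e : rel V) (W : R -> R)
    (l0 : V -> R) X : Prop := {
  vrjp_measurable : forall t v, 0 <= t -> measurable (X t @^-1` [set v]) ;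
  vrjp_cadlag : cadlag X ;
  vrjp_edge : forall t w u, 0 < t -> left_limit X t w u ->
    X t w = u \/ e u (X t w) ;
  vrjp_rate : forall T eps : R, 0 < eps ->
    \forall h \near 0^'+, forall t v, 0 < t <= T ->
      exists2 p : Omega -> R,
        is_cond_prob P (history X t) (jump_event X t h v) p &
        {ae P, forall w, e (X t w) v ->
           `|p w - W (local_time l0 X v t w) * h| <= eps * h} }.

End process.

(* Main.v *)
Require Import Defs.
From HB Require Import structures.
From mathcomp Require Import all_boot all_order all_algebra.
From mathcomp Require Import all_classical all_reals all_analysis.
From mathcomp Require Import measurable_realfun zify ring lra.

Set Implicit Arguments.
Unset Strict Implicit.
Unset Printing Implicit Defensive.

Import Order.TTheory GRing.Theory Num.Theory.
Import numFieldNormedType.Exports.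

Local Open Scope classical_set_scope.
Local Open Scope ring_scope.

(** The local times add up to at least the elapsed time, so at every outcome
    some local time tends to infinity. The theorem therefore says that, for
    any two vertices a and b, the event that both local times tend to infinity
    is negligible. This is proved with a Lyapunov function G(x, L) of the
    position x and of the configuration L of local times: G is bounded below,
    its expectation along the process does not increase, and it tends to
    infinity when L a and L b both do ([exists_lyapunov],
    [lyap_value_decreases], [both_infinite_negligible]). Markov's inequality
    then excludes that both local times diverge.

    Write W(s) = s^alpha and H for the sum of the W(L v), and let phi be the
    antiderivative of 1/W that vanishes at infinity; it exists because
    alpha > 1. The offset N = phi(L a) - phi(L b) is nearly a martingale, since
    a vertex v is entered at rate W(L v) and each unit of time spent there
    moves phi(L v) by 1/W(L v). If both local times diverge, then N tends to
    0. The sum S of the L v / W(L v)^3 over v = a, b is comparable to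
    the variance that N still has to accumulate, and both S and
    q = 2 S + N^2 tend to 0 on the same event. A process on the line whose
    variance follows a prescribed schedule almost surely does not end at a
    prescribed point, which is made quantitative by the wall function
    - ln q + c S / q: for N^2 much larger than S the decrease of c S / q pays
    for the convexity of - ln(N^2), and for N close to 0 the concavity of the
    wall in N pays for the decrease of S ([main_bracket]).

    The position x is averaged out by a corrector. With g the derivative of the
    wall in N, the term g / (W(L a) H) is added when x = a and subtracted,
    with W(L b), when x = b. Weighted by the jump rates the corrections at a
    and b cancel, so jumping away replaces the correction by 0 on average; this
    exactly removes the first-order drift of the wall along the flow and leaves
    the second-order term g' / (W^2 H), collected in [main_term], and remainders
    collected in [error_term]. The remainders are integrable along the growth of
    L a and are absorbed by the decrease of E0 / sqrt(L W(L)).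

    The variance schedule is followed only as long as H is at most a multiple
    of W(L a). Otherwise L a is a small share of the total time, and the excess,
    at most a multiple of 1 / L a, is compensated by [cut_corr] and by
    [cutoff]: a vertex with a small share gains share while it is occupied and
    loses share otherwise, and on a complete graph, where H is comparable to W
    of the total time by the power mean inequality, the loss dominates.

    On the probabilistic side, over (t, t + h] the process stays put, or makes
    one jump, or has at least two changes of position; the last event has
    probability O(h^2) ([multi_moves_pr_le]). On the first two events the
    increment of G is, up to o(h), the descent along the flow plus a term with
    small mean given the past ([increment_le], [noise_sum_small]).
    Summing over a fine grid gives the supermartingale inequality. *)

(** * Drift of the wall function: the algebraic inequalities *)

Section Algebra.
Variable R : realFieldType.
Implicit Types (A W V H N S q k c L b u x : R).

(** The combination of drift coefficients is a concave quadratic in x = S / q,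
    as N^2 / q = 1 - 2 x. Its value is good near x = 1/2 because of - 16 c x^2 b,
    and near x = 0 because of - c k u. Its distance to the bound splits into three
    terms that are nonnegative since b <= u and 2 <= k. *)
Lemma main_bracket k c u b x : 2 <= k -> 0 <= c -> 0 <= b -> b <= u ->
  0 <= x -> x <= 1/2 ->
  - (k * u) * (c - 2 - 2 * c * x) + b * (2 - 8 * x + 6 * c * x - 16 * c * x ^+ 2)
  <= 2 * k * u - (7/16 * c - 2) * b.
Proof.
move=> k2 c0 b0 bu x0 x1.
rewrite -subr_ge0.
have -> : 2 * k * u - (7/16 * c - 2) * b - (- (k * u) * (c - 2 - 2 * c * x) +
    b * (2 - 8 * x + 6 * c * x - 16 * c * x ^+ 2)) =
  c * ((k * u - 2 * b) * (1 - 2 * x)) + c * b * (4 * x - 5/4) ^+ 2 + 8 * (b * x).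
  by field.
have ku : 2 * b <= k * u by apply: ler_pM => //; lra.
apply: addr_ge0; last by rewrite mulr_ge0// mulr_ge0.
apply: addr_ge0; last by rewrite mulr_ge0 ?sqr_ge0// mulr_ge0.
by rewrite !mulr_ge0// ?subr_ge0//; lra.
Qed.

Variables (A W V H N S q k c : R).
Hypotheses (A0 : 0 < A) (W0 : 0 < W) (V0 : 0 < V) (VV : V ^+ 2 = W * A).
Hypotheses (WH : W <= H) (SA : A / W ^+ 3 <= S) (qE : q = 2 * S + N ^+ 2).
Hypotheses (k2 : 2 <= k) (c0 : 0 <= c).

Let H0 : 0 < H. Proof. exact: lt_le_trans WH. Qed.
Let S0 : 0 < S. Proof. by apply: lt_le_trans SA; rewrite divr_gt0// exprn_gt0. Qed.
Let q0 : 0 < q.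
Proof. by rewrite qE ltr_wpDr ?sqr_ge0// mulr_gt0. Qed.
Let Sq0 : 0 <= S / q. Proof. by rewrite divr_ge0 ?ltW. Qed.
Let Sq1 : S / q <= 1/2.
Proof.
rewrite ler_pdivrMr// qE; have := sqr_ge0 N; lra.
Qed.

(** With g(S, N) = - ln q + c S / q, this is g_S S' + g_NN / (W^2 H): the drift
    due to the loss of remaining variance, S' = - k / W^3, and to the volatility
    of N. *)
Definition main_term : R :=
  - (k / W ^+ 3) * (- 2 / q + c / q - 2 * c * S / q ^+ 2) +
  (- 2 / q + 4 * N ^+ 2 / q ^+ 2 - 2 * c * S / q ^+ 2 + 8 * c * S * N ^+ 2 / q ^+ 3)
   / (W ^+ 2 * H).

Lemma main_term_le : main_term <=
  (2 * k / W ^+ 3 - (7/16 * c - 2) / (W ^+ 2 * H)) / q.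
Proof.
have Wn : W != 0 by rewrite gt_eqF.
have Hn : H != 0 by rewrite gt_eqF.
have qn : q != 0 by rewrite gt_eqF.
rewrite ler_pdivlMr//.
have b0 : 0 <= (W ^+ 2 * H)^-1 by rewrite invr_ge0 mulr_ge0 ?exprn_ge0 ?ltW.
have bu : (W ^+ 2 * H)^-1 <= (W ^+ 3)^-1.
  by rewrite lef_pV2 ?posrE ?mulr_gt0 ?exprn_gt0// (exprSr _ 2) ler_pM2l ?exprn_gt0.
have := main_bracket k2 c0 b0 bu Sq0 Sq1.
apply: le_trans; rewrite le_eqVlt; apply/orP; left; apply/eqP.
rewrite /main_term; have -> : N ^+ 2 = q - 2 * S by rewrite qE; ring.
by field; rewrite Wn Hn qn.
Qed.

Lemma inv_q_le : q^-1 <= W ^+ 3 / (2 * A).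
Proof.
have -> : W ^+ 3 / (2 * A) = (2 * (A / W ^+ 3))^-1.
  by rewrite !invfM invrK; ring.
rewrite lef_pV2 ?posrE ?mulr_gt0 ?invr_gt0 ?exprn_gt0//.
rewrite qE; have := sqr_ge0 N; have := SA; lra.
Qed.

(** Without control of H the volatility of N may be negligible with respect to the
    schedule S'; what remains positive is of order 1 / A only. *)
Lemma main_term_le_inv : 32/7 <= c -> main_term <= k / A.
Proof.
move=> c7; apply: (le_trans main_term_le).
have -> : k / A = (2 * k / W ^+ 3) * (W ^+ 3 / (2 * A)).
  by field; rewrite !gt_eqF.
apply: (@le_trans _ _ (2 * k / W ^+ 3 / q)).
  rewrite ler_pM2r ?invr_gt0// gerBl divr_ge0//; first lra.
  by rewrite mulr_ge0 ?exprn_ge0 ?ltW.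
rewrite ler_pM2l ?inv_q_le// divr_gt0 ?exprn_gt0//.
by rewrite mulr_gt0//; apply: lt_le_trans k2.
Qed.

(** If H is comparable to W, then N really receives the scheduled volatility, and a
    large c makes the wall a supersolution. *)
Lemma main_term_le0 L : H <= L * W -> 2 * k * L <= 7/16 * c - 2 -> main_term <= 0.
Proof.
move=> HL cL; apply: (le_trans main_term_le).
rewrite pmulr_lle0 ?invr_gt0// subr_le0.
rewrite ler_pdivlMr ?mulr_gt0 ?exprn_gt0//.
have -> : 2 * k / W ^+ 3 * (W ^+ 2 * H) = 2 * k * (H / W).
  by field; rewrite !gt_eqF.
apply: le_trans cL; rewrite ler_pM2l; last by rewrite mulr_gt0//; apply: lt_le_trans k2.
by rewrite ler_pdivrMr.
Qed.

(** The arithmetic-geometric mean inequality q >= 2 |N| sqrt(2 S), combined with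
    S >= A / W^3 = V^2 / W^4. *)
Lemma norm_ratio_le : `|N| / q <= W ^+ 2 / (2 * V).
Proof.
rewrite ler_pdivrMr// mulrAC ler_pdivlMr ?mulr_gt0//.
have W2 : 0 < W ^+ 2 by rewrite exprn_gt0.
rewrite -(ler_pM2l (x := W ^+ 2)) //.
have h : V ^+ 2 <= W ^+ 4 * S.
  rewrite VV; have -> : W * A = W ^+ 4 * (A / W ^+ 3) by field; rewrite gt_eqF.
  by rewrite ler_pM2l ?exprn_gt0.
have -> : W ^+ 2 * (`|N| * (2 * V)) = 2 * V * (W ^+ 2 * `|N|) by ring.
have -> : W ^+ 2 * (W ^+ 2 * q) = 2 * (W ^+ 4 * S) + (W ^+ 2 * `|N|) ^+ 2.
  by rewrite qE exprMn real_normK ?num_real//; ring.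
set y := W ^+ 2 * `|N|; have := sqr_ge0 (V - y).
have := sqr_ge0 V; nra.
Qed.

(** The derivative of - ln q + c S / q in N. *)
Definition slope_term : R := - (2 * N / q) * (1 + c * (S / q)).

Lemma norm_slope_le : `|slope_term| <= (2 + c) / 2 * (W ^+ 2 / V).
Proof.
rewrite /slope_term normrM normrN normrM (ger0_norm (_ : 0 <= 1 + c * (S / q))); last first.
  by rewrite addr_ge0// mulr_ge0.
have -> : `|2 * N| * `|q^-1| = 2 * (`|N| / q).
  by rewrite normrM (ger0_norm (ler0n _ 2)) (gtr0_norm (_ : 0 < q^-1)) ?invr_gt0// mulrA.
have h1 : 1 + c * (S / q) <= (2 + c) / 2.
  have := ler_wpM2l c0 Sq1; lra.
have h2 := norm_ratio_le.
have h3 : 2 * (`|N| / q) <= W ^+ 2 / V.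
  have -> : W ^+ 2 / V = 2 * (W ^+ 2 / (2 * V)) by field; rewrite gt_eqF.
  by rewrite ler_pM2l.
rewrite mulrC; apply: ler_pM => //.
- by rewrite addr_ge0// mulr_ge0.
- by rewrite mulr_ge0// divr_ge0// ltW.
Qed.

(** What the derivative of g_N / (W H) produces besides g_NN / (W^2 H): the mixed
    derivative g_NS S', and the growth of W and of H. *)
Definition error_term al : R :=
  (4 * N / q ^+ 2 - 2 * c * N / q ^+ 2 + 8 * c * S * N / q ^+ 3) * (- (k / W ^+ 3)) / (W * H)
  - slope_term * (al / A) * (1 / (W * H)) * (1 + W / H).

(** The bound 1 / (V A), with V = A^((al + 1) / 2), is integrable in A at infinity,
    so that a decreasing function of A can compensate it. *)
Lemma error_term_le al : 0 <= al ->
  error_term al <= ((1 + 3/2 * c) * k + (2 + c) * al) / (V * A).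
Proof.
move=> al0; have k0 : 0 <= k by apply: le_trans k2.
have Wn : W != 0 by rewrite gt_eqF.
have Hn : H != 0 by rewrite gt_eqF.
have qn : q != 0 by rewrite gt_eqF.
have An : A != 0 by rewrite gt_eqF.
have Vn : V != 0 by rewrite gt_eqF.
apply: le_trans (ler_norm _) _.
apply: le_trans (ler_normB _ _) _.
rewrite [leRHS]mulrDl.
have WHi : 0 <= 1 / (W * H) <= (W ^+ 2)^-1.
  apply/andP; split; first by rewrite divr_ge0// mulr_ge0 ?ltW.
  by rewrite div1r lef_pV2 ?posrE ?mulr_gt0 ?exprn_gt0// expr2 ler_pM2l.
have /andP[i0 i1] := WHi.
apply: lerD.
- have -> : (4 * N / q ^+ 2 - 2 * c * N / q ^+ 2 + 8 * c * S * N / q ^+ 3) *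
     - (k / W ^+ 3) / (W * H) =
     - ((N / q) * (q^-1 * (4 - 2 * c + 8 * c * (S / q))) * (k / W ^+ 3) * (1 / (W * H))).
    by field; rewrite Wn Hn qn.
  rewrite normrN 3!normrM (ger0_norm i0).
  have ->: `|N / q| = `|N| / q by rewrite normrM normfV (gtr0_norm q0).
  have h1 : `|q^-1 * (4 - 2 * c + 8 * c * (S / q))| <= W ^+ 3 / (2 * A) * (4 + 6 * c).
    rewrite normrM; apply: ler_pM; rewrite ?normr_ge0//.
      by rewrite gtr0_norm ?invr_gt0// inv_q_le.
    apply: le_trans (ler_normD _ _) _.
    apply: (@le_trans _ _ ((4 + 2 * c) + 4 * c)); last by lra.
    apply: lerD; first by rewrite ler_norml; apply/andP; split; have := c0; lra.
    rewrite ger0_norm; last by rewrite mulr_ge0// mulr_ge0.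
    have := ler_wpM2l c0 Sq1; have := c0; lra.
  have h2 := norm_ratio_le.
  have kW : 0 <= k / W ^+ 3 by rewrite divr_ge0// exprn_ge0// ltW.
  rewrite (ger0_norm kW).
  have -> : (1 + 3/2 * c) * k / (V * A) =
    (W ^+ 2 / (2 * V)) * (W ^+ 3 / (2 * A) * (4 + 6 * c)) * (k / W ^+ 3) * (W ^+ 2)^-1.
    by field; rewrite Wn Vn An.
  apply: ler_pM => //.
    by rewrite mulr_ge0// mulr_ge0// divr_ge0// ltW.
  apply: ler_wpM2r => //.
  by apply: ler_pM; rewrite ?normr_ge0// divr_ge0 ?normr_ge0// ltW.
- have -> : (2 + c) * al / (V * A) =
    (2 + c) / 2 * (W ^+ 2 / V) * (al / A) * (W ^+ 2)^-1 * 2.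
    by field; rewrite Wn Vn An.
  rewrite 3!normrM.
  have aA : 0 <= al / A by rewrite divr_ge0// ltW.
  have W1 : 0 <= 1 + W / H <= 2.
    have : W / H <= 1 by rewrite ler_pdivrMr// mul1r.
    have : 0 <= W / H by rewrite divr_ge0 ?ltW.
    by move=> *; apply/andP; split; lra.
  rewrite (ger0_norm aA) (ger0_norm i0) (ger0_norm (_ : 0 <= 1 + W / H)); last by lra.
  apply: ler_pM; [by rewrite mulr_ge0// mulr_ge0 | lra | | lra].
  apply: ler_pM => //; first by rewrite mulr_ge0 ?normr_ge0.
  by apply: ler_wpM2r => //; exact: norm_slope_le.
Qed.

End Algebra.

(** * Derivatives of composite real functions *)

Section Calculus.
Variable R : realType.
Implicit Types (f g : R -> R) (x a b : R).

Lemma is_derive_add f g x a b : is_derive x 1 f a -> is_derive x 1 g b ->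
  is_derive x 1 (fun s => f s + g s) (a + b).
Proof. by move=> ? ?; apply: is_deriveD. Qed.

Lemma is_derive_opp f x a : is_derive x 1 f a -> is_derive x 1 (fun s => - f s) (- a).
Proof. by move=> ?; apply: is_deriveN. Qed.

Lemma is_derive_mul f g x a b : is_derive x 1 f a -> is_derive x 1 g b ->
  is_derive x 1 (fun s => f s * g s) (a * g x + f x * b).
Proof.
move=> fa gb; apply: (is_derive_eq (is_deriveM fa gb)).
by rewrite /GRing.scale/= addrC (mulrC (g x)).
Qed.

Lemma is_derive_const x a : is_derive x (1 : R) (fun _ : R => a) 0.
Proof. exact: is_derive_cst. Qed.

Lemma is_derive_scale f x a b : is_derive x 1 f a ->
  is_derive x 1 (fun s => b * f s) (b * a).
Proof.
move=> fa; apply: (is_derive_eq (is_derive_mul (is_derive_const x b) fa)).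
by rewrite mul0r add0r.
Qed.

Lemma is_derive_chain f g x a b : is_derive (f x) 1 g b -> is_derive x 1 f a ->
  is_derive x 1 (fun s => g (f s)) (b * a).
Proof. by move=> gb fa; apply: is_derive1_comp. Qed.

Lemma is_derive_inv f x a : is_derive x 1 f a -> f x != 0 ->
  is_derive x 1 (fun s => (f s)^-1) (- a / f x ^+ 2).
Proof.
move=> fa fx0; have [df Df] := fa.
apply: DeriveDef; first exact: derivableV.
by rewrite deriveV// Df /GRing.scale/= mulNr mulrC mulNr.
Qed.

Lemma is_derive_ln f x a : is_derive x 1 f a -> 0 < f x ->
  is_derive x 1 (fun s => ln (f s)) ((f x)^-1 * a).
Proof.
move=> fa fx; exact: (is_derive_chain (is_derive1_ln fx) fa).
Qed.

Lemma is_derive_pow f x a p : is_derive x 1 f a -> 0 < f x ->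
  is_derive x 1 (fun s => f s `^ p) (p * (f x `^ p / f x) * a).
Proof.
move=> fa fx; apply: (is_derive_eq (is_derive_chain (is_derive1_powR p fx) fa)).
rewrite powRB; last by rewrite (gt_eqF fx) implybT.
by rewrite powRr1// ltW.
Qed.

Lemma is_derive_sq f x a : is_derive x 1 f a ->
  is_derive x 1 (fun s => f s ^+ 2) (2 * f x * a).
Proof.
move=> fa; apply: (is_derive_eq (is_derive_mul fa fa)); ring.
Qed.

(** The positive part is squared in the Lyapunov function so that the mean value
    theorem applies across the threshold. *)
Lemma is_derive_maxsq x :
  is_derive x (1 : R) (fun y : R => (Num.max 0 y) ^+ 2) (2 * Num.max 0 x).
Proof.
have [x0|x0|->] := ltgtP x 0.
- apply: (@near_eq_is_derive _ _ _ (fun _ : R => (0 : R))).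
  + near=> y; rewrite max_l ?expr0n//; apply: ltW; near: y; exact: lt_nbhsl.
  + by rewrite mulr0; exact: is_derive_const.
- apply: (@near_eq_is_derive _ _ _ (fun y : R => y ^+ 2)).
  + near=> y; rewrite max_r//; apply: ltW; near: y; exact: lt_nbhsr.
  + apply: (is_derive_eq (is_derive_sq (is_derive_id x 1))).
    by rewrite mulr1.
- rewrite mulr0.
  have h : (fun h : R => h^-1 * ((Num.max 0 (h * 1 + 0)) ^+ 2 - (Num.max (0 : R) 0) ^+ 2))
     @ 0^' --> (0 : R).
    apply/cvgr0Pnorm_le => e e0; near=> h.
    rewrite maxxx expr0n subr0 addr0 mulr1 normrM normrX expr2 mulrA.
    have hm : `|Num.max 0 h| <= `|h|.
      by case: (lerP 0 h) => ?; rewrite ?normr0.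
    have h0 : h != 0 by near: h; exact: nbhs_dnbhs_neq.
    apply: (@le_trans _ _ `|h|).
      apply: (@le_trans _ _ (1 * `|h|)); last by rewrite mul1r.
      apply: ler_pM => //.
      by rewrite normfV ler_pdivrMl ?normr_gt0// mulr1.
    by near: h; exact: dnbhs0_le.
  apply: DeriveDef; first by apply/cvg_ex; exists 0.
  exact/cvg_lim.
Unshelve. all: by end_near.
Qed.

End Calculus.

(** * Descent of the Lyapunov function while one local time grows *)

Section Lyapunov.
Variables (R : realType) (al c s0 A1 E0 C : R).
Implicit Types (A B T H s : R).

Definition W A : R := A `^ al.
(** The square root of A W(A), see [rootW_sq]. *)
Definition rootW A : R := A `^ ((al + 1) / 2).
(** The antiderivative of 1 / W that vanishes at infinity. *)
Definition phi A : R := - (al - 1)^-1 * (A / W A).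
(** Up to a factor, the integral of 1 / W^3 from A to infinity, and hence the
    variance that the offset still has to accumulate at one vertex. *)
Definition tail A : R := A / W A ^+ 3.
Definition offset A B : R := phi A - phi B.
Definition tails A B : R := tail A + tail B.
(** The squared distance of the offset from 0, regularized by the remaining
    variance. *)
Definition dist2 A B : R := 2 * tails A B + offset A B ^+ 2.
Definition slope A B : R := slope_term (offset A B) (tails A B) (dist2 A B) c.
Definition wall A B : R := - ln (dist2 A B) + c * (tails A B / dist2 A B).
(** The power (A / T)^(al - 1) of the proportion of the total time T. It is written
    as a product so that its derivative along the flow is found by [field]. *)
Definition share A T : R := (W A / A) * (T / W T).
(** Equal to 0 once the share reaches s0, and at least 1/2 when the share is at most
    s0 / 2. *)
Definition cutoff A T : R := Num.max 0 (1 - share A T / s0).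
(** The first term absorbs [error_term]. The second decreases while a vertex of
    small share is not occupied, because its share then decreases. *)
Definition side A T : R := E0 / rootW A - A1 * cutoff A T ^+ 2.
Definition away_value A B T : R := wall A B + (side A T + side B T).
(** The reserve held while the vertex is occupied; it is released at the jump away
    from the vertex, at the rate needed to pay for [main_term]. *)
Definition cut_corr A T : R := C * cutoff A T / A.
Definition corr A B T : R := slope A B / W A + cut_corr A T.
Definition at_value A B T H : R := away_value A B T + corr A B T / H.

Hypotheses (al1 : 1 < al) (s00 : 0 < s0).

Lemma W_gt0 A : 0 < A -> 0 < W A. Proof. exact: powR_gt0. Qed.
Lemma rootW_gt0 A : 0 < A -> 0 < rootW A. Proof. exact: powR_gt0. Qed.
Hint Resolve W_gt0 rootW_gt0 : core.

Lemma rootW_sq A : 0 < A -> rootW A ^+ 2 = W A * A.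
Proof.
move=> A0; rewrite /rootW -powR_mulrn ?powR_ge0// -powRrM.
rewrite -[X in _ = _ * X](powRr1 (ltW A0)) -powRD; last by rewrite (gt_eqF A0) implybT.
by congr (_ `^ _); field.
Qed.

Lemma tail_gt0 A : 0 < A -> 0 < tail A.
Proof. by move=> A0; rewrite divr_gt0// exprn_gt0// W_gt0. Qed.

Lemma tails_gt0 A B : 0 < A -> 0 < B -> 0 < tails A B.
Proof. by move=> A0 B0; rewrite addr_gt0// tail_gt0. Qed.

Lemma dist2_gt0 A B : 0 < A -> 0 < B -> 0 < dist2 A B.
Proof. by move=> A0 B0; rewrite ltr_wpDr ?sqr_ge0// mulr_gt0// tails_gt0. Qed.

Lemma cutoff_ge0 A T : 0 <= cutoff A T. Proof. by rewrite le_max lexx. Qed.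
Lemma share_gt0 A T : 0 < A -> 0 < T -> 0 < share A T.
Proof. by move=> A0 T0; rewrite mulr_gt0// divr_gt0// W_gt0. Qed.
Lemma cutoff_le1 A T : 0 < A -> 0 < T -> cutoff A T <= 1.
Proof.
move=> A0 T0; rewrite ge_max ler01/= gerBl divr_ge0// ltW//; exact: share_gt0.
Qed.

Section derive.
Variables (s : R) (a h t : R -> R).
Hypotheses (a0 : 0 < a s) (da : is_derive s 1 a 1).

Lemma is_derive_W : is_derive s 1 (fun x => W (a x)) (al * (W (a s) / a s)).
Proof. by apply: (is_derive_eq (is_derive_pow al da a0)); rewrite mulr1. Qed.

Lemma is_derive_phi : is_derive s 1 (fun x => phi (a x)) (W (a s))^-1.
Proof.
have Wn : W (a s) != 0 by rewrite gt_eqF// W_gt0.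
apply: (is_derive_eq (is_derive_scale (- (al - 1)^-1) (is_derive_mul da (is_derive_inv is_derive_W Wn)))).
by field; rewrite Wn gt_eqF//= subr_eq0 gt_eqF.
Qed.

Lemma is_derive_tail : is_derive s 1 (fun x => tail (a x)) (- ((3 * al - 1) / W (a s) ^+ 3)).
Proof.
have Wn : W (a s) != 0 by rewrite gt_eqF// W_gt0.
have W3n : W (a s) * (W (a s) ^+ 2) != 0 by rewrite mulf_neq0// expf_neq0.
have h1 := is_derive_mul da (is_derive_inv (is_derive_mul is_derive_W (is_derive_sq is_derive_W)) W3n).
have -> : (fun x => tail (a x)) = (fun x => a x * (W (a x) * W (a x) ^+ 2)^-1).
  by apply/funext => x; rewrite /tail -exprS.
apply: (is_derive_eq h1).
by field; rewrite Wn gt_eqF.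
Qed.

Lemma is_derive_rootW : is_derive s 1 (fun x => E0 / rootW (a x))
  (- (E0 * ((al + 1) / 2) / (rootW (a s) * a s))).
Proof.
have Vn : rootW (a s) != 0 by rewrite gt_eqF// rootW_gt0.
apply: (is_derive_eq (is_derive_scale E0 (is_derive_inv (is_derive_pow ((al+1)/2) da a0) Vn))).
by rewrite -/(rootW (a s)); field; rewrite Vn gt_eqF.
Qed.

Lemma is_derive_cutoff2 (b : R -> R) (db : R) : 0 < t s -> is_derive s 1 t 1 -> 0 < b s ->
  is_derive s 1 b db ->
  is_derive s 1 (fun x => A1 * cutoff (b x) (t x) ^+ 2)
   (- (2 * A1 * (al - 1) / s0 * cutoff (b s) (t s) * share (b s) (t s) * (db / b s - 1 / t s))).
Proof.
move=> t0 dt b0 dbs.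
have bn : b s != 0 by rewrite gt_eqF.
have tn : t s != 0 by rewrite gt_eqF.
have Wtn : W (t s) != 0 by rewrite gt_eqF// W_gt0.
have dWb := is_derive_pow al dbs b0.
have dWt := is_derive_pow al dt t0.
have d1 := is_derive_mul (is_derive_mul dWb (is_derive_inv dbs bn))
                         (is_derive_mul dt (is_derive_inv dWt Wtn)).
have d2 := is_derive_add (is_derive_const s 1)
            (is_derive_opp (is_derive_mul d1 (is_derive_const s s0^-1))).
apply: (is_derive_eq (is_derive_scale A1 (is_derive_chain (is_derive_maxsq _) d2))).
rewrite -/(W (b s)) -/(W (t s)) -/(share (b s) (t s)) -/(cutoff (b s) (t s)).
by rewrite /share; field; rewrite bn tn Wtn gt_eqF.
Qed.

(** The term slope / W that remains outside [main_term] and [error_term] is the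
    drift of the offset. The jumps remove exactly that amount, by the averaging of the corrector. *)
Lemma is_derive_core B : 0 < B -> 0 < h s ->
  is_derive s 1 h (al * (W (a s) / a s)) ->
  is_derive s 1 (fun x => wall (a x) B + slope (a x) B / (W (a x) * h x))
   (slope (a s) B / W (a s) +
    (main_term (W (a s)) (h s) (offset (a s) B) (tails (a s) B) (dist2 (a s) B) (3 * al - 1) c
    + error_term (a s) (W (a s)) (h s) (offset (a s) B) (tails (a s) B) (dist2 (a s) B) (3 * al - 1) c al)).
Proof.
move=> B0 h0 dh.
have an : a s != 0 by rewrite gt_eqF.
have Wn : W (a s) != 0 by rewrite gt_eqF// W_gt0.
have hn : h s != 0 by rewrite gt_eqF.
have q0 := dist2_gt0 a0 B0.
have qn : dist2 (a s) B != 0 by rewrite gt_eqF.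
have dN := is_derive_add is_derive_phi (is_derive_opp (is_derive_const s (phi B))).
have dS := is_derive_add is_derive_tail (is_derive_const s (tail B)).
have dq := is_derive_add (is_derive_scale 2 dS) (is_derive_sq dN).
have dSq := is_derive_mul dS (is_derive_inv dq qn).
have dg := is_derive_add (is_derive_opp (is_derive_ln dq q0)) (is_derive_scale c dSq).
have dgN := is_derive_mul
  (is_derive_opp (is_derive_mul (is_derive_scale 2 dN) (is_derive_inv dq qn)))
  (is_derive_add (is_derive_const s 1) (is_derive_scale c dSq)).
have Whn : W (a s) * h s != 0 by rewrite mulf_neq0.
have d2 := is_derive_mul dgN (is_derive_inv (is_derive_mul is_derive_W dh) Whn).
apply: (is_derive_eq (is_derive_add dg d2)).
rewrite -/(offset (a s) B) -/(tails (a s) B) -/(dist2 (a s) B) /slope /main_term /error_term /slope_term.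
by field; rewrite an Wn hn qn.
Qed.

End derive.


Variables (D0 Lam : R).
Hypotheses (D00 : 0 < D0) (s0E : s0 = (2 * D0)^-1).
Let k : R := 3 * al - 1.
Hypotheses (CE : C = 4 * k) (A1E : 2 * A1 * (al - 1) / s0 = C * D0).
Hypotheses (c7 : 32/7 <= c) (cL : 2 * k * Lam <= 7/16 * c - 2).
Hypothesis LamP : forall A T, 0 < A -> A <= T -> s0 / 2 <= share A T -> W T <= Lam * W A.
Hypothesis E0P : (1 + 3/2 * c) * k + (2 + c) * al <= E0 * ((al + 1) / 2).

Let k2 : 2 <= k. Proof. rewrite /k; have := al1; lra. Qed.
Let k0 : 0 < k. Proof. exact: lt_le_trans k2. Qed.
Let C0 : 0 < C. Proof. by rewrite CE mulr_gt0. Qed.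
Let c0 : 0 <= c. Proof. by apply: le_trans c7. Qed.

(** The inflow of the reserve per unit of time is at most a multiple of the rate at
    which the share decays. *)
Lemma share_drift A T H : 0 < A -> 0 < T -> 0 < H -> W T <= D0 * H ->
  W A / A / H <= D0 * (share A T / T).
Proof.
move=> A0 T0 H0 WT.
have -> : D0 * (share A T / T) = W A / A * (D0 / W T).
  by rewrite /share; field; rewrite !gt_eqF ?W_gt0.
rewrite ler_pM2l ?divr_gt0 ?W_gt0// ler_pdivlMr ?W_gt0// mulrC ler_pdivrMr//.
Qed.

Lemma cut_drift_away A T H : 0 < A -> 0 < T -> 0 < H -> W T <= D0 * H ->
  C * D0 * cutoff A T * share A T * (0 / A - 1 / T) + W A * cut_corr A T / H <= 0.
Proof.
move=> A0 T0 H0 WT.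
have -> : C * D0 * cutoff A T * share A T * (0 / A - 1 / T) + W A * cut_corr A T / H
   = - (C * cutoff A T * (D0 * (share A T / T) - W A / A / H)).
  by rewrite /cut_corr; field; rewrite !gt_eqF.
rewrite oppr_le0; apply: mulr_ge0; first by rewrite mulr_ge0 ?cutoff_ge0 ?ltW.
by rewrite subr_ge0; exact: share_drift.
Qed.

(** While the vertex is occupied, the growth of the share costs at most half of the
    released reserve: the cost is C D0 cutoff share / A, and where the cutoff does
    not vanish the share is at most s0 = 1 / (2 D0). *)
Lemma cut_drift_at A T H : 0 < A -> A <= T -> 0 < H -> W T <= D0 * H ->
  C * D0 * cutoff A T * share A T * (1 / A - 1 / T) + W A * cut_corr A T / H - cut_corr A T
  <= - (C / 2 * cutoff A T / A).
Proof.
move=> A0 AT H0 WT; have T0 := lt_le_trans A0 AT.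
have /(cut_drift_away A0 T0 H0) := WT.
suff : C * D0 * cutoff A T * share A T / A <= C / 2 * cutoff A T / A.
  by rewrite /cut_corr !mulrBr mul0r mulr0 !mul1r; lra.
rewrite ler_pM2r ?invr_gt0//.
rewrite (_ : _ * share A T = C * (cutoff A T * (D0 * share A T))); last by ring.
rewrite (_ : C / 2 * _ = C * (cutoff A T * (1 / 2))); last by ring.
rewrite ler_pM2l//.
rewrite /cutoff; have [h|_] := lerP 0 (1 - share A T / s0); last by rewrite !mul0r.
apply: ler_wpM2l => //.
move: h; rewrite subr_ge0 s0E invrK => h; lra.
Qed.

(** Either the share is at least s0 / 2, and then H is comparable to W(A) and the
    main term is nonpositive; or the cutoff is at least 1/2, and C = 4 k makes the
    right-hand side at least k / A. *)
Lemma main_cut A B T H : 0 < A -> 0 < B -> A <= T -> W A <= H -> H <= W T ->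
  main_term (W A) H (offset A B) (tails A B) (dist2 A B) k c <= C / 2 * cutoff A T / A.
Proof.
move=> A0 B0 AT WH HT.
have WA0 := W_gt0 A0.
have SA : A / W A ^+ 3 <= tails A B by rewrite lerDl ltW// tail_gt0.
have [sgs|sgs] := leP (s0 / 2) (share A T).
  apply: (@le_trans _ _ 0); last by rewrite !mulr_ge0 ?cutoff_ge0 ?invr_ge0 ?ltW.
  apply: (main_term_le0 A0 WA0 WH SA erefl k2 c0 _ cL).
  by apply: le_trans HT _; exact: LamP.
apply: le_trans (main_term_le_inv A0 WA0 WH SA erefl k2 c0 c7) _.
rewrite ler_pM2r ?invr_gt0// CE.
have : 1/2 <= cutoff A T.
  rewrite le_max; apply/orP; right.
  have : share A T / s0 <= 1/2 by rewrite ler_pdivrMr//; lra.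
  lra.
have := k0; nra.
Qed.

(** The generator inequality at an occupied vertex: the derivative along the flow is
    at most minus the mean change caused by the jumps. *)
Lemma drift_at A B T H : 0 < A -> 0 < B -> A <= T -> W A <= H -> H <= W T ->
  W T <= D0 * H ->
  slope A B / W A +
   (main_term (W A) H (offset A B) (tails A B) (dist2 A B) k c
    + error_term A (W A) H (offset A B) (tails A B) (dist2 A B) k c al) +
   ((- (E0 * ((al + 1) / 2) / (rootW A * A)) + C * D0 * cutoff A T * share A T * (1 / A - 1 / T))
    + C * D0 * cutoff B T * share B T * (0 / B - 1 / T))
  <= corr A B T - (W A * cut_corr A T + W B * cut_corr B T) / H.
Proof.
move=> A0 B0 AT WH HT TH; have T0 := lt_le_trans A0 AT.
have WA0 := W_gt0 A0; have H0 := lt_le_trans WA0 WH.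
have SA : A / W A ^+ 3 <= tails A B by rewrite lerDl ltW// tail_gt0.
have h1 := main_cut A0 B0 AT WH HT.
have h2 := cut_drift_away B0 T0 H0 TH.
have h3 := cut_drift_at A0 AT H0 TH.
have al0 : 0 <= al by rewrite ltW// (lt_trans _ al1).
have h4 := error_term_le A0 WA0 (rootW_gt0 A0) (rootW_sq A0) WH SA (erefl (dist2 A B)) k2 c0 al0.
have h5 : ((1 + 3/2 * c) * k + (2 + c) * al) / (rootW A * A) <= E0 * ((al + 1) / 2) / (rootW A * A).
  by rewrite ler_pM2r// invr_gt0 mulr_gt0// rootW_gt0.
have h6 := le_trans h4 h5.
rewrite /corr [(_ + W B * _) / H]mulrDl.
move: h1 h2 h3 h6.
set e2 := _ / (rootW A * A).
set x1 := error_term _ _ _ _ _ _ _ _ _; set x2 := main_term _ _ _ _ _ _ _.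
set y1 := _ * (1 / A - 1 / T); set y2 := _ * (0 / B - 1 / T).
set z1 := _ * _ / H; set z2 := _ * _ / H; set z3 := slope A B / _; set z4 := cut_corr A T.
set z5 := C / 2 * _ / _.
move=> h1 h2 h3 h6; lra.
Qed.


Lemma mean_value (f df : R -> R) (h : R) : 0 <= h ->
  (forall s, 0 <= s <= h -> is_derive s 1 f (df s)) ->
  exists2 s, 0 <= s <= h & f h - f 0 = h * df s.
Proof.
move=> h0 fdf; have [|//|s] := @MVT_segment R f df 0 h h0.
- by move=> s; rewrite in_itv/= => /andP[/ltW s0' /ltW sh]; apply: fdf; rewrite s0'.
- apply: derivable_within_continuous => s; rewrite in_itv/= => /fdf ?; exact: ex_derive.
- by rewrite in_itv/= => sh ->; exists s => //; rewrite subr0 mulrC.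
Qed.

(** Adding the same amount to A and to T >= A increases A / T. *)
Lemma share_nondecr A T s : 0 < A -> A <= T -> 0 <= s -> share A T <= share (A + s) (T + s).
Proof.
move=> A0 AT s0'; have T0 := lt_le_trans A0 AT.
have E x y : 0 < x -> 0 < y -> share x y = (x / y) `^ (al - 1).
  move=> x0 y0; have pB z : 0 < z -> z `^ (al - 1) = W z / z.
    move=> z0; rewrite powRB; last by rewrite (gt_eqF z0) implybT.
    by rewrite powRr1// ltW.
  rewrite powRM ?invr_ge0 ?ltW// pB// -(powR_inv1 (ltW y0)) -powRrM mulN1r powRN pB//.
  by rewrite /share invf_div.
have As : 0 < A + s by rewrite ltr_wpDr.
have Ts : 0 < T + s by rewrite ltr_wpDr.
have le : A / T <= (A + s) / (T + s).
  rewrite ler_pdivrMr// mulrAC ler_pdivlMr// mulrDr mulrDl.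
  by rewrite lerD2l (mulrC s); exact: ler_wpM2r.
rewrite !E//; apply: ge0_ler_powR => //.
- by rewrite subr_ge0 ltW.
- by rewrite nnegrE divr_ge0// ltW.
- by rewrite nnegrE divr_ge0// ltW.
Qed.

Lemma cutoff_nonincr A T s : 0 < A -> A <= T -> 0 <= s -> cutoff (A + s) (T + s) <= cutoff A T.
Proof.
move=> A0 AT s0'; rewrite ge_max cutoff_ge0/= le_max; apply/orP; right.
by rewrite lerB// ler_pM2r ?invr_gt0//; exact: share_nondecr.
Qed.

Lemma W_le A B : 0 <= A -> A <= B -> W A <= W B.
Proof.
move=> A0 AB; apply: ge0_ler_powR; rewrite ?nnegrE//.
  by rewrite ltW// (lt_trans _ al1).
exact: le_trans AB.
Qed.

(** The mean value theorem turns the generator inequality into an inequality over a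
    time h, with the jump part at an intermediate time. The reserve divided by H
    is left out of the differentiated function, since it does not increase along
    the flow. *)
Lemma flow_at A B T H h (Hs := fun s => H + (W (A + s) - W A)) :
  0 < A -> 0 < B -> A <= T -> 0 <= h -> W A <= H ->
  (forall s, 0 <= s <= h -> Hs s <= W (T + s) /\ W (T + s) <= D0 * Hs s) ->
  exists2 s, 0 <= s <= h &
    at_value (A + h) B (T + h) (Hs h) - at_value A B T H <=
    h * (corr (A + s) B (T + s) -
         (W (A + s) * cut_corr (A + s) (T + s) + W B * cut_corr B (T + s)) / Hs s).
Proof.
move=> A0 B0 AT h0 WH HP.
pose f s := wall (A + s) B + slope (A + s) B / (W (A + s) * Hs s) +
  ((E0 / rootW (A + s) - A1 * cutoff (A + s) (T + s) ^+ 2) +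
   (E0 / rootW B - A1 * cutoff B (T + s) ^+ 2)).
have GaE s : at_value (A + s) B (T + s) (Hs s) = f s + cut_corr (A + s) (T + s) / Hs s.
  rewrite /at_value /f /away_value /side /corr invfM; ring.
have WAs s : 0 <= s -> W (A + s) <= Hs s.
  by move=> s0'; rewrite /Hs; lra.
have df s : 0 <= s <= h -> is_derive s 1 f
  (slope (A + s) B / W (A + s) +
   (main_term (W (A + s)) (Hs s) (offset (A + s) B) (tails (A + s) B) (dist2 (A + s) B) k c
    + error_term (A + s) (W (A + s)) (Hs s) (offset (A + s) B) (tails (A + s) B) (dist2 (A + s) B) k c al) +
   ((- (E0 * ((al + 1) / 2) / (rootW (A + s) * (A + s))) +
     C * D0 * cutoff (A + s) (T + s) * share (A + s) (T + s) * (1 / (A + s) - 1 / (T + s)))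
    + C * D0 * cutoff B (T + s) * share B (T + s) * (0 / B - 1 / (T + s)))).
  move=> /andP[s0' sh].
  have As : 0 < A + s by rewrite ltr_wpDr.
  have Ts : 0 < T + s by rewrite ltr_wpDr// (lt_le_trans A0).
  have Hs0 : 0 < Hs s by apply: lt_le_trans (WAs _ s0'); exact: W_gt0.
  have dA u : is_derive s (1 : R) (fun x => u + x) 1.
    by apply: (is_derive_eq (is_derive_add (is_derive_const s u) (is_derive_id s 1))); rewrite add0r.
  have dW := @is_derive_W s (fun x => A + x) As (dA A).
  have dH : is_derive s 1 Hs (al * (W (A + s) / (A + s))).
    apply: (is_derive_eq (is_derive_add (is_derive_const s H)
      (is_derive_add dW (is_derive_opp (is_derive_const s (W A)))))).
    by rewrite oppr0 addr0 add0r.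
  have d1 := @is_derive_core s (fun x => A + x) Hs As (dA A) B B0 Hs0 dH.
  have d2 := @is_derive_rootW s (fun x => A + x) As (dA A).
  have d3 := @is_derive_cutoff2 s (fun x => T + x) (fun x => A + x) 1 Ts (dA T) As (dA A).
  have d4 := @is_derive_cutoff2 s (fun x => T + x) (fun=> B) 0 Ts (dA T) B0 (is_derive_const s B).
  apply: (is_derive_eq (is_derive_add d1 (is_derive_add (is_derive_add d2 (is_derive_opp d3))
     (is_derive_add (is_derive_const s (E0 / rootW B)) (is_derive_opp d4))))).
  by rewrite /= !opprK A1E add0r.
have [s sh fE] := mean_value h0 df.
exists s => //; have /andP[s0' _] := sh.
have As : 0 < A + s by rewrite ltr_wpDr.
have [HT TH] := HP _ sh.
have Hs0 x : 0 <= x -> 0 < Hs x.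
  by move=> x0; apply: lt_le_trans (WAs _ x0); rewrite W_gt0// ltr_wpDr.
have Ga0 : at_value A B T H = f 0 + cut_corr A T / H.
  by have := GaE 0; rewrite /Hs !addr0 subrr addr0.
rewrite GaE Ga0.
have cKle : cut_corr (A + h) (T + h) / Hs h <= cut_corr A T / H.
  have HHs : H <= Hs h by rewrite /Hs lerDl subr_ge0 W_le ?(ltW A0)// lerDl.
  have H0 : 0 < H by apply: lt_le_trans WH; exact: W_gt0.
  have cKh : cut_corr (A + h) (T + h) <= cut_corr A T.
    rewrite /cut_corr; apply: ler_pM.
    - by rewrite mulr_ge0 ?cutoff_ge0 ?ltW.
    - by rewrite invr_ge0 ltW// ltr_wpDr.
    - by rewrite ler_pM2l//; exact: cutoff_nonincr.
    - by rewrite lef_pV2 ?posrE ?ltr_wpDr// lerDl.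
  apply: ler_pM => //.
  - by rewrite /cut_corr !mulr_ge0 ?cutoff_ge0 ?invr_ge0 ?ltW ?ltr_wpDr.
  - by rewrite invr_ge0 ltW// Hs0.
  - by rewrite lef_pV2 ?posrE ?Hs0.
have := drift_at As B0 (_ : A + s <= T + s) (WAs _ s0') HT TH.
rewrite lerD2r => /(_ AT) dr.
have := ler_wpM2l h0 dr; rewrite -fE; lra.
Qed.

Lemma flow_away A B T h (Hs : R -> R) :
  0 < A -> 0 < B -> 0 < T -> 0 <= h ->
  (forall s, 0 <= s <= h -> 0 < Hs s /\ W (T + s) <= D0 * Hs s) ->
  exists2 s, 0 <= s <= h &
    away_value A B (T + h) - away_value A B T <=
    h * - ((W A * cut_corr A (T + s) + W B * cut_corr B (T + s)) / Hs s).
Proof.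
move=> A0 B0 T0 h0 HP.
have df s : 0 <= s <= h -> is_derive s 1 (fun x => away_value A B (T + x))
  (C * D0 * cutoff A (T + s) * share A (T + s) * (0 / A - 1 / (T + s))
    + C * D0 * cutoff B (T + s) * share B (T + s) * (0 / B - 1 / (T + s))).
  move=> /andP[s0' sh].
  have Ts : 0 < T + s by rewrite ltr_wpDr.
  have dT : is_derive s (1 : R) (fun x => T + x) 1.
    by apply: (is_derive_eq (is_derive_add (is_derive_const s T) (is_derive_id s 1))); rewrite add0r.
  have d3 := @is_derive_cutoff2 s (fun x => T + x) (fun=> A) 0 Ts dT A0 (is_derive_const s A).
  have d4 := @is_derive_cutoff2 s (fun x => T + x) (fun=> B) 0 Ts dT B0 (is_derive_const s B).
  apply: (is_derive_eq (is_derive_add (is_derive_const s (wall A B))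
    (is_derive_add (is_derive_add (is_derive_const s (E0 / rootW A)) (is_derive_opp d3))
     (is_derive_add (is_derive_const s (E0 / rootW B)) (is_derive_opp d4))))).
  by rewrite /= !opprK A1E !add0r.
have [s sh fE] := mean_value h0 df.
exists s => //; rewrite addr0 in fE; rewrite fE; apply: ler_wpM2l => //.
have /andP[s0' _] := sh.
have Ts : 0 < T + s by rewrite ltr_wpDr.
have [Hs0 TH] := HP _ sh.
have := cut_drift_away A0 Ts Hs0 TH; have := cut_drift_away B0 Ts Hs0 TH.
rewrite mulrDl; lra.
Qed.

End Lyapunov.

(** * The Lyapunov function of a configuration of local times *)

Section Configuration.
Variables (R : realType) (V : finType).
Implicit Types (L : V -> R) (x v : V).

Definition shift L x (s : R) : V -> R := fun v => L v + (if v == x then s else 0).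
Definition mass L : R := \sum_v L v.
Definition wsum al L : R := \sum_v W al (L v).

Lemma shiftE L x s : shift L x s x = L x + s. Proof. by rewrite /shift eqxx. Qed.
Lemma shift_neq L x s v : v != x -> shift L x s v = L v.
Proof. by rewrite /shift => /negbTE ->; rewrite addr0. Qed.

Lemma shift_gt0 L x s : (forall v, 0 < L v) -> 0 <= s -> forall v, 0 < shift L x s v.
Proof.
move=> L0 s0 v; have [->|vx] := eqVneq v x; first by rewrite shiftE ltr_wpDr.
by rewrite shift_neq.
Qed.

Lemma mass_shift L x s : mass (shift L x s) = mass L + s.
Proof. by rewrite /mass /shift big_split/= -big_mkcond/= big_pred1_eq. Qed.

Lemma wsum_shift al L x s :
  wsum al (shift L x s) = wsum al L + (W al (L x + s) - W al (L x)).
Proof.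
rewrite /wsum (bigD1 x)//= [X in _ = X + _](bigD1 x)//= shiftE.
rewrite (eq_bigr (fun v => W al (L v))); last by move=> v vx; rewrite shift_neq.
ring.
Qed.

Lemma le_mass L v : (forall v, 0 < L v) -> L v <= mass L.
Proof. by move=> L0; rewrite /mass (bigD1 v)//= lerDl sumr_ge0// => i _; exact: ltW. Qed.

Lemma W_le_wsum al L v : (forall v, 0 < L v) -> W al (L v) <= wsum al L.
Proof.
by move=> L0; rewrite /wsum (bigD1 v)//= lerDl sumr_ge0// => i _; exact: powR_ge0.
Qed.

Lemma mass_gt0 L v : (forall v, 0 < L v) -> 0 < mass L.
Proof. by move=> L0; apply: lt_le_trans (le_mass v L0). Qed.

Lemma wsum_gt0 al L v : (forall v, 0 < L v) -> 0 < wsum al L.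
Proof. by move=> L0; apply: lt_le_trans (W_le_wsum al v L0); exact: W_gt0. Qed.

(** Superadditivity of a convex power: each proportion r <= 1 satisfies r^al <= r. *)
Lemma wsum_le al L v0 : 1 < al -> (forall v, 0 < L v) -> wsum al L <= W al (mass L).
Proof.
move=> al1 L0; have T0 := mass_gt0 v0 L0.
have E : forall v, W al (L v) <= W al (mass L) * (L v / mass L).
  move=> v; have r0 : 0 < L v / mass L by rewrite divr_gt0.
  have r1 : L v / mass L <= 1 by rewrite ler_pdivrMr// mul1r le_mass.
  have {1}-> : L v = mass L * (L v / mass L) by rewrite mulrC divfK// gt_eqF.
  rewrite {1}/W powRM ?(ltW T0) ?(ltW r0)// ler_pM2l ?powR_gt0//.
  rewrite -[leRHS](powRr1 (ltW r0)) /powR gt_eqF// ler_expR.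
  by apply: ler_wnM2r; [exact: ln_le0 | exact: ltW].
apply: (@le_trans _ _ (\sum_v W al (mass L) * (L v / mass L))); first exact: ler_sum.
by rewrite -mulr_sumr -mulr_suml divff ?gt_eqF// mulr1.
Qed.

(** The largest local time is at least the average one. *)
Lemma W_mass_le al L v0 : 1 < al -> (forall v, 0 < L v) ->
  W al (mass L) <= W al #|V|%:R * wsum al L.
Proof.
move=> al1 L0; have T0 := mass_gt0 v0 L0.
have [v _ vmax] := @arg_maxP _ _ V v0 predT L isT.
have h : mass L <= #|V|%:R * L v.
  rewrite /mass -sum1_card natr_sum mulr_suml; apply: ler_sum => u _.
  by rewrite mul1r; exact: vmax.
apply: (@le_trans _ _ (W al (#|V|%:R * L v))); first exact: (W_le al1 (ltW T0)).
rewrite {1}/W powRM ?(ltW (L0 _))//.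
by apply: ler_wpM2l; [exact: powR_ge0 | exact: W_le_wsum].
Qed.

Section params.
Variables (al c s0 A1 E0 C : R) (a b : V).
Hypothesis ab : a != b.

(** Exchanging a and b changes the sign of the slope, so the corrections at the two
    vertices are opposite apart from the reserve. *)
Definition corr_at x L : R := if x == a then corr al c s0 C (L a) (L b) (mass L)
  else if x == b then corr al c s0 C (L b) (L a) (mass L) else 0.
Definition lyapG x L : R :=
  away_value al c s0 A1 E0 (L a) (L b) (mass L) + corr_at x L / wsum al L.
(** The jump part of the generator on a complete graph. The term v = x vanishes, so
    summing over all vertices is harmless. *)
Definition jump x L : R := \sum_v W al (L v) * (lyapG v L - lyapG x L).

Definition cut_inflow L : R := W al (L a) * cut_corr al s0 C (L a) (mass L) +
  W al (L b) * cut_corr al s0 C (L b) (mass L).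

Lemma offsetC A B : offset al B A = - offset al A B. Proof. by rewrite /offset opprB. Qed.
Lemma tailsC A B : tails al B A = tails al A B. Proof. by rewrite /tails addrC. Qed.
Lemma dist2C A B : dist2 al B A = dist2 al A B. Proof. by rewrite /dist2 offsetC tailsC sqrrN. Qed.
Lemma away_valueC A B T : away_value al c s0 A1 E0 B A T = away_value al c s0 A1 E0 A B T.
Proof. by rewrite /away_value /wall dist2C tailsC [_ + side _ _ _ _ A T]addrC. Qed.
Lemma slopeC A B : slope al c B A = - slope al c A B.
Proof. by rewrite /slope /slope_term dist2C tailsC offsetC; ring. Qed.

(** Averaging of the corrector: with weights W(L v), the slopes divided by W(L a) and
    by W(L b) cancel, so the jumps subtract the correction at the current position
    and leave only the inflow of the reserves. *)
Lemma jumpE x L : (forall v, 0 < L v) -> jump x L = cut_inflow L / wsum al L - corr_at x L.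
Proof.
move=> L0; have Hn : wsum al L != 0 by rewrite gt_eqF// (wsum_gt0 _ x).
have Wa : W al (L a) != 0 by rewrite gt_eqF// W_gt0.
have Wb : W al (L b) != 0 by rewrite gt_eqF// W_gt0.
rewrite /jump; under eq_bigr => v _ do
  rewrite /lyapG opprD addrACA subrr add0r -mulrBl mulrA mulrBr.
rewrite -mulr_suml big_split/= sumrN -mulr_suml -/(wsum al L).
have -> : \sum_v W al (L v) * corr_at v L = cut_inflow L.
  rewrite (bigD1 a)//= (bigD1 b) 1?eq_sym//= big1 ?addr0; last first.
    by move=> v /andP[/negbTE va /negbTE vb]; rewrite /corr_at va vb mulr0.
  rewrite /corr_at !eqxx eq_sym (negbTE ab) /cut_inflow /corr slopeC.
  by field; rewrite Wa Wb.
by field.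
Qed.

Hypotheses (al1 : 1 < al) (s00 : 0 < s0).
Variables (Lam : R).
Let D0 := W al #|V|%:R.
Hypotheses (s0E : s0 = (2 * D0)^-1).
Let k : R := 3 * al - 1.
Hypotheses (CE : C = 4 * k) (A1E : 2 * A1 * (al - 1) / s0 = C * D0).
Hypotheses (c7 : 32/7 <= c) (cL : 2 * k * Lam <= 7/16 * c - 2).
Hypothesis LamP : forall A T, 0 < A -> A <= T -> s0 / 2 <= share al A T ->
  W al T <= Lam * W al A.
Hypothesis E0P : (1 + 3/2 * c) * k + (2 + c) * al <= E0 * ((al + 1) / 2).

(** The positions a and b are exchanged by the symmetry of the Lyapunov function;
    at all other positions only the shares vary. *)
Lemma lyap_flow x L h : (forall v, 0 < L v) -> 0 <= h ->
  exists2 s, 0 <= s <= h &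
    lyapG x (shift L x h) - lyapG x L <= - (h * jump x (shift L x s)).
Proof.
move=> L0 h0.
have D00 : 0 < D0.
  by apply: powR_gt0; rewrite ltr0n; apply/card_gt0P; exists a.
have HP u v s : 0 <= s <= h ->
    wsum al (shift L u s) <= W al (mass L + s) /\
    W al (mass L + s) <= D0 * wsum al (shift L u s).
  move=> /andP[s0' _]; rewrite -(mass_shift L u).
  have Ls := shift_gt0 u L0 s0'.
  by split; [exact: (wsum_le v)|exact: (W_mass_le v)].
have [xab|xab] := boolP ((x == a) || (x == b)); last first.
  move: xab; rewrite negb_or => /andP[xa xb].
  have [s sh le] := @flow_away _ al c s0 A1 E0 C al1 s00 D0 CE A1E (L a) (L b) (mass L) h
    (fun s => wsum al (shift L x s)) (L0 a) (L0 b) (mass_gt0 x L0) h0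
    (fun s sh => conj (wsum_gt0 al x (shift_gt0 x L0 (proj1 (andP sh)))) (proj2 (HP x x s sh))).
  exists s => //; rewrite jumpE; last by apply: shift_gt0 => //; case/andP: sh.
  rewrite /lyapG /cut_inflow /corr_at !(negbTE xa) !(negbTE xb) mass_shift mass_shift !shift_neq 1?eq_sym//.
  by rewrite !mul0r !addr0 subr0 -mulrN.
have flow u v : u != v -> ((u == a) && (v == b)) || ((u == b) && (v == a)) ->
  exists2 s, 0 <= s <= h &
    lyapG u (shift L u h) - lyapG u L <= - (h * jump u (shift L u s)).
  move=> uv uvab.
  have HPu s (sh : 0 <= s <= h) := HP u u s sh.
  have HPu' s : 0 <= s <= h ->
     wsum al L + (W al (L u + s) - W al (L u)) <= W al (mass L + s) /\
     W al (mass L + s) <= D0 * (wsum al L + (W al (L u + s) - W al (L u))).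
    by move=> /HPu; rewrite wsum_shift.
  have [s sh le] := @flow_at _ al c s0 A1 E0 C al1 s00 D0 Lam s0E CE A1E c7 cL LamP E0P
    (L u) (L v) (mass L) (wsum al L) h (L0 u) (L0 v) (le_mass u L0) h0 (W_le_wsum al u L0) HPu'.
  exists s => //; rewrite jumpE; last by apply: shift_gt0 => //; case/andP: sh.
  have Ge t : lyapG u (shift L u t) =
      at_value al c s0 A1 E0 C (L u + t) (L v) (mass L + t) (wsum al L + (W al (L u + t) - W al (L u))).
    rewrite /lyapG /at_value /corr_at !mass_shift wsum_shift.
    case/orP: uvab => /andP[/eqP uE /eqP vE]; subst u v.
      by rewrite eqxx shiftE shift_neq// eq_sym.
    by rewrite eqxx (negbTE uv) shiftE shift_neq 1?eq_sym// away_valueC.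
  have G0e : lyapG u L = at_value al c s0 A1 E0 C (L u) (L v) (mass L) (wsum al L).
    have := Ge 0; rewrite !addr0 subrr addr0 => <-; congr lyapG.
    by apply/funext => z; rewrite /shift; case: ifP => _; rewrite addr0.
  rewrite Ge G0e; apply: (le_trans le); rewrite -[leRHS]mulrN opprB wsum_shift.
  apply: ler_wpM2l => //; rewrite lerD// ?lerN2.
    rewrite /corr_at mass_shift; case/orP: uvab => /andP[/eqP uE /eqP vE]; subst u v.
      by rewrite eqxx shiftE shift_neq// eq_sym.
    by rewrite eqxx (negbTE uv) shiftE shift_neq 1?eq_sym.
  rewrite /cut_inflow mass_shift; case/orP: uvab => /andP[/eqP uE /eqP vE]; subst u v.
    by rewrite shiftE shift_neq// eq_sym.
  by rewrite shiftE shift_neq 1?eq_sym// [in leRHS]addrC.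
case/orP: xab => /eqP ->.
  by apply: (flow a b); rewrite ?eqxx.
by apply: (flow b a); rewrite ?eqxx ?orbT// eq_sym.
Qed.

End params.

End Configuration.

(** * Blow-up of the Lyapunov function *)

Section Blowup.
Variables (R : realType) (V : finType) (al c s0 A1 E0 C : R) (a b : V).
Hypotheses (al1 : 1 < al) (s00 : 0 < s0) (ab : a != b).
Hypotheses (c0 : 0 <= c) (A10 : 0 <= A1) (E00 : 0 <= E0) (C0 : 0 <= C).
Implicit Types (L : V -> R) (v : V).

Let al_ge0 : 0 <= al. Proof. by rewrite ltW// (lt_trans _ al1). Qed.

Lemma ratio_nonincr A B : 0 < A -> A <= B -> B / W al B <= A / W al A.
Proof.
move=> A0 AB; have B0 := lt_le_trans A0 AB.
have E x : 0 < x -> x / W al x = (x `^ (al - 1))^-1.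
  move=> x0; rewrite powRB; last by rewrite (gt_eqF x0) implybT.
  by rewrite powRr1 ?(ltW x0)// invf_div.
rewrite !E// lef_pV2 ?posrE ?powR_gt0//.
by apply: ge0_ler_powR; rewrite ?nnegrE ?subr_ge0// ltW.
Qed.

Definition dist2_bound (M : R) : R :=
  4 * tail al M + (2 * ((al - 1)^-1 * (M / W al M))) ^+ 2.

Lemma tail_nonincr A B : 0 < A -> A <= B -> tail al B <= tail al A.
Proof.
move=> A0 AB; have B0 := lt_le_trans A0 AB.
have E x : 0 < x -> tail al x = x / W al x * (W al x ^+ 2)^-1.
  by move=> x0; rewrite /tail (exprS _ 2) invfM mulrA.
rewrite !E//; apply: ler_pM.
- by rewrite divr_ge0 ?ltW// W_gt0.
- by rewrite invr_ge0 exprn_ge0// ltW// W_gt0.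
- exact: ratio_nonincr.
- by rewrite lef_pV2 ?posrE ?exprn_gt0 ?W_gt0// lerXn2r ?nnegrE ?(ltW (W_gt0 _ _))// W_le// ltW.
Qed.

Lemma dist2_le A B M : 0 < M -> M <= A -> M <= B -> dist2 al A B <= dist2_bound M.
Proof.
move=> M0 MA MB; rewrite /dist2 /dist2_bound; apply: lerD.
  rewrite /tails; have := tail_nonincr M0 MA; have := tail_nonincr M0 MB; lra.
rewrite -[leLHS]real_normK ?num_real//.
have i0 : 0 <= (al - 1)^-1 by rewrite invr_ge0 subr_ge0 ltW.
have P x : M <= x -> 0 <= (al - 1)^-1 * (x / W al x) <= (al - 1)^-1 * (M / W al M).
  move=> Mx; have x0 := lt_le_trans M0 Mx; apply/andP; split.
    by rewrite mulr_ge0// divr_ge0 ?ltW// W_gt0.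
  by apply: ler_wpM2l => //; exact: ratio_nonincr.
rewrite lerXn2r ?nnegrE ?normr_ge0//.
  have /andP[? ?] := P M (lexx _); lra.
have /andP[h1 h2] := P _ MA; have /andP[h3 h4] := P _ MB.
rewrite /offset /phi !mulNr ler_norml; apply/andP; split; lra.
Qed.

(** For M^(al - 1) = y >= 1 both tail M and M / W(M) are at most 1 / y. *)
Lemma dist2_bound_small (e : R) : 0 < e -> exists2 M, 0 < M & dist2_bound M <= e.
Proof.
move=> e0; have a0 : 0 < al - 1 by rewrite subr_gt0.
pose K := 4 + (2 * (al - 1)^-1) ^+ 2.
have K0 : 0 < K by rewrite ltr_pwDl// sqr_ge0.
pose y := Num.max 1 (K / e).
have y1 : 1 <= y by rewrite le_max lexx.
have y0 : 0 < y by apply: lt_le_trans y1.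
(* This M satisfies M / W(M) = 1 / y. *)
exists (y `^ (al - 1)^-1); first exact: powR_gt0.
set M := y `^ _; have M0 : 0 < M by exact: powR_gt0.
have ME : M / W al M = y^-1.
  have -> : M / W al M = (M `^ (al - 1))^-1.
    rewrite powRB; last by rewrite (gt_eqF M0) implybT.
    by rewrite powRr1 ?(ltW M0)// invf_div.
  by rewrite /M -powRrM mulVf ?gt_eqF// powRr1// ltW.
have ge1 (z p : R) : 1 <= z -> 0 <= p -> 1 <= z `^ p.
  move=> z1 p0; have <- : (1 : R) `^ p = 1 by rewrite powR1.
  by apply: ge0_ler_powR; rewrite ?nnegrE// (le_trans _ z1).
have M1 : 1 <= M by apply: ge1 => //; rewrite invr_ge0 ltW.
have W1 : 1 <= W al M by exact: ge1.
have vSM : tail al M <= y^-1.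
  rewrite -ME /tail (exprS _ 2) invfM mulrA -[leRHS]mulr1; apply: ler_wpM2l.
    by rewrite divr_ge0 ?ltW// W_gt0.
  by rewrite invf_le1 ?exprn_gt0 ?W_gt0// exprn_ege1.
have yi : y^-1 <= 1 by rewrite invf_le1.
have yi0 : 0 < y^-1 by rewrite invr_gt0.
apply: (@le_trans _ _ (K * y^-1)).
  have -> : K * y^-1 = 4 * y^-1 + (2 * (al - 1)^-1) ^+ 2 * y^-1 by rewrite /K mulrDl.
  rewrite /dist2_bound ME; apply: lerD; first by rewrite ler_pM2l.
  rewrite mulrA exprMn ler_wpM2l ?sqr_ge0// expr2 -[leRHS]mulr1.
  by rewrite ler_pM2l.
by rewrite ler_pdivrMr// mulrC -ler_pdivrMr// le_max lexx orbT.
Qed.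

(** The corrector is small compared with the wall: slope / (W H) is bounded by a
    multiple of 1 / rootW. *)
Lemma corr_ge A B T H : 0 < A -> 0 < B -> 0 < T -> W al A <= H ->
  - ((2 + c) / 2 / rootW al A) <= corr al c s0 C A B T / H.
Proof.
move=> A0 B0 T0 WH; have WA0 := W_gt0 al A0; have H0 := lt_le_trans WA0 WH.
have V0 := rootW_gt0 al A0.
have SA : A / W al A ^+ 3 <= tails al A B by rewrite lerDl ltW// tail_gt0.
have := norm_slope_le A0 WA0 V0 (rootW_sq _ A0) SA (erefl (dist2 al A B)) c0.
rewrite -/(slope al c A B) => h.
have h2 : `|slope al c A B / W al A / H| <= (2 + c) / 2 / rootW al A.
  rewrite -mulrA -invfM normrM normfV (gtr0_norm (mulr_gt0 WA0 H0)).
  rewrite ler_pdivrMr ?mulr_gt0//; apply: (le_trans h).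
  have -> : (2 + c) / 2 / rootW al A * (W al A * H) = (2 + c) / 2 * (W al A * H / rootW al A) by ring.
  apply: ler_wpM2l; first by rewrite divr_ge0// addr_ge0.
  by rewrite ler_pM2r ?invr_gt0// expr2 ler_pM2l.
have cK0 : 0 <= cut_corr al s0 C A T / H.
  by rewrite /cut_corr divr_ge0 ?(ltW H0)// divr_ge0 ?(ltW A0)// mulr_ge0// cutoff_ge0.
move: h2; rewrite ler_norml => /andP[h2 _].
rewrite /corr mulrDl; lra.
Qed.

(** All terms other than - ln dist2 are bounded below when the local times are bounded
    away from 0. *)
Lemma lyapG_ge (l : R) : 0 < l -> exists K, forall x L, (forall v, l <= L v) ->
  - ln (dist2 al (L a) (L b)) - K <= lyapG al c s0 A1 E0 C a b x L.
Proof.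
move=> l0; exists (2 * A1 + (2 + c) / 2 / rootW al l) => x L lL.
have L0 v : 0 < L v by apply: lt_le_trans (lL v).
have T0 := mass_gt0 x L0.
have Vle v : (2 + c) / 2 / rootW al (L v) <= (2 + c) / 2 / rootW al l.
  apply: ler_wpM2l; first by rewrite divr_ge0// addr_ge0.
  rewrite lef_pV2 ?posrE ?rootW_gt0// /rootW; apply: ge0_ler_powR; rewrite ?nnegrE ?(ltW l0) ?(ltW (L0 v))//.
  by rewrite divr_ge0// addr_ge0.
have Vl0 : 0 <= (2 + c) / 2 / rootW al l.
  by rewrite divr_ge0 ?(ltW (rootW_gt0 _ _))// divr_ge0// addr_ge0.
have cg : - ((2 + c) / 2 / rootW al l) <= corr_at al c s0 C a b x L / wsum al L.
  rewrite /corr_at; case: eqP => [_|_]; last case: eqP => [_|_].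
  - apply: le_trans (corr_ge (L0 a) (L0 b) T0 (W_le_wsum al a L0)).
    by rewrite lerN2.
  - apply: le_trans (corr_ge (L0 b) (L0 a) T0 (W_le_wsum al b L0)).
    by rewrite lerN2.
  - by rewrite mul0r oppr_le0.
have ag v : - A1 <= side al s0 A1 E0 (L v) (mass L).
  rewrite /side; have e0 : 0 <= E0 / rootW al (L v) by rewrite divr_ge0// ltW// rootW_gt0.
  have : cutoff al s0 (L v) (mass L) ^+ 2 <= 1.
    by rewrite expr_le1// ?cutoff_ge0// (cutoff_le1 _ s00).
  by move=> /(ler_wpM2l A10); lra.
have gg : - ln (dist2 al (L a) (L b)) <= wall al c (L a) (L b).
  rewrite /wall lerDl mulr_ge0// divr_ge0// ltW//; [exact: tails_gt0|exact: dist2_gt0].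
rewrite /lyapG /away_value; have := ag a; have := ag b; lra.
Qed.

Lemma lyapG_lower (l : R) : 0 < l -> exists m, forall x L, (forall v, l <= L v) ->
  m <= lyapG al c s0 A1 E0 C a b x L.
Proof.
move=> l0; have [K KP] := lyapG_ge l0; exists (- ln (dist2_bound l) - K) => x L lL.
apply: le_trans (KP x L lL); rewrite lerD2r lerN2 ler_ln ?posrE.
- exact: dist2_le.
- by apply: dist2_gt0; apply: lt_le_trans (lL _).
- apply: lt_le_trans (dist2_le l0 (lexx _) (lexx _)); exact: dist2_gt0.
Qed.

Lemma lyapG_blowup (l K : R) : 0 < l -> exists M, forall x L, (forall v, l <= L v) ->
  M <= L a -> M <= L b -> K <= lyapG al c s0 A1 E0 C a b x L.
Proof.
move=> l0; have [K1 KP] := lyapG_ge l0.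
have [M M0 qM] := dist2_bound_small (expR_gt0 (- (K + K1))).
exists M => x L lL Ma Mb; apply: le_trans (KP x L lL).
have q0 : 0 < dist2 al (L a) (L b) by apply: dist2_gt0; apply: lt_le_trans (lL _).
have : ln (dist2 al (L a) (L b)) <= - (K + K1).
  rewrite -[leRHS]expRK ler_ln ?posrE ?expR_gt0//.
  by apply: le_trans qM; exact: dist2_le.
lra.
Qed.

End Blowup.

(** * Functions bounded and uniformly continuous on boxes *)

Section Heine.
Variable R : realType.

(** Continuity is required in a full neighbourhood of each point of the segment; the
    uniform radius is found by compactness. *)
Lemma heine (f : R -> R) (a b : R) :
  (forall x, a <= x <= b -> {for x, continuous f}) ->
  forall e, 0 < e -> exists2 d, 0 < d &
    forall x y, a <= x <= b -> a <= y <= b -> `|x - y| <= d -> `|f x - f y| <= e.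
Proof.
move=> fc e e0.
have /compact_near_coveringP cov := @segment_compact R a b.
have : \forall d \near 0^'+, `[a, b]%classic `<=`
    (fun x => forall y, a <= y <= b -> `|x - y| <= d -> `|f x - f y| <= e).
  apply: cov => x; rewrite /= in_itv/= => xab.
  have e2 : 0 < e / 2 by rewrite divr_gt0.
  have /cvgr_dist_le /(_ _ e2) /nbhs_ballP[r /= r0 rP] := fc x xab.
  have r2 : 0 < r / 2 by rewrite divr_gt0.
  near=> z d => y yab zy.
  have hz : `|x - z| < r / 2.
    by near: z; apply/nbhs_ballP; exists (r / 2).
  have hd : d < r / 2 by near: d; exact: nbhs_right_lt.
  have hy : `|x - y| < r.
    rewrite -(subrKA z) (splitr r); apply: le_lt_trans (ler_normD _ _) _.
    by rewrite ltrD// (le_lt_trans zy).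
  have hz' : `|x - z| < r by apply: (lt_trans hz); rewrite ltr_pdivrMr// ltr_pMr// ltr1n.
  have := rP z hz'; have := rP y hy => /= h1 h2.
  rewrite -(subrKA (f x)) (splitr e); apply: le_trans (ler_normD _ _) _.
  by rewrite lerD// distrC.
case=> d /= d0 H; exists (d / 2); first by rewrite divr_gt0.
move=> x y xab; apply: (H (d / 2)); rewrite /= ?sub0r ?normrN ?gtr0_norm ?divr_gt0//.
- by rewrite ltr_pdivrMr// ltr_pMr// ltr1n.
Unshelve. all: by end_near.
Qed.
End Heine.

Section Nice.
Variables (R : realType) (V : finType).
Implicit Types (f g : (V -> R) -> R) (L : V -> R).

Definition box (l M : R) : set (V -> R) := [set L | forall v, l <= L v <= M].

Definition unif_cont_on (D : set (V -> R)) f : Prop :=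
  forall e, 0 < e -> exists2 d, 0 < d & forall L L', D L -> D L' ->
    (forall v, `|L v - L' v| <= d) -> `|f L - f L'| <= e.

(** The regularity that the one-step estimate asks of a function of the local times.
    Measurability is stated for compositions, which avoids a sigma-algebra on the
    space of configurations. *)
Record nice f : Prop := Nice {
  nice_bound : forall l M, 0 < l -> exists K, forall L, box l M L -> `|f L| <= K ;
  nice_unif : forall l M, 0 < l -> unif_cont_on (box l M) f ;
  nice_meas : forall d (T : measurableType d) (L : V -> T -> R),
    (forall v, measurable_fun setT (L v)) -> (forall v w, 0 < L v w) ->
    measurable_fun setT (fun w => f (L ^~ w)) }.

(** Nice functions to which logarithms, inverses and real powers can be applied. *)
Definition pnice f : Prop := nice f /\ ((forall L, (forall v, 0 < L v) -> 0 < f L) /\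
  forall l M, 0 < l -> exists2 e, 0 < e & forall L, box l M L -> e <= f L).

Lemma nice_eq f g : f =1 g -> nice f -> nice g.
Proof. by move=> /funext ->. Qed.

Lemma nice_const (r : R) : nice (fun=> r).
Proof.
split.
- by move=> l M _; exists `|r|.
- by move=> l M _ e e0; exists 1 => // L L' _ _ _; rewrite subrr normr0 ltW.
- by move=> d T L _ _; exact: measurable_cst.
Qed.

Lemma nice_coord v : nice (fun L => L v).
Proof.
split.
- move=> l M l0; exists M => L /(_ v) /andP[lL LM].
  by rewrite ger0_norm// (le_trans _ lL)// ltW.
- by move=> l M _ e e0; exists e => // L L' _ _; exact.
- by move=> d T L mL _; exact: mL.
Qed.

Lemma nice_add f g : nice f -> nice g -> nice (fun L => f L + g L).
Proof.
move=> [fb fu fm] [gb gu gm]; split.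
- move=> l M l0; have [K1 H1] := fb l M l0; have [K2 H2] := gb l M l0.
  exists (K1 + K2) => L LB; apply: le_trans (ler_normD _ _) _.
  by rewrite lerD ?H1 ?H2.
- move=> l M l0 e e0; have e2 : 0 < e / 2 by rewrite divr_gt0.
  have [d1 d10 H1] := fu l M l0 _ e2; have [d2 d20 H2] := gu l M l0 _ e2.
  exists (Num.min d1 d2); first by rewrite lt_min d10.
  move=> L L' LB LB' LL'; rewrite opprD addrACA (splitr e).
  apply: le_trans (ler_normD _ _) _; apply: lerD; [apply: H1|apply: H2] => // v.
    by apply: le_trans (LL' v) _; rewrite ge_min lexx.
  by apply: le_trans (LL' v) _; rewrite ge_min lexx orbT.
- by move=> d T L mL L0; apply: measurable_funD; [exact: fm|exact: gm].
Qed.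

Lemma nice_mul f g : nice f -> nice g -> nice (fun L => f L * g L).
Proof.
move=> [fb fu fm] [gb gu gm]; split.
- move=> l M l0; have [K1 H1] := fb l M l0; have [K2 H2] := gb l M l0.
  exists (K1 * K2) => L LB; rewrite normrM.
  by apply: ler_pM; rewrite ?normr_ge0 ?H1 ?H2.
- move=> l M l0 e e0; have [K1 H1] := fb l M l0; have [K2 H2] := gb l M l0.
  pose K := Num.max 1 (Num.max K1 K2).
  have K0 : 0 < K by rewrite lt_max ltr01.
  have e2 : 0 < e / 2 / K by rewrite !divr_gt0.
  have [d1 d10 P1] := fu l M l0 _ e2; have [d2 d20 P2] := gu l M l0 _ e2.
  exists (Num.min d1 d2); first by rewrite lt_min d10.
  move=> L L' LB LB' LL'.
  have -> : f L * g L - f L' * g L' = f L * (g L - g L') + (f L - f L') * g L' by ring.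
  rewrite (splitr e); apply: le_trans (ler_normD _ _) _; rewrite !normrM.
  have h1 : `|f L - f L'| <= e / 2 / K.
    by apply: P1 => // v; apply: le_trans (LL' v) _; rewrite ge_min lexx.
  have h2 : `|g L - g L'| <= e / 2 / K.
    by apply: P2 => // v; apply: le_trans (LL' v) _; rewrite ge_min lexx orbT.
  have h3 : `|f L| <= K by apply: le_trans (H1 _ LB) _; rewrite !le_max lexx orbT.
  have h4 : `|g L'| <= K by apply: le_trans (H2 _ LB') _; rewrite !le_max lexx !orbT.
  have -> : e / 2 + e / 2 = K * (e / 2 / K) + e / 2 / K * K by field; rewrite gt_eqF.
  by apply: lerD; apply: ler_pM.
- by move=> d T L mL L0; apply: measurable_funM; [exact: fm|exact: gm].
Qed.

Lemma nice_scale (r : R) f : nice f -> nice (fun L => r * f L).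
Proof. by move=> nf; apply: nice_mul => //; exact: nice_const. Qed.

Lemma nice_opp f : nice f -> nice (fun L => - f L).
Proof. by move=> /(nice_scale (-1)); apply: nice_eq => L; rewrite mulN1r. Qed.

Lemma nice_sq f : nice f -> nice (fun L => f L ^+ 2).
Proof. by move=> nf; apply: nice_eq (nice_mul nf nf) => L; rewrite expr2. Qed.

Lemma nice_sum (F : V -> (V -> R) -> R) : (forall v, nice (F v)) ->
  nice (fun L => \sum_v F v L).
Proof.
move=> nF; elim: (index_enum V) => [|v s IH].
  by apply: nice_eq (nice_const 0) => L; rewrite big_nil.
by apply: nice_eq (nice_add (nF v) IH) => L; rewrite big_cons.
Qed.

(** On a box f takes its values in a segment of positive numbers, on which phi is
    bounded and uniformly continuous. *)
Lemma nice_comp (phi : R -> R) f : measurable_fun setT phi ->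
  (forall x, 0 < x -> {for x, continuous phi}) -> pnice f -> nice (fun L => phi (f L)).
Proof.
move=> mphi cphi [[fb fu fm] [f0 fl]]; split.
- move=> l M l0; have [K H] := fb l M l0; have [e e0 E] := fl l M l0.
  have cs : {within `[e, K], continuous phi}.
    apply: continuous_in_subspaceT => x; rewrite inE/= in_itv/= => /andP[ex _].
    by apply: cphi; exact: lt_le_trans ex.
  have [eK|Ke] := leP e K; last first.
    exists 0 => L LB; exfalso; move: (E _ LB); apply/negP; rewrite -ltNge.
    by apply: le_lt_trans Ke; apply: le_trans (H _ LB); exact: ler_norm.
  have [x1 _ X1] := EVT_max eK cs; have [x2 _ X2] := EVT_min eK cs.
  exists (`|phi x1| + `|phi x2|) => L LB.
  have fL : f L \in `[e, K].
    by rewrite in_itv/= E//= (le_trans _ (H _ LB))// ler_norm.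
  rewrite ler_norml; apply/andP; split.
    apply: le_trans (X2 _ fL); rewrite lerNl.
    have := ler_norm (- phi x2); rewrite normrN; have := normr_ge0 (phi x1); lra.
  apply: le_trans (X1 _ fL) _; have := ler_norm (phi x1); have := normr_ge0 (phi x2); lra.
- move=> l M l0 e e0; have [K H] := fb l M l0; have [m m0 E] := fl l M l0.
  have [|d d0 D] := @heine _ phi m K _ e e0.
    by move=> x /andP[mx _]; apply: cphi; exact: lt_le_trans mx.
  have [d' d'0 D'] := fu l M l0 d d0; exists d' => // L L' LB LB' LL'.
  apply: D; last exact: D'.
    by rewrite E//= (le_trans _ (H _ LB))// ler_norm.
  by rewrite E//= (le_trans _ (H _ LB'))// ler_norm.
- by move=> d T L mL L0; apply: measurableT_comp => //; exact: fm.
Qed.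

Lemma continuous_powR (p x : R) : 0 < x -> {for x, continuous (fun y => y `^ p)}.
Proof.
move=> x0; apply: differentiable_continuous; apply/derivable1_diffP.
by have [] := is_derive1_powR p x0.
Qed.

Lemma nice_powR (p : R) f : pnice f -> nice (fun L => f L `^ p).
Proof.
apply: (nice_comp (measurable_powR p)) => x x0; exact: continuous_powR.
Qed.

(** The lower bound comes from the upper bound of the opposite power. *)
Lemma pnice_powR (p : R) f : pnice f -> pnice (fun L => f L `^ p).
Proof.
move=> nf; split; first exact: nice_powR.
split; first by move=> L L0; apply: powR_gt0; exact: nf.2.1.
move=> l M l0; have [K KP] := nice_bound (nice_powR (- p) nf) M l0.
exists (Num.max 1 K)^-1; first by rewrite invr_gt0 lt_max ltr01.
move=> L LB; have fL : 0 < f L by have [e e0 E] := nf.2.2 l M l0; exact: lt_le_trans (E _ LB).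
have := KP L LB; rewrite powRN gtr0_norm ?invr_gt0 ?powR_gt0// => h.
rewrite -[leRHS]invrK lef_pV2 ?posrE ?invr_gt0 ?powR_gt0 ?lt_max ?ltr01//.
by rewrite le_max h orbT.
Qed.

Lemma pnice_inv f : pnice f -> pnice (fun L => (f L)^-1).
Proof.
move=> [[fb fu fm] [f0 fl]].
have nf : pnice f by [].
have := pnice_powR (-1) nf; case=> -[b1 u1 m1] [p1 l1].
have E L : (forall v, 0 < L v) -> f L `^ (-1) = (f L)^-1.
  by move=> L0; rewrite powR_inv1// ltW// f0.
have B0 l M L : 0 < l -> box l M L -> forall v, 0 < L v.
  by move=> l0 LB v; have /andP[+ _] := LB v; exact: lt_le_trans.
split; first split.
- move=> l M l0; have [K' H] := b1 l M l0; exists K' => L LB.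
  by rewrite -(E _ (B0 _ _ _ l0 LB)); exact: H.
- move=> l M l0 e e0; have [d d0 D] := u1 l M l0 e e0; exists d => // L L' LB LB' LL'.
  by rewrite -(E _ (B0 _ _ _ l0 LB)) -(E _ (B0 _ _ _ l0 LB')); exact: D.
- move=> d T L mL L0; have := m1 d T L mL L0; congr measurable_fun.
  by apply/funext => w; rewrite E.
split; first by move=> L L0; rewrite invr_gt0 f0.
move=> l M l0; have [e e0 H] := l1 l M l0; exists e => // L LB.
by rewrite -(E _ (B0 _ _ _ l0 LB)); exact: H.
Qed.

Lemma pnice_mul f g : pnice f -> pnice g -> pnice (fun L => f L * g L).
Proof.
move=> [nf [f0 fl]] [ng [g0 gl]]; split; first exact: nice_mul.
split; first by move=> L L0; rewrite mulr_gt0 ?f0 ?g0.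
move=> l M l0; have [e e0 E] := fl l M l0; have [e' e'0 E'] := gl l M l0.
exists (e * e'); first exact: mulr_gt0.
by move=> L LB; apply: ler_pM; rewrite ?(ltW e0) ?(ltW e'0) ?E ?E'.
Qed.

Lemma pnice_add f g : pnice f -> nice g -> (forall L, (forall v, 0 < L v) -> 0 <= g L) ->
  pnice (fun L => f L + g L).
Proof.
move=> [nf [f0 fl]] ng g0; split; first exact: nice_add.
split; first by move=> L L0; rewrite ltr_wpDr ?f0 ?g0.
move=> l M l0; have [e e0 E] := fl l M l0; exists e => // L LB.
apply: (le_trans (E _ LB)); rewrite lerDl g0// => v.
by have /andP[+ _] := LB v; exact: lt_le_trans.
Qed.

Lemma pnice_coord v : pnice (fun L => L v).
Proof.
split; first exact: nice_coord.
by split => // l M l0; exists l => // L /(_ v) /andP[].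
Qed.

Lemma pnice_sum (F : V -> (V -> R) -> R) (v0 : V) : (forall v, pnice (F v)) ->
  pnice (fun L => \sum_v F v L).
Proof.
move=> nF; split; first by apply: nice_sum => v; exact: (nF v).1.
split.
  move=> L L0; rewrite (bigD1 v0)//= ltr_wpDr ?(nF _).2.1//.
  by apply: sumr_ge0 => v _; rewrite ltW// (nF v).2.1.
move=> l M l0; have [e e0 E] := (nF v0).2.2 l M l0; exists e => // L LB.
rewrite (bigD1 v0)//=; apply: (le_trans (E _ LB)); rewrite lerDl.
apply: sumr_ge0 => v _; rewrite ltW// (nF v).2.1// => u.
by have /andP[+ _] := LB u; exact: lt_le_trans.
Qed.

Lemma nice_ln f : pnice f -> nice (fun L => ln (f L)).
Proof. by apply: (nice_comp (@measurable_ln R)) => x x0; exact: continuous_ln. Qed.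

Lemma nice_max0 f : nice f -> nice (fun L => Num.max 0 (f L)).
Proof.
move=> [fb fu fm]; split.
- move=> l M l0; have [K H] := fb l M l0; exists K => L LB; apply: le_trans (H _ LB).
  by case: (lerP 0 (f L)) => // _; rewrite normr0.
- move=> l M l0 e e0; have [d d0 D] := fu l M l0 e e0; exists d => // L L' LB LB' LL'.
  apply: le_trans (D L L' LB LB' LL'); rewrite /Num.max.
  case: ltP => h1; case: ltP => h2 //.
  + by rewrite subr0 gtr0_norm// ler_normr; apply/orP; left; lra.
  + by rewrite sub0r normrN gtr0_norm// ler_normr; apply/orP; right; lra.
  + by rewrite subrr normr0.
- by move=> d T L mL L0; apply: measurable_maxr; [exact: measurable_cst|exact: fm].
Qed.

End Nice.
Arguments pnice_coord {R V} v.
Arguments nice_coord {R V} v.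

(** * Existence of a Lyapunov function *)

Section Interface.
Variables (R : realType) (V : finType) (al : R) (a b : V).
Implicit Types (L : V -> R) (l h s K M : R) (x v : V).

(** The descent is integrated over a time h, with the jump part at an intermediate
    configuration, so that no derivative of G occurs; the rest of the proof uses
    nothing else about G. *)
Record lyapunov (G : V -> (V -> R) -> R) : Prop := Lyapunov {
  lyap_nice : forall x, nice (G x) ;
  lyap_descent : forall x L h, (forall v, 0 < L v) -> 0 <= h ->
    exists2 s, 0 <= s <= h &
      G x (shift L x h) - G x L <=
      - (h * \sum_v W al (shift L x s v) * (G v (shift L x s) - G x (shift L x s))) ;
  lyap_lower : forall l, 0 < l -> exists m, forall x L, (forall v, l <= L v) -> m <= G x L ;
  lyap_blowup : forall l K, 0 < l -> exists M, forall x L, (forall v, l <= L v) ->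
    M <= L a -> M <= L b -> K <= G x L }.

Lemma pnice_W v : pnice (fun L : V -> R => W al (L v)).
Proof. by apply: pnice_powR; exact: pnice_coord. Qed.

Lemma pnice_mass : pnice (@mass R V).
Proof. by apply: (pnice_sum a) => v; exact: pnice_coord. Qed.

Lemma pnice_wsum : pnice (@wsum R V al).
Proof. by apply: (pnice_sum a) => v; exact: pnice_W. Qed.

Hypothesis al1 : 1 < al.

Section nice_lyapG.
Variables (c s0 A1 E0 C : R).

Lemma nice_phi v : nice (fun L : V -> R => phi al (L v)).
Proof.
apply: nice_scale; apply: nice_mul; first exact: nice_coord.
exact: (proj1 (pnice_inv (pnice_W v))).
Qed.

Lemma pnice_tail v : pnice (fun L : V -> R => tail al (L v)).
Proof.
rewrite /tail; apply: pnice_mul; first exact: pnice_coord.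
apply: pnice_inv; rewrite (_ : (fun L : V -> R => W al (L v) ^+ 3) =
  (fun L => W al (L v) * (W al (L v) * W al (L v)))).
  by do 2 (apply: pnice_mul; first exact: pnice_W); exact: pnice_W.
by apply/funext => L; rewrite !exprS expr0 mulr1.
Qed.

Lemma nice_offset u v : nice (fun L : V -> R => offset al (L u) (L v)).
Proof. by apply: nice_add; [|apply: nice_opp]; exact: nice_phi. Qed.

Lemma pnice_tails u v : pnice (fun L : V -> R => tails al (L u) (L v)).
Proof.
apply: pnice_add; [exact: pnice_tail|exact: (proj1 (pnice_tail v))|].
by move=> L L0; rewrite ltW// tail_gt0.
Qed.

Lemma pnice_dist2 u v : pnice (fun L : V -> R => dist2 al (L u) (L v)).
Proof.
rewrite /dist2 (_ : (fun L : V -> R => _) = (fun L : V -> R =>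
  (tails al (L u) (L v) + tails al (L u) (L v)) + offset al (L u) (L v) ^+ 2)).
  apply: pnice_add.
  - apply: pnice_add; [exact: pnice_tails|exact: (proj1 (pnice_tails u v))|].
    by move=> L L0; rewrite ltW// tails_gt0.
  - by apply: nice_sq; exact: nice_offset.
  - by move=> L _; exact: sqr_ge0.
by apply/funext => L; rewrite mulr_natl mulr2n.
Qed.

Lemma nice_ratio u v : nice (fun L : V -> R => tails al (L u) (L v) / dist2 al (L u) (L v)).
Proof.
by apply: nice_mul; [exact: (proj1 (pnice_tails u v))|exact: (proj1 (pnice_inv (pnice_dist2 u v)))].
Qed.

Lemma nice_wall u v : nice (fun L : V -> R => wall al c (L u) (L v)).
Proof.
apply: nice_add; first by apply: nice_opp; apply: nice_ln; exact: pnice_dist2.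
by apply: nice_scale; exact: nice_ratio.
Qed.

Lemma nice_slope u v : nice (fun L : V -> R => slope al c (L u) (L v)).
Proof.
rewrite /slope /slope_term; apply: nice_mul.
  apply: nice_opp; apply: nice_mul; last exact: (proj1 (pnice_inv (pnice_dist2 u v))).
  by apply: nice_scale; exact: nice_offset.
by apply: nice_add; [exact: nice_const|apply: nice_scale; exact: nice_ratio].
Qed.

Lemma nice_cutoff v : nice (fun L : V -> R => cutoff al s0 (L v) (mass L)).
Proof.
apply: nice_max0; apply: nice_add; first exact: nice_const.
apply: nice_opp; apply: nice_mul; last exact: nice_const.
apply: nice_mul; apply: nice_mul.
- exact: (proj1 (pnice_W v)).
- exact: (proj1 (pnice_inv (pnice_coord v))).
- exact: (proj1 pnice_mass).
- by apply: (proj1 (pnice_inv _)); apply: pnice_powR; exact: pnice_mass.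
Qed.

Lemma nice_side v : nice (fun L : V -> R => side al s0 A1 E0 (L v) (mass L)).
Proof.
apply: nice_add.
  apply: nice_scale; apply: (proj1 (pnice_inv _)); apply: pnice_powR; exact: pnice_coord.
by apply: nice_opp; apply: nice_scale; apply: nice_sq; exact: nice_cutoff.
Qed.

Lemma nice_corr u v : nice (fun L : V -> R => corr al c s0 C (L u) (L v) (mass L)).
Proof.
apply: nice_add; apply: nice_mul.
- exact: nice_slope.
- exact: (proj1 (pnice_inv (pnice_W u))).
- by apply: nice_scale; exact: nice_cutoff.
- exact: (proj1 (pnice_inv (pnice_coord u))).
Qed.

Lemma nice_lyapG x : nice (lyapG al c s0 A1 E0 C a b x).
Proof.
apply: nice_add.
  by apply: nice_add; [exact: nice_wall|apply: nice_add; exact: nice_side].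
apply: nice_mul; last exact: (proj1 (pnice_inv pnice_wsum)).
rewrite /corr_at; case: (x == a); first exact: nice_corr.
by case: (x == b); [exact: nice_corr|exact: nice_const].
Qed.
End nice_lyapG.

(** It remains to choose the constants. D0 compares W of the total time with H; s0 is
    half its inverse, so that the growth of the share costs half the reserve; Lam
    compares H with W where the share is at least s0 / 2; c is large with respect to
    Lam; C, A1 and E0 are then given by the balance equations. *)
Lemma exists_lyapunov : a != b -> exists G, lyapunov G.
Proof.
move=> ab.
pose D0 : R := W al #|V|%:R.
have D00 : 0 < D0 by apply: powR_gt0; rewrite ltr0n; apply/card_gt0P; exists a.
pose s0 : R := (2 * D0)^-1.
have s00 : 0 < s0 by rewrite invr_gt0 mulr_gt0.
have am : 0 < al - 1 by rewrite subr_gt0.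
have al0 : 0 < al by rewrite (lt_trans _ al1).
pose Lam : R := ((s0 / 2) `^ (al / (al - 1)))^-1.
have Lam0 : 0 < Lam by rewrite invr_gt0 powR_gt0// divr_gt0.
have k0 : 0 < 3 * al - 1 by lra.
pose c : R := 16 / 7 * (2 * (3 * al - 1) * Lam + 2).
have kL : 0 < 2 * (3 * al - 1) * Lam by rewrite !mulr_gt0.
have c7 : 32 / 7 <= c by rewrite /c; lra.
have c0 : 0 <= c by apply: le_trans c7.
pose C : R := 4 * (3 * al - 1).
have C0 : 0 < C by rewrite mulr_gt0.
pose A1 : R := C * D0 * s0 / (2 * (al - 1)).
pose E0 : R := ((1 + 3/2 * c) * (3 * al - 1) + (2 + c) * al) / ((al + 1) / 2).
have E00 : 0 <= E0.
  have a1 : 0 <= (al + 1) / 2 by rewrite divr_ge0// addr_ge0// ltW.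
  apply: divr_ge0 => //; apply: addr_ge0; apply: mulr_ge0; rewrite ?(ltW k0) ?(ltW al0)//.
    by rewrite addr_ge0// mulr_ge0.
  by rewrite addr_ge0.
have A10 : 0 <= A1 by apply: ltW; rewrite /A1 divr_gt0 ?mulr_gt0.
have A1E : 2 * A1 * (al - 1) / s0 = C * D0 by rewrite /A1; field; rewrite !gt_eqF.
have cL : 2 * (3 * al - 1) * Lam <= 7/16 * c - 2 by rewrite /c; lra.
have E0P : (1 + 3/2 * c) * (3 * al - 1) + (2 + c) * al <= E0 * ((al + 1) / 2).
  rewrite /E0 divfK// gt_eqF// divr_gt0// addr_gt0//.
have LamP A T : 0 < A -> A <= T -> s0 / 2 <= share al A T -> W al T <= Lam * W al A.
  move=> A0 AT sgA; have T0 := lt_le_trans A0 AT.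
  have E (x : R) : 0 < x -> W al x / x = x `^ (al - 1).
    move=> x0; rewrite powRB; last by rewrite (gt_eqF x0) implybT.
    by rewrite powRr1// ltW.
  have p0 : 0 <= al / (al - 1) by rewrite divr_ge0 ?ltW.
  have h : (s0 / 2) `^ (al / (al - 1)) <= share al A T `^ (al / (al - 1)).
    apply: ge0_ler_powR => //; rewrite nnegrE.
      by rewrite divr_ge0// ltW.
    by rewrite ltW// share_gt0.
  have sE : share al A T `^ (al / (al - 1)) = W al A / W al T.
    rewrite /share E// -(invf_div (W al T)) E// powRM ?powR_ge0 ?invr_ge0 ?powR_ge0//.
    rewrite -powRN -!powRrM mulrCA divff ?gt_eqF// mulr1.
    by rewrite mulNr mulrCA divff ?gt_eqF// mulr1 powRN.
  rewrite sE in h.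
  rewrite /Lam mulrC ler_pdivlMr ?powR_gt0 ?divr_gt0// mulrC.
  by rewrite -ler_pdivlMr// W_gt0.
exists (lyapG al c s0 A1 E0 C a b); split.
- exact: nice_lyapG.
- by move=> x L h L0 h0; exact: (lyap_flow ab al1 s00 erefl erefl A1E c7 cL LamP E0P).
- by move=> l l0; exact: (lyapG_lower a b al1 s00 c0 A10 E00 (ltW C0)).
- by move=> l K l0; exact: (lyapG_blowup a b al1 s00 c0 A10 E00 (ltW C0) K l0).
Qed.

End Interface.

(** * Direct jumps of a path with one-sided limits *)

Section Paths.
Variables (R : realType) (V : finType) (x : R -> V).
Implicit Types (t h s r : R) (n k : nat) (u v : V).

Hypothesis right_cont : forall t, 0 <= t -> \forall s \near t^'+, x s = x t.
Hypothesis left_lim : forall t, 0 < t -> exists u, \forall s \near t^'-, x s = u.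

Lemma right_stay t : 0 <= t -> exists2 e, 0 < e & forall s, t <= s < t + e -> x s = x t.
Proof.
move=> t0; have [e /= e0 eP] := right_cont t0.
exists e => // s /andP[]; rewrite le_eqVlt => /predU1P[->//|ts] ste.
by apply: eP => //=; rewrite ltr_distlC; apply/andP; split; lra.
Qed.

Lemma left_stay t : 0 < t -> exists u, exists2 e, 0 < e &
  forall s, t - e < s < t -> x s = u.
Proof.
move=> t0; have [u [e /= e0 eP]] := left_lim t0.
exists u, e => // s /andP[ts st].
by apply: eP => //=; rewrite ltr_distlC; apply/andP; split; lra.
Qed.

Definition jump_at r u v := (\forall s \near r^'-, x s = u) /\ x r = v.

(** Near each time r the path is constant on the left of r and on the right of r, so
    two times close to r with different positions have the jump at r between
    them; a uniform distance follows by compactness. *)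
Lemma close_jump a b : 0 <= a -> exists2 d, 0 < d &
  forall s s', a <= s -> s < s' -> s' <= b -> s' - s < d -> x s != x s' ->
    exists2 r, s < r <= s' & jump_at r (x s) (x s').
Proof.
move=> a0.
have /compact_near_coveringP/near_covering_withinP cov := @segment_compact R a b.
have : \forall d \near 0^'+, `[a, b]%classic `<=`
    (fun s => forall s', s < s' -> s' <= b -> s' - s < d -> x s != x s' ->
       exists2 r, s < r <= s' & jump_at r (x s) (x s')).
  apply: cov => r; rewrite /= in_itv/= => /andP[ar rb].
  have r0 : 0 <= r := le_trans a0 ar.
  have [e e0 eP] := right_stay r0.
  have [u [e' e'0 e'P]] : exists u, exists2 e, 0 < e &
      forall s, a <= s -> r - e < s < r -> x s = u.
    have [r_gt0|] := ltP 0 r; last first.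
      move=> r00; exists (x 0), 1 => // s as_ /andP[_ sr]; exfalso; lra.
    by have [u [e1 e10 e1P]] := left_stay r_gt0; exists u, e1 => // s _; exact: e1P.
  have e2 : 0 < Num.min e e' / 2 by rewrite divr_gt0// lt_min e0.
  near=> s d; rewrite /= in_itv/= => /andP[as_ _] s' ss' s'b s'sd.
  have hz : `|r - s| < Num.min e e' / 2.
    by near: s; apply/nbhs_ballP; exists (Num.min e e' / 2).
  have hd : d < Num.min e e' / 2 by near: d; exact: nbhs_right_lt.
  have m1 : Num.min e e' <= e by rewrite ge_min lexx.
  have m2 : Num.min e e' <= e' by rewrite ge_min lexx orbT.
  move: hz; rewrite ltr_distlC => /andP[hz1 hz2].
  have [rs|sr] := leP r s.
    have E1 : x s = x r by apply: eP; apply/andP; split=> //; lra.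
    have E2 : x s' = x r by apply: eP; apply/andP; split; lra.
    by rewrite E1 E2 eqxx.
  have xs : x s = u by apply: e'P => //; apply/andP; split; lra.
  have [s'r|rs'] := ltP s' r.
    have E2 : x s' = u by apply: e'P; [lra|apply/andP; split=> //; lra].
    by rewrite xs E2 eqxx.
  move=> _; exists r; first by rewrite sr.
  split; last by apply/esym/eP; apply/andP; split=> //; lra.
  have : s < r by [].
  move=> sr'; near=> z; rewrite xs; apply: e'P.
    apply: le_trans as_ _; apply: ltW; near: z; exact: nbhs_left_gt.
  apply/andP; split; last by near: z; exact: nbhs_left_lt.
  apply: (@lt_trans _ _ s); first lra.
  by near: z; exact: nbhs_left_gt.
case=> d /= d0 H; exists (d / 2); first by rewrite divr_gt0.
move=> s s' as_ ss' s'b s'sd; apply: (H (d / 2)) => //=.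
- by rewrite sub0r normrN gtr0_norm ?divr_gt0// ltr_pdivrMr// ltr_pMr// ltr1n.
- by rewrite divr_gt0.
- by rewrite in_itv/= as_; lra.
Unshelve. all: by end_near.
Qed.
End Paths.

(** * Detecting jumps on dyadic grids *)

Section Grid.
Variables (R : realType) (V : finType).
Implicit Types (t h s r : R) (n k : nat) (u v : V).

Definition grid t h n k : R := t + h * (k%:R / (2 ^ n)%:R).

Let pow2_gt0 n : 0 < (2 ^ n)%:R :> R. Proof. by rewrite ltr0n expn_gt0. Qed.

Lemma grid0 t h n : grid t h n 0 = t.
Proof. by rewrite /grid mul0r mulr0 addr0. Qed.

Lemma grid_last t h n : grid t h n (2 ^ n) = t + h.
Proof. by rewrite /grid divff ?mulr1// gt_eqF. Qed.

Lemma gridS t h n k : grid t h n k.+1 = grid t h n k + h / (2 ^ n)%:R.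
Proof. by rewrite /grid -natr1 mulrDl mulrDr addrA mul1r. Qed.

Lemma grid_refine t h n k : grid t h n.+1 (2 * k) = grid t h n k.
Proof.
rewrite /grid expnS !natrM invfM mulrACA divff ?mul1r// pnatr_eq0.
Qed.

Lemma grid_ge t h n k : 0 <= h -> t <= grid t h n k.
Proof. by move=> h0; rewrite lerDl mulr_ge0// divr_ge0// ltW. Qed.

Lemma grid_le t h n k : 0 <= h -> (k <= 2 ^ n)%N -> grid t h n k <= t + h.
Proof.
move=> h0 kn; rewrite lerD2l -[leRHS]mulr1 ler_wpM2l// ler_pdivrMr// mul1r.
by rewrite ler_nat.
Qed.

Lemma grid_after t h n a : 0 < h -> t < a <= t + h ->
  exists2 k, (k < 2 ^ n)%N & grid t h n k < a <= grid t h n k.+1.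
Proof.
move=> h0 /andP[ta ath].
have cell N (y : R) : 0 < y <= N%:R -> exists2 k, (k < N)%N & k%:R < y <= k.+1%:R.
  elim: N => [|N IH] /andP[y0 yN]; first by exfalso; move: yN; rewrite leNgt y0.
  have [yN'|Ny] := leP y N%:R.
    have [|k kN kP] := IH; first by rewrite y0.
    by exists k => //; rewrite ltnS ltnW.
  by exists N => //; rewrite Ny.
have [|k kn /andP[k1 k2]] := cell (2 ^ n)%N ((a - t) / h * (2 ^ n)%:R).
  rewrite mulr_gt0 ?divr_gt0 ?subr_gt0//= -[leRHS]mul1r ler_pM2r//.
  by rewrite ler_pdivrMr// mul1r lerBlDl.
exists k => //; rewrite /grid -ltrBrDl -lerBlDl.
have -> : a - t = h * ((a - t) / h) by rewrite mulrC divfK// gt_eqF.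
by rewrite ltr_pM2l// ler_pM2l// ltr_pdivrMr// ler_pdivlMr// k1.
Qed.

Lemma mesh_small h d : 0 < h -> 0 < d ->
  exists n0, forall n, (n0 <= n)%N -> h / (2 ^ n)%:R < d.
Proof.
move=> h0 d0; exists (Num.truncn (h / d)).+1 => n nn.
rewrite ltr_pdivrMr// mulrC -ltr_pdivrMr//.
apply: (@lt_trans _ _ n%:R); last by rewrite ltr_nat ltn_expl.
by apply: lt_le_trans (truncnS_gt _) _; rewrite ler_nat.
Qed.

Lemma first_change (T : eqType) (y : nat -> T) i j : (i <= j)%N -> y j != y i ->
  exists k, [/\ (i <= k < j)%N, y k = y i & y k.+1 != y i].
Proof.
move=> ij yij; have ex : exists k, (i <= k)%N && (y k != y i) by exists j; rewrite ij.
case: (ex_minnP ex) => m /andP[im ym] mmin.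
have m0 : (i < m)%N.
  by rewrite ltn_neqAle im andbT; apply: contraNneq ym => ->; rewrite eqxx.
have mE : m = m.-1.+1 by rewrite prednK// (leq_ltn_trans _ m0).
have mj : (m <= j)%N by apply: mmin; rewrite ij.
exists m.-1; split.
- by rewrite -mE mj andbT -ltnS -mE.
- apply/eqP; apply: contraTT (leqnn m) => ym1; rewrite -ltnNge {2}mE ltnS.
  by apply: mmin; rewrite ym1 andbT -ltnS -mE.
- by rewrite -mE.
Qed.

Variable x : R -> V.
Hypothesis right_cont : forall t, 0 <= t -> \forall s \near t^'+, x s = x t.
Hypothesis left_lim : forall t, 0 < t -> exists u, \forall s \near t^'-, x s = u.

(** On a grid finer than the distance of [close_jump], the first cell where the
    position changes contains a direct jump from the initial position. *)
Lemma first_jump t h : 0 <= t -> 0 < h -> x (t + h) != x t ->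
  exists v, v != x t /\ exists2 r, t < r <= t + h & jump_at x r (x t) v.
Proof.
move=> t0 h0 xth; have [d d0 dP] := close_jump right_cont left_lim (t + h) t0.
have [n /(_ n (leqnn n)) nP] := mesh_small h0 d0.
have [|k [/andP[_ kn] yk yk1]] := @first_change _ (fun k => x (grid t h n k)) 0 (2 ^ n) isT.
  by rewrite grid_last grid0.
rewrite grid0 in yk yk1.
have [|||||r] := dP (grid t h n k) (grid t h n k.+1).
- exact/grid_ge/ltW.
- by rewrite gridS ltrDl divr_gt0.
- by apply: grid_le => //; exact: ltW.
- by rewrite gridS addrAC subrr add0r.
- by rewrite yk eq_sym.
move=> /andP[r1 r2]; rewrite yk => jr; exists (x (grid t h n k.+1)); split => //.
exists r => //; rewrite (le_lt_trans (grid_ge t n k (ltW h0)) r1)/=.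
by apply: le_trans r2 _; apply: grid_le => //; exact: ltW.
Qed.

(** A change before a cell and another one within the cell. The first event
    belongs to the past of the cell, so the two probabilities multiply. *)
Definition two_changes t h n := exists2 k, (k < 2 ^ n)%N &
  x (grid t h n k) != x t /\ x (grid t h n k.+1) != x (grid t h n k).

(** If the position at the midpoint of the cell is still the one at its left end, then
    the change lies in the right half. Otherwise it lies in the left half. *)
Lemma two_changes_refine t h n : two_changes t h n -> two_changes t h n.+1.
Proof.
move=> [k kn [xk xk1]].
have [xm|xm] := eqVneq (x (grid t h n.+1 (2 * k).+1)) (x (grid t h n k)).
  exists (2 * k).+1; first by rewrite expnS; lia.
  rewrite xm; split => //.
  by rewrite (_ : (2 * k).+2 = 2 * k.+1)%N ?grid_refine//; lia.
exists (2 * k)%N; first by rewrite expnS; lia.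
by rewrite grid_refine.
Qed.

(** An intermediate position different from both end positions is seen on a fine
    grid, by right continuity, and the path has to leave it again. *)
Lemma revisit_changes t h a : 0 <= t -> 0 < h -> t < a <= t + h ->
  x a != x t -> x (t + h) != x a -> exists n, two_changes t h n.
Proof.
move=> t0 h0 ath xat xth.
have a0 : 0 <= a by case/andP: ath => ta _; rewrite (le_trans t0)// ltW.
have [e e0 eP] := right_stay right_cont a0.
have [n /(_ n (leqnn n)) nP] := mesh_small h0 e0.
have [k kn /andP[k1 k2]] := grid_after n h0 ath.
have xk : x (grid t h n k.+1) = x a.
  by apply: eP; rewrite k2/= gridS ltrD.
have [|j [/andP[kj jn] yj yj1]] := @first_change _ (fun k => x (grid t h n k)) k.+1 (2 ^ n) kn.
  by rewrite grid_last xk.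
by exists n, j => //; rewrite yj yj1 xk.
Qed.

(** Direct jumps are read off countably many times, which makes the jump events
    measurable. *)
Lemma jump_grid t h u v : 0 <= t -> 0 < h -> u != v ->
  (exists2 r, t < r <= t + h & jump_at x r u v) <->
  exists n0, forall n, (n0 <= n)%N -> exists2 k, (k < 2 ^ n)%N &
    x (grid t h n k) = u /\ x (grid t h n k.+1) = v.
Proof.
move=> t0 h0 uv; split.
  move=> [r /andP[tr rth] [[e' /= e'0 e'P] xr]].
  have r0 : 0 <= r by rewrite (le_trans t0)// ltW.
  have [e e0 eP] := right_stay right_cont r0.
  have ee : 0 < Num.min e e' by rewrite lt_min e0.
  have [n0 n0P] := mesh_small h0 ee; exists n0.
  move=> n /n0P; rewrite lt_min => /andP[ne ne'].
  have [|k kn /andP[k1 k2]] := @grid_after t h n r h0; first by rewrite tr.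
  exists k => //; split.
    apply: e'P => //=; rewrite ltr_distlC.
    by move: k2; rewrite gridS => k2; apply/andP; split; lra.
  by rewrite -xr; apply: eP; rewrite k2/= gridS ltrD.
move=> [n0 n0P]; have [d d0 dP] := close_jump right_cont left_lim (t + h) t0.
have [n1 n1P] := mesh_small h0 d0.
have [k kn [ku kv]] := n0P _ (leq_maxl n0 n1); have nP := n1P _ (leq_maxr n0 n1).
set n := maxn n0 n1 in k kn ku kv nP *.
have [|||||r] := dP (grid t h n k) (grid t h n k.+1).
- exact/grid_ge/ltW.
- by rewrite gridS ltrDl divr_gt0.
- by apply: grid_le => //; exact: ltW.
- by rewrite gridS addrAC subrr add0r.
- by rewrite ku kv.
move=> /andP[r1 r2]; rewrite ku kv => jr.
exists r => //; rewrite (le_lt_trans (grid_ge t n k (ltW h0)) r1)/=.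
by apply: le_trans r2 _; apply: grid_le => //; exact: ltW.
Qed.

End Grid.

(** * Local times *)

Section LocalTime.
Context {R : realType} {d : measure_display} {Omega : measurableType d}.
Context {V : finType}.
Variables (X : R -> Omega -> V) (l0 : V -> R).
Hypothesis Xcadlag : cadlag X.
Implicit Types (t h s : R) (w : Omega) (u v : V).

Let rc w t : 0 <= t -> \forall s \near t^'+, X s w = X t w.
Proof. by move: t; apply: (Xcadlag w).1. Qed.

Definition occ v t w : set R := [set s | 0 <= s <= t /\ X s w = v].

Notation past t := (g_sigma_algebraType (history X t)).

Definition occ_graph v t : set (past t * R) := [set p | occ v t p.1 p.2].
Arguments occ_graph : clear implicits.

Lemma history_measurable t s v : 0 <= s <= t ->
  measurable (X s @^-1` [set v] : set (past t)).
Proof. by move=> st; apply: sub_sigma_algebra; exists s, v. Qed.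

(** By right continuity, the position at time s is the position at the next grid
    point for all fine grids. Sampling at that point, or at t if it is smaller,
    only uses the past of t. *)
Lemma measurable_occ_graph v t : 0 <= t -> measurable (occ_graph v t).
Proof.
move=> t0.
pose c n k : R := k%:R / (2 ^ n)%:R.
pose A n := \bigcup_k ((X (Num.min t (c n k.+1)) @^-1` [set v] : set (past t)) `*`
                       ([set` `[c n k, c n k.+1[] `&` `[0, t]%classic)).
have c0 n k : 0 <= c n k by rewrite divr_ge0.
have cS n k : c n k.+1 = c n k + 1 / (2 ^ n)%:R by rewrite /c -natr1 mulrDl.
have -> : occ_graph v t = \bigcup_n0 \bigcap_(n >= n0) A n.
  apply/seteqP; split => -[w s].
    move=> [/= /andP[s0 st] Xs].
    have [e e0 eP] := right_stay (@rc w) s0.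
    have [n0 n0P] := mesh_small (ltr01 : 0 < (1 : R)) e0.
    exists n0 => // n /= /n0P ne; exists (Num.truncn (s * (2 ^ n)%:R)) => //=.
    set k := Num.truncn _.
    have p0 : 0 < (2 ^ n)%:R :> R by rewrite ltr0n expn_gt0.
    have /andP[k1 k2] : c n k <= s < c n k.+1.
      rewrite /c ler_pdivrMr// ltr_pdivlMr//.
      by rewrite truncn_itv// mulr_ge0// ltW.
    split; last by split; rewrite in_itv/= ?k1 ?k2 ?s0.
    rewrite -Xs; apply: eP; apply/andP; split; first by rewrite le_min st ltW.
    by rewrite gt_min; apply/orP; right; move: k1; rewrite cS; lra.
  move=> [n0 _ n0P]; have /= : occ_graph v t (w, s); last by [].
  have [k0 _ /= [_ [_ ]]] := n0P n0 (leqnn n0).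
  rewrite in_itv/= => /andP[s0 st].
  have [e e0 eP] := right_stay (@rc w) s0.
  have [n1 n1P] := mesh_small (ltr01 : 0 < (1 : R)) e0.
  have := n1P _ (leq_maxr n0 n1) => ne.
  have [k _ /= [Xk [+ _]]] := n0P _ (leq_maxl n0 n1).
  rewrite in_itv/= => /andP[k1 k2]; split => /=; first by rewrite s0.
  rewrite -Xk; apply/esym/eP; apply/andP; split; first by rewrite le_min st ltW.
  by rewrite gt_min; apply/orP; right; move: k1; rewrite cS; lra.
apply: bigcupT_measurable => n0; apply: bigcap_measurable => [|n _]; first by exists n0 => /=.
apply: bigcupT_measurable => k; apply: measurableX.
  by apply: history_measurable; rewrite le_min t0 c0/= ge_min lexx.
exact: measurableI.
Qed.

Lemma measurable_occ v t w : 0 <= t -> measurable (occ v t w).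
Proof.
move=> t0; have := measurable_xsection (w : past t) (measurable_occ_graph v t0).
by congr measurable; apply/seteqP; split => s; rewrite /xsection/= inE.
Qed.

Notation mu := (@lebesgue_measure R).

Lemma occ_finite v t w : 0 <= t -> (mu (occ v t w) <= t%:E)%E.
Proof.
move=> t0; apply: (@le_trans _ _ (mu `[0, t]%classic)).
  apply: le_measure; rewrite ?inE//; first exact: measurable_occ.
  by move=> s [st _]; rewrite /= in_itv.
rewrite lebesgue_measure_itv/= lte_fin; case: ifP => _; first by rewrite sube0.
by rewrite lee_fin.
Qed.

Lemma occ_fin_num v t w : 0 <= t -> mu (occ v t w) \is a fin_num.
Proof.
move=> t0; rewrite ge0_fin_numE ?measure_ge0//.
by apply: le_lt_trans (occ_finite v w t0) _; rewrite ltry.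
Qed.

Lemma local_timeE v t w : 0 <= t ->
  local_time l0 X v t w = l0 v + fine (mu (occ v t w)).
Proof.
move=> t0; rewrite /local_time /Rintegral; congr (_ + fine _).
transitivity (\int[mu]_(s in `[0%R, t]) (\1_(occ v t w) s)%:E)%E.
  apply: eq_integral => s; rewrite inE/= in_itv/= => st; rewrite indicE.
  congr ((_ : bool)%:R%:E); apply/eqP/idP => [Xs|]; first by rewrite inE.
  by rewrite inE => -[].
rewrite integral_indic//; last exact: measurable_occ.
congr (mu _); apply/seteqP; split => s; first by case.
by move=> os; split => //=; case: os => st _; rewrite in_itv.
Qed.

(** The measure of the sections of a measurable set is measurable. *)
Lemma measurable_local_time v t : 0 <= t ->
  measurable_fun [set: past t] (fun w : past t => local_time l0 X v t w).
Proof.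
move=> t0; rewrite (_ : (fun w => _) = fun w => l0 v + fine (mu (occ v t w))); last first.
  by apply/funext => w; exact: local_timeE.
apply: measurable_funD; first exact: measurable_cst.
apply: measurableT_comp => //.
have := @measurable_fun_xsection _ _ (past t) _ R mu _ (measurable_occ_graph v t0).
congr measurable_fun; apply/funext => w /=; congr (mu _).
by apply/seteqP; split => s; rewrite /xsection/= inE.
Qed.

Lemma local_time_ge v t w : 0 <= t -> l0 v <= local_time l0 X v t w.
Proof. by move=> t0; rewrite local_timeE// lerDl fine_ge0. Qed.

Lemma local_time_le v t w : 0 <= t -> local_time l0 X v t w <= l0 v + t.
Proof.
move=> t0; rewrite local_timeE// lerD2l -lee_fin fineK ?occ_fin_num//.
exact: occ_finite.
Qed.

Lemma itv_oc_measure t h : 0 <= h -> mu `]t, t + h]%classic = h%:E.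
Proof.
move=> h0; rewrite lebesgue_measure_itv/= lte_fin ltrDl.
move: h0; rewrite le_eqVlt => /predU1P[<-|h0]; first by rewrite ltxx.
by rewrite h0 -EFinD addrAC subrr add0r.
Qed.

Lemma occ_nondecr v t h w : 0 <= h -> occ v t w `<=` occ v (t + h) w.
Proof. move=> h0 s [/andP[s0 st] Xs]; split=> //; rewrite s0/=; lra. Qed.

Lemma local_time_nondecr v t h w : 0 <= t -> 0 <= h ->
  local_time l0 X v t w <= local_time l0 X v (t + h) w.
Proof.
move=> t0 h0; have th0 : 0 <= t + h by rewrite addr_ge0.
rewrite !local_timeE// lerD2l; apply: fine_le; rewrite ?occ_fin_num//.
apply: le_measure; rewrite ?inE; [exact: measurable_occ|exact: measurable_occ|].
exact: occ_nondecr.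
Qed.

Lemma local_time_incr v t h w : 0 <= t -> 0 <= h ->
  local_time l0 X v (t + h) w <= local_time l0 X v t w + h.
Proof.
move=> t0 h0; have th0 : 0 <= t + h by rewrite addr_ge0.
rewrite !local_timeE// -addrA lerD2l -lee_fin EFinD !fineK ?occ_fin_num//.
rewrite -[X in (_ <= _ + X)%E](itv_oc_measure t h0).
apply: (@le_trans _ _ (mu (occ v t w `|` `]t, (t + h)]%classic))); last first.
  by apply: measureU2 => //; exact: measurable_occ.
apply: le_measure; rewrite ?inE; [exact: measurable_occ| |].
  by apply: measurableU => //; exact: measurable_occ.
move=> s [/andP[s0 sth] Xs]; have [st|ts] := leP s t.
  by left; split => //; rewrite s0.
by right; rewrite /= in_itv/= ts.
Qed.

Lemma local_time_stay x t h w : 0 <= t -> 0 <= h ->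
  (forall s, t <= s <= t + h -> X s w = x) ->
  (fun v => local_time l0 X v (t + h) w) =
  (fun v => local_time l0 X v t w + (if v == x then h else 0)).
Proof.
move=> t0 h0 stay; have th0 : 0 <= t + h by rewrite addr_ge0.
apply/funext => v; rewrite !local_timeE//; case: eqVneq => [->|vx].
  rewrite -addrA; congr (_ + _); apply: EFin_inj; rewrite EFinD !fineK ?occ_fin_num//.
  rewrite -[X in (_ = _ + X)%E](itv_oc_measure t h0) -measureU//.
  - congr (mu _); apply/seteqP; split => s.
      move=> [/andP[s0 sth] Xs]; have [st|ts] := leP s t.
        by left; split => //; rewrite s0.
      by right; rewrite /= in_itv/= ts.
    move=> [os|]; first exact: occ_nondecr os.
    rewrite /= in_itv/= => /andP[ts sth]; split.
      by rewrite sth andbT (le_trans t0)// ltW.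
    by apply: stay; rewrite sth andbT ltW.
  - exact: measurable_occ.
  - by apply/seteqP; split => // s [[/andP[_ st] _]]; rewrite /= in_itv/=; move/andP => [ts _]; lra.
rewrite addr0; congr (_ + fine (mu _)); apply/seteqP; split; last exact: occ_nondecr.
move=> s [/andP[s0 sth] Xs]; split => //; rewrite s0/= leNgt; apply/negP => ts.
by move: vx; rewrite -Xs stay ?eqxx// sth andbT ltW.
Qed.

Lemma local_time_sum_ge t w : 0 <= t -> (forall v, 0 <= l0 v) ->
  t <= \sum_v local_time l0 X v t w.
Proof.
move=> t0 l00; apply: (@le_trans _ _ (\sum_v fine (mu (occ v t w)))); last first.
  by apply: ler_sum => v _; rewrite local_timeE// lerDr.
rewrite -lee_fin -sumEFin (eq_bigr (fun v => mu (occ v t w))); last first.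
  by move=> v _; rewrite fineK ?occ_fin_num.
have -> : t%:E = mu `[0, t]%classic.
  rewrite lebesgue_measure_itv/= lte_fin; move: t0; rewrite le_eqVlt => /predU1P[<-|t0].
    by rewrite ltxx.
  by rewrite t0 sube0.
have cov : `[0, t]%classic `<=` \big[setU/set0]_(v : V) occ v t w.
  move=> s; rewrite /= in_itv/= => st; rewrite -bigcup_seq/=.
  by exists (X s w) => //; rewrite /= mem_index_enum.
apply: (@le_trans _ _ (mu (\big[setU/set0]_(v : V) occ v t w))).
  apply: le_measure; rewrite ?inE//.
  by apply: bigsetU_measurable => v _; exact: measurable_occ.
elim: (index_enum V) => [|v r IH]; first by rewrite !big_nil measure0.
rewrite !big_cons; apply: le_trans (leeD2l _ IH).
apply: measureU2; first exact: measurable_occ.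
by apply: bigsetU_measurable => u _; exact: measurable_occ.
Qed.

End LocalTime.

(** * Expectations of bounded measurable functions *)

Section Expectation.
Context {R : realType} {d : measure_display} {T : measurableType d}.
Variable P : probability T R.
Implicit Types (f g phi : T -> R) (A B : set T).

Definition bmeas f : Prop := measurable_fun setT f /\ exists K, forall w, `|f w| <= K.
Definition Ex f : R := \int[P]_w f w.
Definition pr A : R := fine (P A).

Lemma bmeas_add f g : bmeas f -> bmeas g -> bmeas (fun w => f w + g w).
Proof.
move=> [mf [K fK]] [mg [K' gK']]; split; first exact: measurable_funD.
exists (K + K') => w; apply: le_trans (ler_normD _ _) _; exact: lerD.
Qed.

Lemma bmeas_mul f g : bmeas f -> bmeas g -> bmeas (fun w => f w * g w).
Proof.
move=> [mf [K fK]] [mg [K' gK']]; split; first exact: measurable_funM.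
by exists (K * K') => w; rewrite normrM ler_pM.
Qed.

Lemma bmeas_const (r : R) : bmeas (fun=> r).
Proof. by split; [exact: measurable_cst|exists `|r|]. Qed.

Lemma bmeas_scale (r : R) f : bmeas f -> bmeas (fun w => r * f w).
Proof. by move=> ?; apply: bmeas_mul => //; exact: bmeas_const. Qed.

Lemma bmeas_sub f g : bmeas f -> bmeas g -> bmeas (fun w => f w - g w).
Proof.
move=> bf bg; have := bmeas_add bf (bmeas_scale (-1) bg); congr bmeas.
by apply/funext => w; rewrite mulN1r.
Qed.

Lemma bmeas_indic A : measurable A -> bmeas (\1_A : T -> R).
Proof.
move=> mA; split; first exact: measurable_indic.
by exists 1 => w; rewrite indicE; case: (w \in A); rewrite ?normr1// normr0.
Qed.

Lemma bmeas_sum (I : Type) (s : seq I) (F : I -> T -> R) :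
  (forall i, bmeas (F i)) -> bmeas (fun w => \sum_(i <- s) F i w).
Proof.
move=> bF; elim: s => [|i s IH].
  by have := bmeas_const 0; congr bmeas; apply/funext => w; rewrite big_nil.
have := bmeas_add (bF i) IH; congr bmeas.
by apply/funext => w; rewrite big_cons.
Qed.

Lemma bmeas_integrable f : bmeas f -> P.-integrable setT (EFin \o f).
Proof.
move=> [mf [K fK]]; have PT : (P setT < +oo)%E by rewrite probability_setT ltry.
apply: measurable_bounded_integrable => //.
by exists K; split; [exact: num_real|move=> y Ky w _ /=; exact: le_trans (fK w) (ltW Ky)].
Qed.

Lemma ExD f g : bmeas f -> bmeas g -> Ex (fun w => f w + g w) = Ex f + Ex g.
Proof. by move=> bf bg; rewrite /Ex RintegralD//; exact: bmeas_integrable. Qed.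

Lemma ExB f g : bmeas f -> bmeas g -> Ex (fun w => f w - g w) = Ex f - Ex g.
Proof. by move=> bf bg; rewrite /Ex RintegralB//; exact: bmeas_integrable. Qed.

Lemma ExZ (r : R) f : bmeas f -> Ex (fun w => r * f w) = r * Ex f.
Proof. by move=> bf; rewrite /Ex RintegralZl//; exact: bmeas_integrable. Qed.

Lemma Ex_le f g : bmeas f -> bmeas g -> (forall w, f w <= g w) -> Ex f <= Ex g.
Proof.
by move=> bf bg fg; apply: le_Rintegral => //; exact: bmeas_integrable.
Qed.

Lemma pr_setT : pr setT = 1.
Proof. by rewrite /pr (_ : P setT = 1%E)//; exact: probability_setT. Qed.

Lemma Ex_const (r : R) : Ex (fun=> r) = r.
Proof. by rewrite /Ex Rintegral_cst// -/(pr _) pr_setT mulr1. Qed.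

Lemma Ex_indic A : measurable A -> Ex (\1_A) = pr A.
Proof. by move=> mA; rewrite /Ex /Rintegral integral_indic// setIT. Qed.

Lemma Ex_sum (I : Type) (s : seq I) (F : I -> T -> R) :
  (forall i, bmeas (F i)) -> Ex (fun w => \sum_(i <- s) F i w) = \sum_(i <- s) Ex (F i).
Proof.
move=> bF; elim: s => [|i s IH].
  rewrite big_nil -[RHS](Ex_const 0); congr Ex.
  by apply/funext => w; rewrite big_nil.
rewrite big_cons -IH -ExD//; last exact: bmeas_sum.
by congr Ex; apply/funext => w; rewrite big_cons.
Qed.

Lemma Ex_abs_le f g : bmeas f -> bmeas g -> (forall w, `|f w| <= g w) -> `|Ex f| <= Ex g.
Proof.
move=> bf bg fg; rewrite ler_norml; apply/andP; split.
  rewrite -mulN1r -ExZ//; apply: Ex_le => //; first exact: bmeas_scale.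
  by move=> w; rewrite mulN1r; have := fg w; rewrite ler_norml => /andP[].
by apply: Ex_le => // w; apply: le_trans (fg w); exact: ler_norm.
Qed.

Lemma pr_fin A : measurable A -> (pr A)%:E = P A.
Proof. by move=> mA; rewrite /pr fineK// fin_num_measure. Qed.

Lemma pr_ge0 A : 0 <= pr A. Proof. by rewrite fine_ge0. Qed.

Lemma pr_le A B : measurable A -> measurable B -> A `<=` B -> pr A <= pr B.
Proof.
by move=> mA mB AB; rewrite -lee_fin !pr_fin//; apply: le_measure; rewrite ?inE.
Qed.

Lemma pr_le1 A : measurable A -> pr A <= 1.
Proof. by move=> mA; rewrite -pr_setT; apply: pr_le. Qed.

(** The sum is the integer part of y. *)
Lemma trunc_layers (y : R) n : 0 <= y <= n%:R ->
  y - 1 <= \sum_(k < n) (k.+1%:R <= y)%R%:R <= y.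
Proof.
elim: n => [|n IH] /andP[y0 yn].
  by rewrite big_ord0 y0 andbT; move: yn; lra.
rewrite big_ord_recr/=; have [ny|yn1] := leP n.+1%:R y.
  have -> : \sum_(i < n) (i.+1%:R <= y)%R%:R = n%:R :> R.
    rewrite (eq_bigr (fun=> 1)); last first.
      by move=> i _; rewrite (le_trans _ ny)// ler_nat ltnS ltnW.
    by rewrite sumr_const card_ord.
  rewrite (_ : true%:R = 1 :> R)//.
  by move: ny yn; rewrite -natr1 => ny yn; apply/andP; split; lra.
rewrite addr0; have [yn'|ny] := leP y n%:R; first by apply: IH; rewrite y0.
have -> : \sum_(i < n) (i.+1%:R <= y)%R%:R = n%:R :> R.
  rewrite (eq_bigr (fun=> 1)); last first.
    by move=> i _; rewrite (le_trans _ (ltW ny))// ler_nat.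
  by rewrite sumr_const card_ord.
by move: yn1; rewrite -natr1 => yn1; apply/andP; split; lra.
Qed.

(** Layer-cake decomposition: phi is within 1 / n of the mean of the indicators of its
    n upper level sets, which belong to F. *)
Lemma Ex_mul_le_of_sets01 (F : set (set T)) g phi (e : R) :
  F `<=` measurable -> bmeas g -> bmeas phi -> (forall w, 0 <= phi w <= 1) ->
  (forall r, F [set w | r <= phi w]) ->
  (forall A, F A -> `|Ex (fun w => \1_A w * g w)| <= e) ->
  `|Ex (fun w => phi w * g w)| <= e.
Proof.
move=> FM bg bphi phi01 Fphi FE.
have [_ [K gK]] := bg.
have K0 : 0 <= K by apply: le_trans (gK point).
apply/ler_addgt0Pr => z z0.
pose n := (Num.truncn (K / z)).+1.
have n0 : 0 < n%:R :> R by rewrite ltr0n.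
have Kn : K / n%:R <= z.
  by rewrite ler_pdivrMr// mulrC -ler_pdivrMr// ltW// Num.Theory.truncnS_gt.
pose A k := [set w | k.+1%:R / n%:R <= phi w].
pose phin w : R := \sum_(k < n) n%:R^-1 * \1_(A k) w.
have bA k : bmeas (\1_(A k)) by apply: bmeas_indic; apply: FM; exact: Fphi.
have bphin : bmeas phin by apply: bmeas_sum => k; exact: bmeas_scale.
have close w : `|phi w - phin w| <= n%:R^-1.
  have yn : 0 <= phi w * n%:R <= n%:R.
    have /andP[p0 p1] := phi01 w.
    by rewrite mulr_ge0 ?(ltW n0)//= -[leRHS]mul1r ler_pM2r.
  have := trunc_layers yn; set s := \sum_(k < n) _ => /andP[s1 s2].
  have -> : phin w = s / n%:R.
    rewrite /phin -mulr_sumr mulrC; congr (_ * _); apply: eq_bigr => k _.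
    by rewrite indicE /A -ler_pdivrMr//; congr ((_ : bool)%:R); apply/idP/idP; rewrite inE.
  have -> : phi w - s / n%:R = (phi w * n%:R - s) / n%:R by field; rewrite gt_eqF.
  rewrite normrM (gtr0_norm (_ : 0 < n%:R^-1)) ?invr_gt0// ler_piMl ?invr_ge0 ?(ltW n0)//.
  by rewrite ler_norml; apply/andP; split; lra.
have -> : Ex (fun w => phi w * g w) =
   Ex (fun w => phin w * g w) + Ex (fun w => (phi w - phin w) * g w).
  rewrite -ExD//; [|exact: bmeas_mul|by apply: bmeas_mul => //; exact: bmeas_sub].
  by congr Ex; apply/funext => w; ring.
apply: le_trans (ler_normD _ _) _; apply: lerD; last first.
  apply: le_trans Kn; rewrite -[leRHS]Ex_const; apply: Ex_abs_le.
  - by apply: bmeas_mul => //; exact: bmeas_sub.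
  - exact: bmeas_const.
  - by move=> w; rewrite normrM mulrC; apply: ler_pM.
have -> : Ex (fun w => phin w * g w) = \sum_(k < n) n%:R^-1 * Ex (fun w => \1_(A k) w * g w).
  have bAg k : bmeas (fun w => \1_(A k) w * g w) by exact: bmeas_mul.
  under [RHS]eq_bigr do rewrite -ExZ//.
  rewrite -Ex_sum; last by move=> k; exact: bmeas_scale.
  by congr Ex; apply/funext => w; rewrite /phin mulr_suml; apply: eq_bigr => k _; rewrite -mulrA.
apply: le_trans (ler_norm_sum _ _ _) _.
apply: (@le_trans _ _ (\sum_(k < n) n%:R^-1 * e)).
  apply: ler_sum => k _; rewrite normrM (gtr0_norm (_ : 0 < n%:R^-1)) ?invr_gt0//.
  by apply: ler_wpM2l; [rewrite invr_ge0 ltW|apply: FE; exact: Fphi].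
by rewrite sumr_const card_ord -[leLHS]mulr_natl mulrA divff ?mul1r// gt_eqF.
Qed.

(** A conditional statement tested on the sets of a sigma-algebra extends to its bounded
    measurable functions, without conditional expectations of functions. *)
Lemma Ex_mul_le_of_sets (F : set (set T)) g phi (e K : R) :
  F `<=` measurable -> F setT -> bmeas g -> bmeas phi -> (forall w, `|phi w| <= K) -> 0 < K ->
  (forall r, F [set w | r <= phi w]) ->
  (forall A, F A -> `|Ex (fun w => \1_A w * g w)| <= e) ->
  `|Ex (fun w => phi w * g w)| <= 3 * K * e.
Proof.
move=> FM FT bg bphi phiK K0 Fphi FE.
pose psi w := (phi w + K) / (2 * K).
have K20 : 0 < 2 * K by rewrite mulr_gt0.
have bpsi : bmeas psi.
  by apply: bmeas_mul; [apply: bmeas_add => //|]; exact: bmeas_const.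
have psi01 w : 0 <= psi w <= 1.
  have := phiK w; rewrite ler_norml => /andP[h1 h2].
  by rewrite divr_ge0 ?(ltW K20)//=; [rewrite ler_pdivrMr// mul1r; lra|lra].
have h1 : `|Ex (fun w => psi w * g w)| <= e.
  apply: (@Ex_mul_le_of_sets01 F) => // r.
  rewrite (_ : [set w | _] = [set w | r * (2 * K) - K <= phi w])//.
  by apply/seteqP; split => w /=; rewrite /psi ler_pdivlMr// lerBlDr.
have h2 := FE _ FT.
have -> : Ex (fun w => phi w * g w) =
   2 * K * Ex (fun w => psi w * g w) - K * Ex (fun w => \1_setT w * g w).
  have b1 : bmeas (fun w => psi w * g w) by exact: bmeas_mul.
  have b2 : bmeas (fun w => \1_setT w * g w) by apply: bmeas_mul => //; exact: bmeas_indic.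
  rewrite -!ExZ// -ExB//; [|exact: bmeas_scale|exact: bmeas_scale].
  congr Ex; apply/funext => w; rewrite indicE in_setT (_ : true%:R = 1 :> R)// /psi; field.
  by rewrite gt_eqF.
apply: le_trans (ler_normB _ _) _; rewrite !normrM !(gtr0_norm K0) normr_nat.
have := ler_wpM2l (ltW K20) h1; have := ler_wpM2l (ltW K0) h2; lra.
Qed.

Lemma pr_bigcup_nondecr (F : nat -> set T) (K : R) : (forall n, measurable (F n)) ->
  (forall n, F n `<=` F n.+1) -> (forall n, pr (F n) <= K) -> pr (\bigcup_n F n) <= K.
Proof.
move=> mF ndF FK; have mU : measurable (\bigcup_n F n) by exact: bigcupT_measurable.
rewrite -lee_fin pr_fin//.
have nd : nondecreasing_seq F.
  by apply/nondecreasing_seqP => n; apply/subsetPset; exact: ndF.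
have := @nondecreasing_cvg_mu _ _ _ P F mF mU nd.
by apply: cvge_le; near=> n => /=; rewrite -pr_fin// lee_fin.
Unshelve. all: by end_near. Qed.

End Expectation.

(** * Jumps of the process over a short time interval *)

Section Step.
Context {R : realType} {d : measure_display} {Omega : measurableType d}.
Variables (P : probability Omega R) (V : finType) (l0 : V -> R) (al : R).
Variable X : R -> Omega -> V.
Hypotheses (hl0 : forall v, 0 < l0 v) (al1 : 1 < al).
Hypothesis hX : is_vrjp P (@complete_graph V) (fun x : R => x `^ al) l0 X.
Implicit Types (t h s r : R) (w : Omega) (u v : V) (A : set Omega).

Notation past t := (g_sigma_algebraType (history X t)).
Notation Ex := (Ex P).
Notation pr := (pr P).

Definition ltime t w : V -> R := fun v => local_time l0 X v t w.

Let Xc : cadlag X := vrjp_cadlag hX.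
Let rc w t : 0 <= t -> \forall s \near t^'+, X s w = X t w.
Proof. by move: t; apply: (Xc w).1. Qed.
Let ll w t : 0 < t -> exists u, \forall s \near t^'-, X s w = u.
Proof. by move: t; apply: (Xc w).2. Qed.

Lemma past_measurable t A : measurable (A : set (past t)) -> measurable A.
Proof.
move=> mA; apply: (smallest_sub (G := history X t) _ _ mA).
  exact: sigma_algebra_measurable.
by move=> B [s [v [/andP[s0 _] ->]]]; exact: (vrjp_measurable hX).
Qed.

Lemma past_measurable_fun t (f : Omega -> R) :
  measurable_fun [set: past t] (f : past t -> R) -> measurable_fun setT f.
Proof. by move=> mf _ Y mY; apply: (@past_measurable t); apply: mf. Qed.

Definition located t u : set Omega := X t @^-1` [set u].
Definition moved s r : set Omega := [set w | X r w != X s w].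

Lemma past_located t u : 0 <= t -> measurable (located t u : set (past t)).
Proof. by move=> t0; apply: history_measurable; rewrite t0 lexx. Qed.

Lemma past_moved t s r : 0 <= s <= t -> 0 <= r <= t ->
  measurable (moved s r : set (past t)).
Proof.
move=> st rt; rewrite (_ : moved s r =
    \bigcup_(u in [set: V]) (X s @^-1` [set u] `\` X r @^-1` [set u])).
  apply: fin_bigcup_measurable => [|u _]; first exact: finite_finset.
  by apply: measurableD; exact: history_measurable.
apply/seteqP; split => w /=; first by move=> /eqP Xw; exists (X s w).
by move=> [u _ [/= <- Xr]]; rewrite /moved/=; apply/eqP.
Qed.

(** The condition u != v matters: at u = v the jump event also contains times where
    the path does not move. *)
Definition jumps t h u v : set Omega :=
  [set w | u != v /\ (X t w = u /\ jump_event X t h v w)].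

Lemma jumps_path t h u v w : jumps t h u v w <->
  u != v /\ (X t w = u /\ exists2 r, t < r <= t + h & jump_at (X ^~ w) r u v).
Proof.
split => -[uv [Xt J]]; split => //; split => //.
  by case: J => r [tr lr Xr]; exists r => //; split => //; rewrite -Xt.
by case: J => r tr [lr Xr]; exists r; split => //; rewrite /left_limit Xt.
Qed.

Lemma measurable_jumps t h u v : 0 <= t -> 0 < h -> measurable (jumps t h u v).
Proof.
move=> t0 h0; have [->|uv] := eqVneq u v.
  rewrite (_ : jumps t h v v = set0) //.
  by apply/seteqP; split => // w [/=]; rewrite eqxx.
have g0 n k : 0 <= grid t h n k by rewrite (le_trans t0)// grid_ge// ltW.
rewrite (_ : jumps t h u v = X t @^-1` [set u] `&`
   \bigcup_n0 \bigcap_(n >= n0) \bigcup_(k in `I_(2 ^ n))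
     (X (grid t h n k) @^-1` [set u] `&` X (grid t h n k.+1) @^-1` [set v])).
  apply: measurableI; first exact: (vrjp_measurable hX).
  apply: bigcupT_measurable => n0; apply: bigcap_measurable => [|n _].
    by exists n0 => /=.
  by apply: bigcup_measurable => k _; apply: measurableI; apply: (vrjp_measurable hX).
apply/seteqP; split => w.
  move=> /jumps_path[_ [Xt J]]; split => //=.
  have [n0 n0P] := (jump_grid (@rc w) (@ll w) t0 h0 uv).1 J.
  by exists n0 => // n /= /n0P[k kn [ku kv]]; exists k.
move=> [/= Xt [n0 _ n0P]]; apply/jumps_path; split => //; split => //.
apply/(jump_grid (@rc w) (@ll w) t0 h0 uv).
by exists n0 => n /n0P[k /= kn [ku kv]]; exists k.
Qed.

Definition two_moves t h n : set Omega := [set w | two_changes (X ^~ w) t h n].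
(** The events increase with n, by [two_changes_refine]. *)
Definition multi_moves t h : set Omega := \bigcup_n two_moves t h n.

Lemma two_moves_bigcup t h n : two_moves t h n =
  \bigcup_(k in `I_(2 ^ n)) (moved t (grid t h n k) `&` moved (grid t h n k) (grid t h n k.+1)).
Proof.
apply/seteqP; split => w; first by move=> [k kn [k1 k2]]; exists k.
by move=> [k /= kn [k1 k2]]; exists k.
Qed.

Lemma measurable_moved s r : 0 <= s -> 0 <= r -> measurable (moved s r).
Proof.
move=> s0 r0; apply: (@past_measurable (Num.max s r)); apply: past_moved.
  by rewrite s0 le_max lexx.
by rewrite r0 le_max lexx orbT.
Qed.

Lemma measurable_two_moves t h n : 0 <= t -> 0 < h -> measurable (two_moves t h n).
Proof.
move=> t0 h0; have g0 k : 0 <= grid t h n k by rewrite (le_trans t0)// grid_ge// ltW.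
rewrite two_moves_bigcup; apply: bigcup_measurable => k _.
by apply: measurableI; exact: measurable_moved.
Qed.

Lemma measurable_multi_moves t h : 0 <= t -> 0 < h -> measurable (multi_moves t h).
Proof. by move=> t0 h0; apply: bigcupT_measurable => n; exact: measurable_two_moves. Qed.

(** A third position at time a would be seen as two changes on a fine grid. *)
Lemma not_multi_moves t h w a : 0 <= t -> 0 < h -> ~ multi_moves t h w -> t <= a <= t + h ->
  X a w = X t w \/ X a w = X (t + h) w.
Proof.
move=> t0 h0 nr /andP[]; rewrite le_eqVlt => /predU1P[<-|ta] ath; first by left.
have [|Xa] := eqVneq (X a w) (X t w); first by left.
right; apply: contra_notP nr => Xath.
have [|||n] := @revisit_changes _ _ (X ^~ w) (@rc w) t h a t0 h0.
- by rewrite ta.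
- by [].
- by apply/eqP => E; apply: Xath.
by exists n.
Qed.

(** Outside the rare event, a direct jump is the same as a change of the end
    position, hence at most one of the jump indicators is nonzero. *)
Lemma not_multi_moves_jump t h w v : 0 <= t -> 0 < h -> ~ multi_moves t h w ->
  jumps t h (X t w) v w <-> X t w != v /\ X (t + h) w = v.
Proof.
move=> t0 h0 nr; split.
  move=> /jumps_path[uv [_ [r /andP[tr rth] [_ Xr]]]]; split => //.
  have [|Xrt|<-//] := not_multi_moves (a := r) t0 h0 nr.
    by rewrite rth ltW.
  by move: uv; rewrite -Xr Xrt eqxx.
move=> [uv Xth]; apply/jumps_path; split => //; split => //.
have [|v' [v't [r rI jr]]] := first_jump (@rc w) (@ll w) t0 h0.
  by rewrite Xth eq_sym.
exists r => //; case: jr => lr Xr; split => //.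
have [||] := not_multi_moves (a := r) t0 h0 nr.
- by case/andP: rI => tr ->; rewrite ltW.
- by move=> E; move: v't; rewrite -Xr E eqxx.
- by move=> ->.
Qed.

Lemma moved_jump t h w : 0 <= t -> 0 < h -> moved t (t + h) w ->
  exists v, jumps t h (X t w) v w.
Proof.
move=> t0 h0 /= m; have [v [vt [r rI jr]]] := first_jump (@rc w) (@ll w) t0 h0 m.
by exists v; apply/jumps_path; rewrite eq_sym; split => //; split => //; exists r.
Qed.

(** * Probabilities of one and of several jumps *)

Lemma measurable_ltime t v : 0 <= t ->
  measurable_fun [set: past t] (fun w : past t => ltime t w v).
Proof. exact: measurable_local_time. Qed.

Lemma ltime_ge t w v : 0 <= t -> l0 v <= ltime t w v.
Proof. exact: local_time_ge. Qed.

Lemma ltime_gt0 t w v : 0 <= t -> 0 < ltime t w v.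
Proof. by move=> t0; apply: lt_le_trans (ltime_ge w v t0). Qed.

Lemma ltime_le t w v : 0 <= t -> ltime t w v <= l0 v + t.
Proof. exact: local_time_le. Qed.

Definition rate t v w : R := W al (ltime t w v).
Definition rmax T : R := \sum_v W al (l0 v + T).

Lemma rate_ge0 t v w : 0 <= rate t v w. Proof. exact: powR_ge0. Qed.

Lemma rmax_ge0 T : 0 <= rmax T. Proof. by apply: sumr_ge0 => v _; exact: powR_ge0. Qed.

Lemma rate_le T t v w : 0 <= t <= T -> rate t v w <= rmax T.
Proof.
move=> /andP[t0 tT]; apply: (@le_trans _ _ (W al (l0 v + T))).
  apply: W_le => //; first by rewrite ltW// ltime_gt0.
  by apply: le_trans (ltime_le w v t0) _; rewrite lerD2l.
by rewrite /rmax (bigD1 v)//= lerDl sumr_ge0// => u _; exact: powR_ge0.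
Qed.

Lemma past_rate t v : 0 <= t -> measurable_fun [set: past t] (rate t v : past t -> R).
Proof.
move=> t0; apply: (@measurableT_comp _ _ _ _ _ _ (fun x : R => x `^ al)).
  exact: measurable_powR.
exact: measurable_ltime.
Qed.

Lemma bmeas_rate t v : 0 <= t -> bmeas (rate t v).
Proof.
move=> t0; split; first by apply: past_measurable_fun; exact: past_rate.
exists (rmax t) => w; rewrite ger0_norm ?rate_ge0//.
by apply: rate_le; rewrite t0 lexx.
Qed.

Lemma bmeas_past t A : measurable (A : set (past t)) -> bmeas (\1_A : Omega -> R).
Proof. by move=> mA; apply: bmeas_indic; exact: past_measurable mA. Qed.

(** The indicator of a direct jump from u to v minus its conditional probability to
    first order in h. *)
Definition jump_noise t h u v w : R :=
  \1_(jumps t h u v) w - h * (\1_(located t u) w * rate t v w).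

Lemma bmeas_jump_noise t h u v : 0 <= t -> 0 < h -> bmeas (jump_noise t h u v).
Proof.
move=> t0 h0; apply: bmeas_sub; first by apply: bmeas_indic; exact: measurable_jumps.
apply: bmeas_scale; apply: bmeas_mul; last exact: bmeas_rate.
exact: bmeas_past (past_located u t0).
Qed.

Lemma indicI A B (w : Omega) : \1_(A `&` B) w = \1_A w * \1_B w :> R.
Proof. by rewrite !indicE in_setI; case: (w \in A); case: (w \in B); rewrite /= ?mulr1 ?mulr0. Qed.

(** The integral over A of the conditional probability p is the probability of a jump
    within A. As p is only almost everywhere close to the rate times h, and only
    on the event that X is at u, it is first clamped to that range. *)
Lemma jump_noise_set_le T e : 0 < e -> exists2 dl, 0 < dl &
  forall h t u v A, 0 < h < dl -> 0 < t <= T -> u != v ->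
    measurable (A : set (past t)) ->
    `|Ex (fun w => \1_A w * jump_noise t h u v w)| <= e * h * pr (A `&` located t u).
Proof.
move=> e0; have [dl /= dl0 dlP] := vrjp_rate hX T e0.
exists dl => // h t u v A /andP[h0 hdl] /andP[t0 tT] uv mA.
have [] := dlP h _ h0 t v; rewrite ?t0//; first by rewrite /= sub0r normrN gtr0_norm.
move=> p [mp ip pE] pb; have t0' := ltW t0.
have mB : measurable (A `&` located t u : set (past t)) by apply: measurableI => //; exact: past_located.
have mB' := past_measurable mB; set B := A `&` located t u in mB mB' *.
have mp' : measurable_fun setT p by exact: past_measurable_fun mp.
pose q w := Num.max (rate t v w * h - e * h) (Num.min (rate t v w * h + e * h) (p w)).
have brh : bmeas (fun w => rate t v w * h) by apply: bmeas_mul; [exact: bmeas_rate|exact: bmeas_const].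
have eh0 : 0 < e * h by rewrite mulr_gt0.
have qb w : `|q w - rate t v w * h| <= e * h.
  rewrite ler_distl /q; apply/andP; split; first by rewrite le_max lexx.
  by rewrite ge_max ge_min lexx andbT; lra.
have mq : measurable_fun setT q.
  apply: measurable_maxr; first by apply: measurable_funB; [exact: brh.1|exact: measurable_cst].
  apply: measurable_minr => //.
  by apply: measurable_funD; [exact: brh.1|exact: measurable_cst].
have bq : bmeas q.
  split => //; have [_ [K rK]] := brh; exists (K + e * h) => w.
  rewrite -(subrK (rate t v w * h) (q w)) addrC.
  by apply: le_trans (ler_normD _ _) _; exact: lerD.
have bB : bmeas (\1_B : Omega -> R) by exact: bmeas_indic.
have E1 : pr (A `&` jumps t h u v) = Ex (fun w => \1_B w * q w).
  rewrite /pr /Ex /Rintegral; congr fine.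
  rewrite (_ : A `&` _ = B `&` jump_event X t h v); last first.
    apply/seteqP; split => w; first by move=> [Aw [_ [Xt J]]].
    by move=> [[Aw Xt] J].
  rewrite -(pE B mB) (@ae_eq_integral _ _ _ P B (EFin \o q))//.
  - rewrite integral_mkcond; apply: eq_integral => w _.
    by rewrite patchE indicE; case: (w \in B) => /=; rewrite ?mul1r ?mul0r.
  - by apply/measurable_EFinP; exact: measurable_funTS.
  - by apply/measurable_EFinP; exact: measurable_funTS.
  apply: filterS pb => w H [_ Xt] /=; congr EFin.
  have : complete_graph (X t w) v by rewrite /complete_graph Xt.
  move=> /H; rewrite ler_distl => /andP[p1 p2].
  by rewrite /q min_r// max_r.
have mAJ : measurable (A `&` jumps t h u v).
  by apply: measurableI; [exact: past_measurable mA|exact: measurable_jumps].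
have -> : Ex (fun w => \1_A w * jump_noise t h u v w) = Ex (fun w => \1_B w * (q w - rate t v w * h)).
  have -> : (fun w => \1_A w * jump_noise t h u v w) =
      (fun w => \1_(A `&` jumps t h u v) w - \1_B w * (rate t v w * h)).
    apply/funext => w; rewrite /B (indicI A (jumps t h u v)) (indicI A (located t u)) /jump_noise; ring.
  rewrite ExB ?Ex_indic//; [|exact: bmeas_indic|exact: bmeas_mul].
  rewrite E1 -ExB; [|exact: bmeas_mul|exact: bmeas_mul].
  by congr Ex; apply/funext => w; rewrite mulrBr.
rewrite -Ex_indic// -ExZ//; apply: Ex_abs_le.
- by apply: bmeas_mul => //; exact: bmeas_sub.
- exact: bmeas_scale.
- move=> w; rewrite normrM mulrC; have iB : 0 <= (\1_B w : R) by rewrite indicE.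
  by rewrite (ger0_norm iB); exact: ler_wpM2r.
Qed.

(** A change of position over (t, t + h] requires a direct jump from the position at
    time t, whose probability given the past is O(h) since the rates are bounded up
    to time T. *)
Lemma moved_set_le T : exists2 C, 0 < C & exists2 dl, 0 < dl &
  forall h t A, 0 < h < dl -> 0 < t <= T -> measurable (A : set (past t)) ->
    pr (A `&` moved t (t + h)) <= C * h * pr A.
Proof.
have [dl dl0 dlP] := jump_noise_set_le T (@ltr01 R).
pose c := 1 + rmax T; have c0 : 0 < c by rewrite ltr_pwDl ?rmax_ge0.
exists (#|V|%:R * #|V|%:R * c + 1); first by rewrite ltr_wpDl// !mulr_ge0// ltW.
exists dl => // h t A hdl tT mA; have /andP[h0 _] := hdl; have /andP[t0 _] := tT.
have t0' := ltW t0; have mA' := past_measurable mA.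
have one u v : u != v -> pr (A `&` jumps t h u v) <= c * h * pr A.
  move=> uv; have mat := past_measurable (past_located u t0').
  have mJ := measurable_jumps u v t0' h0.
  have bA : bmeas (\1_A : Omega -> R) by exact: bmeas_indic.
  have bg := bmeas_jump_noise u v t0' h0.
  have -> : pr (A `&` jumps t h u v) = Ex (fun w => \1_A w * jump_noise t h u v w) +
      h * Ex (fun w => \1_(A `&` located t u) w * rate t v w).
    have b1 : bmeas (fun w => \1_(A `&` located t u) w * rate t v w).
      by apply: bmeas_mul; [apply: bmeas_indic; exact: measurableI|exact: bmeas_rate].
    rewrite -ExZ// -ExD; [|exact: bmeas_mul|exact: bmeas_scale].
    rewrite -Ex_indic; last exact: measurableI.
    congr Ex; apply/funext => w; rewrite (indicI A (jumps t h u v)) (indicI A (located t u)) /jump_noise; ring.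
  have prA : pr (A `&` located t u) <= pr A.
    by apply: pr_le => //; exact: measurableI.
  have h1 := dlP h t u v A hdl tT uv mA.
  have h2 : Ex (fun w => \1_(A `&` located t u) w * rate t v w) <= rmax T * pr (A `&` located t u).
    rewrite -Ex_indic; last exact: measurableI.
    have bi : bmeas (\1_(A `&` located t u) : Omega -> R) by apply: bmeas_indic; exact: measurableI.
    rewrite -ExZ//; apply: Ex_le.
    - by apply: bmeas_mul => //; exact: bmeas_rate.
    - exact: bmeas_scale.
    - move=> w; rewrite mulrC; apply: ler_wpM2r; first by rewrite indicE.
      by apply: rate_le; rewrite t0'; case/andP: tT.
  have h3 := le_trans (ler_norm _) h1.
  apply: (@le_trans _ _ (c * h * pr (A `&` located t u))).
    have := ler_wpM2l (ltW h0) h2; rewrite /c; lra.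
  by apply: ler_wpM2l => //; rewrite mulr_ge0// ltW.
pose S w : R := \sum_u \sum_v (if u != v then \1_(A `&` jumps t h u v) w else 0).
have bF u v : bmeas (fun w => if u != v then \1_(A `&` jumps t h u v) w else 0 : R).
  case: (u != v); last exact: bmeas_const.
  by apply: bmeas_indic; apply: measurableI => //; exact: measurable_jumps.
have bS : bmeas S by apply: bmeas_sum => u; exact: bmeas_sum.
have F0 u v w : 0 <= (if u != v then \1_(A `&` jumps t h u v) w else 0 : R).
  by case: ifP => // _; rewrite indicE.
have mAm : measurable (A `&` moved t (t + h)).
  by apply: measurableI => //; apply: measurable_moved => //; rewrite addr_ge0// ltW.
apply: (@le_trans _ _ (Ex S)).
  rewrite -Ex_indic//; apply: Ex_le => //; first exact: bmeas_indic.
  move=> w; rewrite indicE; case: (boolP (w \in _)) => [|_]; last first.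
    by apply: sumr_ge0 => u _; apply: sumr_ge0.
  rewrite inE => -[Aw mw]; have [v jv] := moved_jump t0' h0 mw.
  rewrite /S (bigD1 (X t w))//= (bigD1 v)//= jv.1 indicE mem_set//= -addrA lerDl.
  apply: addr_ge0; first exact: sumr_ge0.
  by apply: sumr_ge0 => u _; exact: sumr_ge0.
rewrite /S Ex_sum; last by move=> u; exact: bmeas_sum.
apply: (@le_trans _ _ (\sum_(u : V) \sum_(v : V) c * h * pr A)).
  apply: ler_sum => u _; rewrite Ex_sum//; apply: ler_sum => v _.
  have cA : 0 <= c * h * pr A by rewrite !mulr_ge0 ?pr_ge0// ltW.
  case: (boolP (u != v)) => uv; last by rewrite Ex_const.
  by rewrite Ex_indic ?one//; apply: measurableI => //; exact: measurable_jumps.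
have sumE (x : R) : \sum_(v : V) x = #|V|%:R * x by rewrite sumr_const mulr_natl.
rewrite !sumE; have : 0 <= h * pr A by rewrite mulr_ge0 ?pr_ge0// ltW.
have -> : #|V|%:R * (#|V|%:R * (c * h * pr A)) = #|V|%:R * #|V|%:R * c * (h * pr A) by ring.
by rewrite -(mulrA _ h) mulrDl mul1r lerDl.
Qed.

(** On the grid with 2^n cells, the changes before and within one cell have
    probability at most C h times C h / 2^n, since the first one belongs to the past of
    the cell. The sum over the cells does not depend on n, and the events increase
    with n. *)
Lemma multi_moves_pr_le T : exists2 C, 0 < C & exists2 dl, 0 < dl &
  forall h t, 0 < h < dl -> 0 < t <= T -> pr (moved t (t + h)) <= C * h /\
    pr (multi_moves t h) <= C * h * (C * h).
Proof.
(* The grid points after t may exceed T, but not T + 1. *)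
have [C C0 [dl dl0 dlP]] := moved_set_le (T + 1).
exists C => //; exists (Num.min dl 1); first by rewrite lt_min dl0 ltr01.
move=> h t /andP[h0]; rewrite lt_min => /andP[hdl h1] /andP[t0 tT].
have t0' := ltW t0.
have mv h' : 0 < h' <= h -> pr (moved t (t + h')) <= C * h'.
  move=> /andP[h'0 h'h].
  have := dlP h' t setT; rewrite setTI pr_setT mulr1; apply.
  - by rewrite h'0 (le_lt_trans h'h).
  - by rewrite t0/=; lra.
  - exact: measurableT.
split; first by apply: mv; rewrite h0 lexx.
have Ch0 : 0 <= C * h by rewrite mulr_ge0// ltW.
apply: pr_bigcup_nondecr => [n|n w|n]; first exact: measurable_two_moves.
  exact: two_changes_refine.
have p0 : 0 < (2 ^ n)%:R :> R by rewrite ltr0n expn_gt0.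
have g0 k : 0 <= grid t h n k by rewrite (le_trans t0')// grid_ge// ltW.
pose F k := moved t (grid t h n k) `&` moved (grid t h n k) (grid t h n k.+1).
have mF k : measurable (F k) by apply: measurableI; exact: measurable_moved.
have bF k : bmeas (\1_(F k) : Omega -> R) by exact: bmeas_indic.
have Fle k : (k < 2 ^ n)%N -> pr (F k) <= C * h * (C * (h / (2 ^ n)%:R)).
  move=> kn; have gt0 : 0 < grid t h n k by apply: lt_le_trans t0 _; exact/grid_ge/ltW.
  have gle : grid t h n k <= t + h by apply: grid_le; [exact: ltW|exact: ltnW].
  have hm : 0 < h / (2 ^ n)%:R by rewrite divr_gt0.
  have hmh : h / (2 ^ n)%:R <= h.
    by rewrite ler_pdivrMr// ler_peMr ?(ltW h0)// ler1n expn_gt0.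
  apply: (@le_trans _ _ (C * (h / (2 ^ n)%:R) * pr (moved t (grid t h n k)))).
    rewrite /F gridS; apply: dlP.
    - by rewrite hm (le_lt_trans hmh).
    - by rewrite gt0/=; lra.
    - by apply: past_moved; rewrite ?g0 ?lexx// t0'/= grid_ge// ltW.
  rewrite [leRHS]mulrC; apply: ler_wpM2l; first by rewrite mulr_ge0// ltW.
  have [->|k0] := eqVneq k 0%N.
    rewrite grid0 (_ : moved t t = set0) ?/pr ?measure0//.
    by apply/seteqP; split => // w; rewrite /moved /= eqxx.
  have kp : 0 < h * (k%:R / (2 ^ n)%:R) by rewrite mulr_gt0// divr_gt0// ltr0n lt0n.
  have kh : h * (k%:R / (2 ^ n)%:R) <= h.
    by rewrite ler_piMr ?(ltW h0)// ler_pdivrMr// mul1r ler_nat ltnW.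
  apply: (@le_trans _ _ (C * (h * (k%:R / (2 ^ n)%:R)))); first by apply: mv; rewrite kp.
  by apply: ler_wpM2l; rewrite ?(ltW C0).
apply: (@le_trans _ _ (Ex (fun w => \sum_(k < 2 ^ n) \1_(F k) w))).
  rewrite -Ex_indic; last exact: measurable_two_moves.
  apply: Ex_le; first by apply: bmeas_indic; exact: measurable_two_moves.
    exact: bmeas_sum.
  move=> w; rewrite indicE; case: (boolP (w \in _)) => [|_]; last first.
    by apply: sumr_ge0 => k _; rewrite indicE.
  rewrite inE => -[k kn kP]; rewrite (bigD1 (Ordinal kn))//= indicE mem_set//= lerDl.
  by apply: sumr_ge0 => j _; rewrite indicE.
rewrite Ex_sum//.
apply: (@le_trans _ _ (\sum_(k < 2 ^ n) C * h * (C * (h / (2 ^ n)%:R)))).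
  by apply: ler_sum => k _; rewrite Ex_indic//; exact: Fle.
rewrite sumr_const card_ord -[leLHS]mulr_natl le_eqVlt; apply/orP; left; apply/eqP.
by field; rewrite gt_eqF.
Qed.

(** * Increment of the Lyapunov function over a short time *)

Section OneStep.
Variables (a b : V) (G : V -> (V -> R) -> R).
Hypothesis HG : lyapunov al a b G.

Definition lyap_value t w : R := G (X t w) (ltime t w).
Definition jump_part u (L : V -> R) : R := \sum_v W al (L v) * (G v L - G u L).

Lemma nice_jump_part u : nice (jump_part u).
Proof.
apply: nice_sum => v; apply: nice_mul; first exact: (proj1 (pnice_W al v)).
by apply: nice_add; [|apply: nice_opp]; exact: (lyap_nice HG).
Qed.

Lemma past_nice f t : nice f -> 0 <= t ->
  measurable_fun [set: past t] (fun w : past t => f (ltime t w)).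
Proof.
move=> nf t0; apply: (@nice_meas _ _ _ nf _ (past t) (fun v w => ltime t w v)).
  by move=> v; exact: measurable_ltime.
by move=> v w; exact: ltime_gt0.
Qed.

Lemma exists_common_lower (f : V -> R) : (forall v, 0 < f v) ->
  exists2 m, 0 < m & forall v, m <= f v.
Proof.
move=> f0; have S0 : 0 <= \sum_v (f v)^-1 by apply: sumr_ge0 => v _; rewrite invr_ge0 ltW.
exists (\sum_v (f v)^-1 + 1)^-1; first by rewrite invr_gt0 ltr_wpDl.
move=> v; rewrite -[leRHS]invrK lef_pV2 ?posrE ?invr_gt0 ?ltr_wpDl//.
rewrite (bigD1 v)//= -addrA lerDl addr_ge0// sumr_ge0// => u _.
by rewrite invr_ge0 ltW.
Qed.

Lemma ltime_box T : exists2 l, 0 < l & exists M, forall t w, 0 <= t <= T ->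
  box l M (ltime t w).
Proof.
have [l l0_ lP] := exists_common_lower hl0; exists l => //.
exists (\sum_v l0 v + T) => t w /andP[t0 tT] v; apply/andP; split.
  exact: le_trans (lP v) (ltime_ge w v t0).
apply: le_trans (ltime_le w v t0) _; rewrite lerD//.
by rewrite (bigD1 v)//= lerDl sumr_ge0// => u _; exact: ltW.
Qed.

Lemma exists_common_bound (F : V -> (V -> R) -> R) l M : (forall v, nice (F v)) -> 0 < l ->
  exists2 K, 0 < K & forall v L, box l M L -> `|F v L| <= K.
Proof.
move=> nF l_gt0; have [k kP] := choice (fun v => nice_bound (nF v) M l_gt0).
exists (\sum_v `|k v| + 1); first by rewrite ltr_wpDl// sumr_ge0.
move=> v L /kP /le_trans; apply; apply: (le_trans (ler_norm _)).
by rewrite (bigD1 v)//= -addrA lerDl addr_ge0// sumr_ge0.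
Qed.

Lemma exists_common_delta (F : V -> (V -> R) -> R) l M e : (forall v, nice (F v)) ->
  0 < l -> 0 < e -> exists2 dl, 0 < dl & forall v L L', box l M L -> box l M L' ->
    (forall u, `|L u - L' u| <= dl) -> `|F v L - F v L'| <= e.
Proof.
move=> nF l_gt0 e0.
have ex v : exists dl, 0 < dl /\ forall L L', box l M L -> box l M L' ->
    (forall u, `|L u - L' u| <= dl) -> `|F v L - F v L'| <= e.
  by have [dl dl0 H] := nice_unif (nF v) M l_gt0 e0; exists dl.
have [dl dlP] := choice ex.
have [m m0 mP] := exists_common_lower (fun v => (dlP v).1).
exists m => // v L L' LB LB' LL'; apply: (dlP v).2 => // u.
exact: le_trans (LL' u) (mP v).
Qed.

Lemma bmeas_nice f t : nice f -> 0 <= t -> bmeas (fun w => f (ltime t w)).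
Proof.
move=> nf t0; split; first exact: past_measurable_fun (past_nice nf t0).
have [l l_gt0 [M B]] := ltime_box t; have [K KP] := nice_bound nf M l_gt0.
by exists K => w; apply: KP; apply: B; rewrite t0 lexx.
Qed.

Lemma bmeas_lyap_value t : 0 <= t -> bmeas (lyap_value t).
Proof.
move=> t0; rewrite (_ : lyap_value t =
    fun w => \sum_u \1_(located t u) w * G u (ltime t w)).
  apply: bmeas_sum => u; apply: bmeas_mul; first exact: bmeas_past (past_located u t0).
  by apply: bmeas_nice => //; exact: (lyap_nice HG).
apply/funext => w; rewrite (bigD1 (X t w))//= big1 => [|u uX].
  by rewrite addr0 indicE mem_set// mul1r.
by rewrite indicE memNset ?mul0r// /located/= => E; rewrite E eqxx in uX.
Qed.

(** The compensated jumps of G with the local times frozen at time t. The sum over u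
    keeps only u = X t w, and makes each summand the product of a function of the
    past with [jump_noise]. *)
Definition noise_sum t h w : R :=
  \sum_u \sum_v (G v (ltime t w) - G u (ltime t w)) * jump_noise t h u v w.

Lemma noise_sumE t h w : noise_sum t h w =
  \sum_v (G v (ltime t w) - G (X t w) (ltime t w)) * \1_(jumps t h (X t w) v) w
  - h * jump_part (X t w) (ltime t w).
Proof.
rewrite /noise_sum (bigD1 (X t w))//= [X in _ + X]big1 ?addr0; last first.
  move=> u uX; apply: big1 => v _; rewrite /jump_noise !indicE !memNset ?mul0r ?mulr0 ?subr0 ?mulr0//.
    by rewrite /located/= => E; rewrite E eqxx in uX.
  by move=> [_ [E _]]; rewrite E eqxx in uX.
rewrite /jump_part mulr_sumr -sumrB; apply: eq_bigr => v _.
rewrite /jump_noise [\1_(located t _) w]indicE mem_set// mul1r /rate; ring.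
Qed.

(** Outside the event of several moves the path is constant or jumps once. If it is
    constant, the compensator in [noise_sum] is the jump part that the descent
    inequality provides. If it jumps once, the jump of G is in [noise_sum] and the
    change of the local times costs at most e + h K. Several moves are bounded crudely. *)
Lemma increment_le T e : 0 < e -> exists K, exists2 dl, 0 < dl &
  0 <= K /\ forall h t w, 0 < h < dl -> 0 < t <= T ->
    lyap_value (t + h) w - lyap_value t w <= noise_sum t h w + e * h
      + (e + h * K) * \1_(moved t (t + h)) w + K * \1_(multi_moves t h) w.
Proof.
move=> e0; have [l l_gt0 [M B]] := ltime_box (T + 1).
have [KG KG0 KGP] := exists_common_bound M (lyap_nice HG) l_gt0.
have [KJ KJ0 KJP] := exists_common_bound M nice_jump_part l_gt0.
have [d1 d10 d1P] := exists_common_delta M (lyap_nice HG) l_gt0 e0.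
have [d2 d20 d2P] := exists_common_delta M nice_jump_part l_gt0 e0.
pose N : R := #|V|%:R * (#|V|%:R * (2 * KG * (1 + rmax T))).
have N0 : 0 <= N by rewrite !mulr_ge0 ?(ltW KG0)// addr_ge0// rmax_ge0.
exists (KJ + 2 * KG + N), (Num.min 1 (Num.min d1 d2)).
  by rewrite !lt_min ltr01 d10.
split; first by rewrite !addr_ge0 ?(ltW KJ0)// mulr_ge0 ?(ltW KG0).
move=> h t w /andP[h0]; rewrite !lt_min => /andP[h1 /andP[hd1 hd2]] /andP[t0 tT].
have t0' := ltW t0; have h0' := ltW h0.
have BL : box l M (ltime t w) by apply: B; rewrite t0'/=; lra.
have BL' : box l M (ltime (t + h) w) by apply: B; apply/andP; split; lra.
have LL' u : `|ltime (t + h) w u - ltime t w u| <= h.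
  have := local_time_nondecr l0 Xc u w t0' h0'; have := local_time_incr l0 Xc u w t0' h0'.
  by rewrite -!/(ltime _ w u) => q1 q2; rewrite ger0_norm; lra.
have i01 A : 0 <= (\1_A w : R) <= 1 by rewrite indicE; case: (w \in A); rewrite ?lexx ?ler01.
have /andP[m0 m1] := i01 (moved t (t + h)); have /andP[r0 r1] := i01 (multi_moves t h).
set K := KJ + 2 * KG + N.
have K0 : 0 <= K by rewrite !addr_ge0 ?(ltW KJ0)// mulr_ge0 ?(ltW KG0).
have eh0 : 0 <= e * h by rewrite mulr_ge0 // ltW.
have eK0 : 0 <= (e + h * K) * \1_(moved t (t + h)) w.
  by rewrite mulr_ge0// addr_ge0 ?(ltW e0)// mulr_ge0.
have Kr0 : 0 <= K * \1_(multi_moves t h) w by rewrite mulr_ge0.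
have [ret|nret] := pselect (multi_moves t h w).
  have dN : `|noise_sum t h w| <= N.
    apply: le_trans (ler_norm_sum _ _ _) _.
    apply: (@le_trans _ _ (\sum_(u : V) \sum_(v : V) 2 * KG * (1 + rmax T))).
      apply: ler_sum => u _; apply: le_trans (ler_norm_sum _ _ _) _.
      apply: ler_sum => v _; rewrite normrM; apply: ler_pM => //.
        apply: le_trans (ler_normB _ _) _.
        have := KGP u _ BL; have := KGP v _ BL; lra.
      rewrite /jump_noise; apply: le_trans (ler_normB _ _) _; apply: lerD.
        by have /andP[? ?] := i01 (jumps t h u v); rewrite ger0_norm.
      have /andP[q1 q2] := i01 (located t u).
      have rl : rate t v w <= rmax T by apply: rate_le; rewrite t0'.
      have rg := rate_ge0 t v w.
      rewrite ger0_norm; last by rewrite !mulr_ge0.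
      rewrite -[leRHS]mul1r; apply: ler_pM; rewrite ?mulr_ge0 ?(ltW h1)//.
      by rewrite -[leRHS]mul1r; apply: ler_pM.
    have sumE (x : R) : \sum_(v : V) x = #|V|%:R * x by rewrite sumr_const mulr_natl.
    by rewrite !sumE.
  rewrite [\1_(multi_moves _ _) w]indicE mem_set// mulr1.
  have := KGP (X (t + h) w) _ BL'; have := KGP (X t w) _ BL.
  rewrite /lyap_value !ler_norml => /andP[x1 x2] /andP[x3 x4].
  move: dN; rewrite ler_norml => /andP[x5 x6].
  move: eK0; set z := (e + h * K) * _ => eK0.
  have KE : K = KJ + 2 * KG + N by [].
  move: x1 x2 x3 x4 x5 eK0 eh0 KE KJ0; clear; lra.
have jE v := not_multi_moves_jump v t0' h0 nret.
(* No move: only the local time of X t w grows. *)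
have [E|E] := eqVneq (X (t + h) w) (X t w).
  have stay s : t <= s <= t + h -> X s w = X t w.
    by move=> sI; have [|->] := not_multi_moves t0' h0 nret sI.
  have dE : noise_sum t h w = - (h * jump_part (X t w) (ltime t w)).
    rewrite noise_sumE big1 ?sub0r// => v _; rewrite indicE memNset ?mulr0//.
    by move=> /jE[uv Xv]; move: uv; rewrite -Xv E eqxx.
  have LE : ltime (t + h) w = shift (ltime t w) (X t w) h.
    exact: local_time_stay.
  have Lt0 v : 0 < ltime t w v by exact: ltime_gt0.
  have [s /andP[s0 sh] sP] := lyap_descent HG (X t w) Lt0 h0'.
  rewrite /lyap_value E LE; rewrite -/(jump_part _ _) in sP.
  have shB : box l M (shift (ltime t w) (X t w) s).
    move=> v; have /andP[q1 q2] := BL v; have /andP[q3 q4] := BL' v.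
    have q5 : 0 <= (if v == X t w then s else 0) <= (if v == X t w then h else 0).
      by case: ifP => _; rewrite ?s0 ?lexx.
    move: q4 q5; rewrite LE /shift; set z := if _ then h else 0.
    set y := if _ then s else 0 => q4 /andP[y0 yz].
    apply/andP; split; first by rewrite (le_trans q1)// lerDl.
    by apply: le_trans q4; rewrite lerD2l.
  have := d2P (X t w) _ _ BL shB.
  have dsh u : `|ltime t w u - shift (ltime t w) (X t w) s u| <= d2.
    rewrite /shift opprD addrA subrr sub0r normrN; case: (u == X t w).
      by rewrite ger0_norm//; apply: le_trans sh _; exact: ltW.
    by rewrite normr0 ltW.
  move=> /(_ dsh); rewrite ler_norml => /andP[q1 q2].
  have := ler_wpM2l h0' q2; rewrite mulrBr => q3.
  rewrite dE; lra.
have mw : moved t (t + h) w by [].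
have dE : noise_sum t h w = G (X (t + h) w) (ltime t w) - G (X t w) (ltime t w)
    - h * jump_part (X t w) (ltime t w).
  rewrite noise_sumE (bigD1 (X (t + h) w))//= big1 ?addr0; last first.
    move=> v vE; rewrite indicE memNset ?mulr0//.
    by move=> /jE[_ Xv]; rewrite Xv eqxx in vE.
  by rewrite indicE mem_set ?mulr1//; apply/jE; rewrite eq_sym.
have LL1 u : `|ltime (t + h) w u - ltime t w u| <= d1 by apply: le_trans (LL' u) _; exact: ltW.
have := d1P (X (t + h) w) _ _ BL' BL LL1.
have := KJP (X t w) _ BL; rewrite !ler_norml => /andP[x1 x2] /andP[x3 x4].
have := ler_wpM2l h0' x2 => x5.
have KJK : h * KJ <= h * K.
  apply: ler_wpM2l => //; rewrite /K -addrA lerDl addr_ge0// mulr_ge0// ltW//.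
rewrite dE /lyap_value [\1_(moved _ _) w]indicE mem_set// mulr1; lra.
Qed.

(** * Supermartingale inequality and blow-up event *)

(** Given the past, the mean of [jump_noise] is o(h), and the factors G v - G u are
    bounded functions of the past. *)
Lemma noise_sum_small T e : 0 < e -> exists2 dl, 0 < dl & forall h t,
  0 < h < dl -> 0 < t <= T -> Ex (noise_sum t h) <= e * h.
Proof.
move=> e0; have [l l_gt0 [M B]] := ltime_box T.
have [KG KG0 KGP] := exists_common_bound M (lyap_nice HG) l_gt0.
pose n : R := #|V|%:R * #|V|%:R.
have n0 : 0 <= n by rewrite mulr_ge0.
have c0 : 0 < n * (3 * (2 * KG)) + 1 by rewrite ltr_wpDl// !mulr_ge0// ltW.
have e'0 : 0 < e / (n * (3 * (2 * KG)) + 1) by rewrite divr_gt0.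
have [dl dl0 dlP] := jump_noise_set_le T e'0.
exists dl => // h t hdl tT; have /andP[h0 _] := hdl; have /andP[t0 tT'] := tT.
have t0' := ltW t0; set e' := e / _ in e'0 dlP *.
have eh0 : 0 <= e' * h by rewrite mulr_ge0// ltW.
pose D u v w := G v (ltime t w) - G u (ltime t w).
have nD u v : nice (fun L => G v L - G u L).
  by apply: nice_add; [|apply: nice_opp]; exact: (lyap_nice HG).
have bD u v : bmeas (D u v) by exact: (bmeas_nice (nD u v)).
have bg u v := bmeas_jump_noise u v t0' h0.
have DK u v w : `|D u v w| <= 2 * KG.
  have LB : box l M (ltime t w) by apply: B; rewrite t0'.
  apply: le_trans (ler_normB _ _) _.
  by rewrite mulr_natl mulr2n; apply: lerD; exact: KGP.
have one u v : Ex (fun w => D u v w * jump_noise t h u v w) <= 3 * (2 * KG) * (e' * h).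
  have [uv|uv] := eqVneq u v.
    rewrite (_ : (fun w => _) = (fun=> 0)); last first.
      by apply/funext => w; rewrite /D uv subrr mul0r.
    by rewrite Ex_const mulr_ge0// mulr_ge0// mulr_ge0// ltW.
  apply: le_trans (ler_norm _) _.
  apply: (@Ex_mul_le_of_sets _ _ _ P (fun A => measurable (A : set (past t)))) => //.
  - by move=> A; exact: past_measurable.
  - by rewrite mulr_gt0.
  - move=> r; have := past_nice (nD u v) t0' => /(_ measurableT `[r, +oo[%classic).
    rewrite setTI => /(_ (measurable_itv _)).
    by congr measurable; apply/seteqP; split => w; rewrite /= in_itv/= andbT.
  - move=> A mA; apply: le_trans (dlP h t u v A hdl tT uv mA) _.
    rewrite -[leRHS]mulr1; apply: ler_wpM2l => //; apply: pr_le1.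
    by apply: measurableI; [exact: past_measurable mA|exact: past_measurable (past_located u t0')].
have bDg u v : bmeas (fun w => D u v w * jump_noise t h u v w) := bmeas_mul (bD u v) (bg u v).
rewrite /noise_sum Ex_sum; last by move=> u; apply: bmeas_sum => v; exact: bDg.
apply: (@le_trans _ _ (\sum_(u : V) \sum_(v : V) 3 * (2 * KG) * (e' * h))).
  apply: ler_sum => u _; rewrite Ex_sum; last by move=> v; exact: bDg.
  by apply: ler_sum => v _; exact: one.
have sumE (x : R) : \sum_(v : V) x = #|V|%:R * x by rewrite sumr_const mulr_natl.
rewrite !sumE (_ : #|V|%:R * (#|V|%:R * _) = n * (3 * (2 * KG)) * e' * h); last by rewrite /n; ring.
rewrite ler_pM2r// /e' mulrC mulrAC ler_pdivrMr// ler_pM2l// lerDl//.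
Qed.

Lemma bmeas_noise_sum t h : 0 <= t -> 0 < h -> bmeas (noise_sum t h).
Proof.
move=> t0 h0; apply: bmeas_sum => u; apply: bmeas_sum => v.
apply: bmeas_mul; last exact: bmeas_jump_noise.
apply: (@bmeas_nice (fun L => G v L - G u L)) => //.
by apply: nice_add; [|apply: nice_opp]; exact: (lyap_nice HG).
Qed.

(** A move costs e + h K and has probability O(h); several moves cost K and have
    probability O(h^2). All remainders are thus o(h), uniformly in t. *)
Lemma lyap_value_step T eta : 0 < eta -> exists2 dl, 0 < dl & forall h t,
  0 < h < dl -> 0 < t <= T -> Ex (lyap_value (t + h)) <= Ex (lyap_value t) + eta * h.
Proof.
move=> eta0; have [C C0 [d1 d10 d1P]] := multi_moves_pr_le T.
have e0 : 0 < eta / (4 * (C + 1)) by rewrite divr_gt0// mulr_gt0// ltr_wpDl// ltW.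
have [K [d2 d20 [K0 d2P]]] := increment_le T e0; set e := eta / _ in e0 d2P.
(* The terms of first order in e, the noise, and the terms of order h^2 each
   amount to at most eta h / 4. *)
have eC : e * (C + 1) = eta / 4.
  by rewrite /e; field; rewrite gt_eqF// ltr_wpDl// ltW.
have e4 : 0 < eta / 4 by rewrite divr_gt0.
have [d3 d30 d3P] := noise_sum_small T e4.
pose z := K * C + K * (C * C).
have z0 : 0 <= z by rewrite addr_ge0// !mulr_ge0// ltW.
pose d4 := eta / (4 * (z + 1)).
have d40 : 0 < d4 by rewrite divr_gt0// mulr_gt0// ltr_wpDl.
exists (Num.min (Num.min d1 d2) (Num.min d3 d4)); first by rewrite !lt_min d10 d20 d30.
move=> h t /andP[h0]; rewrite !lt_min => /andP[/andP[hd1 hd2] /andP[hd3 hd4]] tT.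
have /andP[t0 _] := tT; have t0' := ltW t0.
have th0 : 0 <= t + h by rewrite addr_ge0// ltW.
have [m1 m2] := d1P h t (introT andP (conj h0 hd1)) tT.
have m3 := d3P h t (introT andP (conj h0 hd3)) tT.
have bm : bmeas (\1_(moved t (t + h)) : Omega -> R).
  by apply: bmeas_indic; exact: measurable_moved.
have br : bmeas (\1_(multi_moves t h) : Omega -> R).
  by apply: bmeas_indic; exact: measurable_multi_moves.
have bd := bmeas_noise_sum t0' h0.
have bv := bmeas_lyap_value t0'; have bv' := bmeas_lyap_value th0.
have b1 : bmeas (fun w => lyap_value t w + (noise_sum t h w + e * h)).
  by apply: bmeas_add => //; apply: bmeas_add => //; exact: bmeas_const.
have b2 : bmeas (fun w => (e + h * K) * \1_(moved t (t + h)) w) by exact: bmeas_scale.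
have b3 : bmeas (fun w => K * \1_(multi_moves t h) w) by exact: bmeas_scale.
have b4 := bmeas_add b1 b2; have b5 := bmeas_add b4 b3.
have bound := Ex_le P bv' b5; apply: le_trans.
  apply: bound => w; have := d2P h t w (introT andP (conj h0 hd2)) tT.
  set x1 := (_ + h * K) * _; set x2 := K * _; lra.
rewrite !ExD//; [|exact: bmeas_const|by apply: bmeas_add => //; exact: bmeas_const].
rewrite Ex_const !ExZ// !Ex_indic; [|exact: measurable_multi_moves|exact: measurable_moved].
have hK : 0 <= h * K by rewrite mulr_ge0// ltW.
have q1 : (e + h * K) * pr (moved t (t + h)) <= (e + h * K) * (C * h).
  by apply: ler_wpM2l => //; rewrite addr_ge0// ltW.
have q2 : K * pr (multi_moves t h) <= K * (C * h * (C * h)) by exact: ler_wpM2l.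
have q3 : h * z * h <= eta / 4 * h.
  rewrite ler_pM2r//; apply: (@le_trans _ _ (d4 * (z + 1))).
    by apply: ler_pM => //; rewrite ?(ltW h0) ?(ltW hd4)// lerDl.
  rewrite /d4 le_eqVlt; apply/orP; left; apply/eqP; field.
  by rewrite gt_eqF// ltr_wpDl.
have q4 : e * h + e * (C * h) = eta / 4 * h by rewrite -eC; ring.
have q5 : h * z * h = h * K * (C * h) + K * (C * h * (C * h)) by rewrite /z; ring.
have q6 : (e + h * K) * (C * h) = e * (C * h) + h * K * (C * h) by ring.
have q7 : 0 <= eta / 4 * h by rewrite mulr_ge0// ltW.
have -> : eta * h = 4 * (eta / 4 * h) by field.
rewrite q6 in q1; move: q1 q2 q3 q4 q5 q7 m3; clear.
set x1 := eta / 4 * h; set y1 := (e + h * K) * _; set y2 := K * pr _.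
set y3 := h * z * h; set y4 := K * _; set y5 := h * K * _.
set y6 := e * h; set y7 := e * _; set y8 := Ex (lyap_value t); set y9 := Ex _.
lra.
Qed.

Lemma iterate_steps (f : R -> R) (eta h T : R) n : 0 <= h -> 1 + h * n%:R <= T ->
  (forall t, 0 < t <= T -> f (t + h) <= f t + eta * h) ->
  f (1 + h * n%:R) <= f 1 + eta * (h * n%:R).
Proof.
move=> h0 + fstep; elim: n => [|n IH] nT; first by rewrite !mulr0 !addr0.
have hn : 0 <= h * n%:R by rewrite mulr_ge0.
have E : 1 + h * n.+1%:R = 1 + h * n%:R + h by rewrite -natr1 mulrDr mulr1 addrA.
rewrite E in nT *.
have nT' : 1 + h * n%:R <= T by apply: le_trans nT; rewrite lerDl.
apply: (le_trans (fstep _ _)); first by rewrite nT' andbT ltr_wpDr.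
by rewrite -natr1 mulrDr mulr1 (mulrDr eta) addrA lerD2r; exact: IH.
Qed.

(** Steps of length h < dl over [1, T] add up to an excess of at most eta (T - 1), for
    every eta > 0. The start at time 1 is due to the jump rates being
    given at positive times. *)
Lemma lyap_value_decreases T : 1 <= T -> Ex (lyap_value T) <= Ex (lyap_value 1).
Proof.
rewrite le_eqVlt => /predU1P[<-//|T1]; apply/ler_addgt0Pr => z z0.
have T10 : 0 < T - 1 by rewrite subr_gt0.
have eta0 : 0 < z / (T - 1) by rewrite divr_gt0.
have [dl dl0 dlP] := lyap_value_step T eta0.
have [n /(_ n (leqnn n)) hdl] := mesh_small T10 dl0.
have p0 : (2 ^ n)%:R != 0 :> R by rewrite pnatr_eq0 expn_eq0.
have h0 : 0 < (T - 1) / (2 ^ n)%:R by rewrite divr_gt0// ltr0n expn_gt0.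
have := @iterate_steps (fun t => Ex (lyap_value t)) _ _ T (2 ^ n) (ltW h0) _
  (fun t tT => dlP _ t (introT andP (conj h0 hdl)) tT).
by rewrite divfK// (addrC 1) subrK divfK ?gt_eqF//; exact.
Qed.

Definition both_infinite : set Omega := [set w |
  (forall M, exists2 t, 0 <= t & M <= ltime t w a) /\
  (forall M, exists2 t, 0 <= t & M <= ltime t w b)].

Lemma ltime_mono s t w v : 0 <= s -> s <= t -> ltime s w v <= ltime t w v.
Proof.
move=> s0 st; have := local_time_nondecr l0 Xc v w s0 (_ : 0 <= t - s).
by rewrite subr_ge0 addrC subrK; apply.
Qed.

(** On this event the Lyapunov function tends to infinity along the integers, whereas
    by Markov's inequality the probability that it exceeds m + k at a given time
    is O(1 / k). *)
Lemma both_infinite_negligible : P.-negligible both_infinite.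
Proof.
have [l l_gt0 lP] := exists_common_lower hl0.
have [m mP] := lyap_lower HG l_gt0.
have Ll t w v : 0 <= t -> l <= ltime t w v.
  by move=> t0; apply: le_trans (lP v) _; exact: ltime_ge.
have mv t w : 0 <= t -> m <= lyap_value t w by move=> t0; apply: mP => v; exact: Ll.
pose big (K : R) (n : nat) : set Omega := [set w | K <= lyap_value n.+1%:R w].
have mbig K n : measurable (big K n).
  have := (bmeas_lyap_value (ler0n R n.+1)).1 measurableT `[K, +oo[%classic.
  rewrite setTI => /(_ (measurable_itv _)).
  by congr measurable; apply/seteqP; split => w; rewrite /= in_itv/= andbT.
pose c1 := Ex (lyap_value 1) - m.
have c10 : 0 <= c1.
  rewrite subr_ge0 -(Ex_const P m); apply: Ex_le; first exact: bmeas_const.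
    exact: bmeas_lyap_value.
  by move=> w; exact: mv.
have prbig (k : R) n : 0 < k -> pr (big (m + k) n) <= c1 / k.
  move=> k0; rewrite ler_pdivlMr// mulrC -Ex_indic//.
  have bi : bmeas (\1_(big (m + k) n) : Omega -> R) by exact: bmeas_indic.
  have bv := bmeas_lyap_value (ler0n R n.+1).
  rewrite -ExZ//; apply: (@le_trans _ _ (Ex (fun w => lyap_value n.+1%:R w - m))).
    apply: Ex_le; [exact: bmeas_scale|by apply: bmeas_sub => //; exact: bmeas_const|].
    move=> w; have mvw := mv n.+1%:R w (ler0n _ _).
    rewrite indicE; case: (boolP (w \in _)); rewrite ?mulr1 ?mulr0 ?subr_ge0//.
    by rewrite inE /big/= lerBrDl.
  rewrite ExB//; last exact: bmeas_const.
  by rewrite Ex_const lerD2r; apply: lyap_value_decreases; rewrite ler1n.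
pose Z k := \bigcup_n0 \bigcap_(n >= n0) big (m + k.+1%:R) n.
have mcap k n0 : measurable (\bigcap_(n >= n0) big (m + k.+1%:R) n).
  by apply: bigcap_measurable => [|n _]; [exists n0 => /=|exact: mbig].
have mZ k : measurable (Z k) by exact: bigcupT_measurable.
have prZ k : pr (Z k) <= c1 / k.+1%:R.
  apply: pr_bigcup_nondecr => // [n0 w H n /= nn|n0].
    by apply: H => /=; exact: ltnW.
  apply: le_trans (prbig k.+1%:R n0 _); last by rewrite ltr0n.
  by apply: pr_le => // w H; apply: H => /=.
have mI : measurable (\bigcap_k Z k) by exact: bigcapT_measurable.
exists (\bigcap_k Z k); split => //.
  rewrite -pr_fin//; congr EFin; apply/eqP; rewrite eq_le pr_ge0 andbT.
  apply/ler_addgt0Pr => e e0; rewrite add0r.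
  pose k := Num.truncn (c1 / e).
  apply: (@le_trans _ _ (pr (Z k))); first by apply: pr_le => // w; apply.
  apply: le_trans (prZ k) _; rewrite ler_pdivrMr ?ltr0n// mulrC -ler_pdivrMr//.
  by apply: ltW; exact: Num.Theory.truncnS_gt.
move=> w [Ha Hb] k _; have [M MP] := lyap_blowup HG (m + k.+1%:R) l_gt0.
have [ta ta0 Ma] := Ha M; have [tb tb0 Mb] := Hb M.
pose n0 := Num.truncn (Num.max ta tb).
have le_n0 n s : (n0 <= n)%N -> s <= Num.max ta tb -> s <= n.+1%:R.
  move=> nn sm; apply: (le_trans sm).
  apply: ltW; apply: lt_le_trans (Num.Theory.truncnS_gt _) _.
  by rewrite ler_nat ltnS.
exists n0 => // n /= nn; apply: MP.
- by move=> v; apply: Ll.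
- by apply: le_trans Ma _; apply: ltime_mono => //; apply: le_n0 => //; rewrite le_max lexx.
- by apply: le_trans Mb _; apply: ltime_mono => //; apply: le_n0 => //; rewrite le_max lexx orbT.
Qed.

End OneStep.

End Step.

(** * Localization on a single vertex *)

Theorem theorem2p1 (R : realType) (d : measure_display)
    (Omega : measurableType d) (P : probability Omega R) (V : finType)
    (l0 : V -> R) (alpha : R) (X : R -> Omega -> V)
    (hl0 : forall v, 0 < l0 v) (halpha : 1 < alpha)
    (hX : is_vrjp P (@complete_graph V) (fun x : R => x `^ alpha) l0 X) :
  {ae P, forall w, exists v : V,
     local_time l0 X v t w @[t --> +oo] --> +oo /\
     forall u : V, u != v ->
       exists M : R, forall t : R, 0 <= t -> local_time l0 X u t w <= M}.
Proof.
pose unbdd v w := forall M, exists2 t, 0 <= t & M <= local_time l0 X v t w.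
have pairs : {ae P, forall w, forall p : V * V, p.1 != p.2 -> ~ (unbdd p.1 w /\ unbdd p.2 w)}.
  apply: filter_forall => -[a b] /=.
  have [->|ab] := eqVneq a b; first exact: nearW.
  have [G HG] := exists_lyapunov halpha ab.
  have := both_infinite_negligible hl0 halpha hX HG; rewrite /almost_everywhere /=.
  apply: negligibleS => w /= H.
  by apply: contrapT => nb; apply: H => _ both; apply: nb.
apply: filterS pairs => w Hw.
have Xc := vrjp_cadlag hX.
have mono v s t : 0 <= s -> s <= t -> local_time l0 X v s w <= local_time l0 X v t w.
  by move=> s0 st; exact: (ltime_mono hX).
(* The local times add up to at least the elapsed time. *)
have [v Hv] : exists v, unbdd v w.
  apply: contrapT => nv.
  have bd v : exists M, forall t, 0 <= t -> local_time l0 X v t w <= M.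
    apply: contrapT => nM; apply: nv; exists v => M; apply: contrapT => nt.
    apply: nM; exists M => t t0; rewrite leNgt; apply/negP => Mt.
    by apply: nt; exists t => //; exact: ltW.
  have [M MP] := choice bd.
  have S0 : 0 <= \sum_v `|M v| + 1 by rewrite addr_ge0// sumr_ge0.
  have := local_time_sum_ge Xc w S0 (fun v => ltW (hl0 v)); apply/negP; rewrite -ltNge.
  apply: (@le_lt_trans _ _ (\sum_v `|M v|)); last by rewrite ltrDl.
  by apply: ler_sum => v _; apply: le_trans (MP v _ S0) _; exact: ler_norm.
exists v; split.
  apply/cvgryPge => M; have [t t0 Mt] := Hv M.
  apply: filterS (nbhs_pinfty_ge (num_real t)) => s ts.
  by apply: (le_trans Mt); exact: mono.
move=> u uv; apply: contrapT => nM; apply: (Hw (u, v)) => //=; split => // M.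
apply: contrapT => nt; apply: nM; exists M => t t0; rewrite leNgt; apply/negP => Mt.
by apply: nt; exists t => //; exact: ltW.
Qed.
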